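(* Let $M$ be the model class, $K_A$ the limiting spectral measure, and $\mathbb{P}_n^{\tau}$ the empirical angular measure of the thresholded samples, all as defined in the context. The following holds. (i) If $\frac{1}{2+\max\{1,\alpha\}}\le s<\frac12$, then there is a choice of thresholds $\tau_n=\tilde\Theta\big(n^{\frac{1}{\min\{2+\alpha,3\alpha\}}}\big)$ and there are constants $C>0$, $q\ge 0$ (not depending on $n$ or $\varepsilon$) such that for every $\varepsilon\in(0,\frac12)$, $$\liminf_{n\to\infty}\ \inf_{\mathcal{L}(X)\in M} P\Big(\mathbb{W}_p^p(\mathbb{P}_n^{\tau_n},K_A)\le C\,(\log n)^q\,(-\log\varepsilon)^{\frac12}\, n^{-\frac{1}{2+\max\{1,\alpha\}}}\Big)\ \ge\ 1-\varepsilon .$$ (ii) If $0<s<\frac{1}{2+\max\{1,\alpha\}}$, then there is a choice of thresholds $\tau_n=\Theta\big(n^{\frac{1-2s}{\alpha}}\big)$ and there is a constant $C>0$ (not depending on $n$ or $\varepsilon$) such that for every $\varepsilon\in(0,\frac12)$, $$\liminf_{n\to\infty}\ \inf_{\mathcal{L}(X)\in M} P\Big(\mathbb{W}_p^p(\mathbb{P}_n^{\tau_n},K_A)\le C\,(-\log\varepsilon)^{\frac12}\, n^{-s}\Big)\ \ge\ 1-\varepsilon .$$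
   Context: Constants: integers $m\ge d\ge 2$, $\alpha\in(0,\infty)$, $p\in[1,\infty)$, $0<l<1<u$, $\sigma>0$, $0<s<\frac12$, $0<\xi<1$, $\zeta>0$ are fixed. $\mathbb{R}_+=[0,\infty)$; $\|\cdot\|_1$ is the $\ell_1$-norm; $A_{\cdot i}$ is the $i$-th column of $A$; $JA=\sqrt{|\det(AA^\top)|}$ for $A\in\mathbb{R}^{d\times m}$. $\mathcal{L}(X)$ is the law of $X$. $a_n=\Theta(b_n)$ means that $a_n/b_n$ is bounded above and bounded away from $0$ for large $n$; $\tilde\Theta$ means the same up to poly-logarithmic factors in $n$. Model class. $\mathcal{A}=\{A\in\mathbb{R}_+^{d\times m}: l\le\min_i\|A_{\cdot i}\|_1\le\max_i\|A_{\cdot i}\|_1\le u,\ JA\ge\sigma\}$. For each integer $k\ge1$, $\tilde M_k$ is the set of laws of random vectors $Z$ in $\mathbb{R}_+^m$ admitting a Lebesgue density $g$ on $\mathbb{R}_+^m$ such that (a) for all $z$, $\left|\frac{g(z)-\alpha^m\prod_{i=1}^m(1+z_i)^{-(\alpha+1)}}{\alpha^m\prod_{i=1}^m(1+z_i)^{-(\alpha+1)}}\right|\le\xi k^{-s}$, and (b) $g(z)\propto\prod_{i=1}^m(1+z_i)^{-(\alpha+1)}$ on $\{z:\|z\|_1>\zeta k^{\frac{1-2s}{\alpha}}\}$ (i.e. equality up to a multiplicative constant on this set). $M_k=\{\mathcal{L}(X):X=AZ,\ A\in\mathcal{A},\ \mathcal{L}(Z)\in\tilde M_k\}$ and $M=\bigcup_{k=1}^\infty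 M_k$. For $\mathcal{L}(X)\in M$, $A$ denotes the matrix in the representation $X=AZ$, and $P$ is the probability when $X^{(1)},\dots,X^{(n)}$ are i.i.d. with law $\mathcal{L}(X)$. Spectral measure. $K_A=\sum_{i=1}^m\frac{\|A_{\cdot i}\|_1^\alpha}{\sum_{j=1}^m\|A_{\cdot j}\|_1^\alpha}\,\delta_{A_{\cdot i}/\|A_{\cdot i}\|_1}$, a probability measure on $\aleph_+^1=\{\omega\in\mathbb{R}_+^d:\|\omega\|_1=1\}$. Wasserstein distance. For probability measures $\mu,\mu'$ on $\aleph_+^1$, $\mathbb{W}_p(\mu,\mu')=\big(\inf_{\gamma}E_{(y,y')\sim\gamma}[\|y-y'\|_1^p]\big)^{1/p}$, the infimum over all couplings $\gamma$ of $\mu$ and $\mu'$; $\mathbb{W}_p^p$ is its $p$-th power. Peak-over-Threshold estimator. For $\tau>0$, $n_\tau=\#\{1\le i\le n:\|X^{(i)}\|_1>\tau\}$ and (when $n_\tau\ge1$) $\mathbb{P}_n^\tau=\frac{1}{n_\tau}\sum_{i:\|X^{(i)}\|_1>\tau}\delta_{X^{(i)}/\|X^{(i)}\|_1}$. *)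

(* Defs.v *)
(* Vectors of R^k are [k.-tuple R], whose measurable structure in the library
   is the product (= Borel) sigma-algebra. *)
From HB Require Import structures.
From mathcomp Require Import all_boot all_order all_algebra.
From mathcomp Require Import all_classical all_reals all_analysis.

Set Implicit Arguments.
Unset Strict Implicit.
Unset Printing Implicit Defensive.
Import Order.TTheory GRing.Theory Num.Theory.
Import numFieldNormedType.Exports.
Local Open Scope classical_set_scope.
Local Open Scope ring_scope.
Local Open Scope ereal_scope.

Section power_measure.
Context d (T : measurableType d) (R : realType).

Definition tcons n (x : T * n.-tuple T) : n.+1.-tuple T := [tuple of x.1 :: x.2].

Lemma measurable_tcons n : measurable_fun [set: T * n.-tuple T] (@tcons n).
Proof. exact: (measurable_cons measurable_fst measurable_snd). Qed.

Section step.
Variables (n : nat) (mu : {sigma_finite_measure set T -> \bar R})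
  (nu : {sigma_finite_measure set (n.-tuple T) -> \bar R}).

Definition tcons_measure : set (n.+1.-tuple T) -> \bar R :=
  pushforward (mu \x nu) (@tcons n).

Let push : {measure set (n.+1.-tuple T) -> \bar R} :=
  @measure_function_pushforward__canonical__measure_function_Measure
    _ _ _ _ _ (mu \x nu) _ (@measurable_tcons n).

HB.instance Definition _ := Measure.copy tcons_measure push.

Let tcons_measure_sigma_finite : sigma_finite setT tcons_measure.
Proof.
have /sigma_finiteP[F [FT ndF Foo]] := sigma_finiteT mu.
have /sigma_finiteP[G [GT ndG Goo]] := sigma_finiteT nu.
pose uncons (t : n.+1.-tuple T) := (thead t, [tuple of behead t]).
have muncons : measurable_fun setT uncons.
  apply: measurable_fun_pair; first exact: measurable_tnth.
  exact: measurable_behead.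
have tconsK : cancel (@tcons n) uncons.
  by move=> [x t]; rewrite /uncons /tcons; congr pair; exact/val_inj.
exists (fun k => uncons @^-1` (F k `*` G k)).
  apply/esym; rewrite -subTset => t _.
  have [i _ Fi] : (\bigcup_i F i) (thead t) by rewrite -FT.
  have [j _ Gj] : (\bigcup_i G i) [tuple of behead t] by rewrite -GT.
  exists (maxn i j) => //; split => /=.
  - by move: (thead t) Fi; exact/subsetPset/ndF/leq_maxl.
  - by move: [tuple of behead t] Gj; exact/subsetPset/ndG/leq_maxr.
move=> k; have [mF Fk] := Foo k; have [mG Gk] := Goo k; split.
  by rewrite -[X in measurable X]setTI; apply: muncons => //; exact: measurableX.
rewrite /tcons_measure /pushforward -comp_preimage.
rewrite (_ : uncons \o _ = id); last by apply/funext => x /=; rewrite tconsK.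
by rewrite preimage_id product_measure1E// lte_mul_pinfty// ge0_fin_numE.
Qed.

HB.instance Definition _ := Measure_isSigmaFinite.Build _ _ _ tcons_measure
  tcons_measure_sigma_finite.
End step.

(* n-fold product measure mu^n on T^n *)
Fixpoint power_measure (mu : {sigma_finite_measure set T -> \bar R}) (n : nat) :
    {sigma_finite_measure set (n.-tuple T) -> \bar R} :=
  if n is n'.+1 then tcons_measure mu (power_measure mu n') else \d_[tuple].

End power_measure.

Section finite_sum_measure.
Context d (T : measurableType d) (R : realType).
Variables (I : finType) (P : pred I) (mu_ : I -> {measure set T -> \bar R}).

Definition fin_sum_measure (B : set T) : \bar R := \sum_(i | P i) mu_ i B.

Let fin_sum_measure0 : fin_sum_measure set0 = 0.
Proof. by rewrite /fin_sum_measure big1. Qed.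

Let fin_sum_measure_ge0 B : 0 <= fin_sum_measure B.
Proof. exact: sume_ge0. Qed.

Let fin_sum_measure_sigma_additive : semi_sigma_additive fin_sum_measure.
Proof.
move=> F mF tF mUF; rewrite [X in _ --> X](_ : _ =
    lim ((fun n => \sum_(0 <= k < n) fin_sum_measure (F k)) @ \oo)).
  by apply: is_cvg_ereal_nneg_natsum => k _; exact: fin_sum_measure_ge0.
rewrite nneseries_sum//; apply: eq_bigr => i _.
exact: measure_semi_bigcup.
Qed.

HB.instance Definition _ := isMeasure.Build _ _ _ fin_sum_measure
  fin_sum_measure0 fin_sum_measure_ge0 fin_sum_measure_sigma_additive.
End finite_sum_measure.

(* The library's [lebesgue_measure] lives on [measurableTypeR R], an alias of R
   with another display; this is the same function on the sets of R. *)
Section lebesgue.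
Variable R : realType.

Definition lebesgueR : set R -> \bar R := @lebesgue_measure R.

Let lebesgueR_sigma_additive : semi_sigma_additive lebesgueR.
Proof. exact: (@measure_semi_sigma_additive _ _ _ (@lebesgue_measure R)). Qed.

HB.instance Definition _ := isMeasure.Build _ R R lebesgueR
  (measure0 (@lebesgue_measure R)) (measure_ge0 (@lebesgue_measure R))
  lebesgueR_sigma_additive.

Let lebesgueR_sigma_finite : sigma_finite setT lebesgueR.
Proof. exact: (sigma_finiteT (@lebesgue_measure R)). Qed.

HB.instance Definition _ := Measure_isSigmaFinite.Build _ R R lebesgueR
  lebesgueR_sigma_finite.
End lebesgue.

Section vectors.
Variable R : realType.
Local Open Scope ring_scope.

Definition lebesgue_tuple k : {sigma_finite_measure set (k.-tuple R) -> \bar R} :=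
  power_measure (@lebesgueR R) k.

Definition norm1 k (v : k.-tuple R) : R := \sum_(i < k) `|tnth v i|.

Definition dist1 k (v w : k.-tuple R) : R := \sum_(i < k) `|tnth v i - tnth w i|.

Definition orthant k : set (k.-tuple R) := [set z | forall i, 0 <= tnth z i].

Definition angle k (v : k.-tuple R) : k.-tuple R :=
  [tuple tnth v i / norm1 v | i < k].

Definition column d m (A : 'M[R]_(d, m)) (j : 'I_m) : d.-tuple R :=
  [tuple A i j | i < d].

Definition apply_mx d m (A : 'M[R]_(d, m)) (z : m.-tuple R) : d.-tuple R :=
  [tuple \sum_(j < m) A i j * tnth z j | i < d].

Definition jacobian d m (A : 'M[R]_(d, m)) : R := Num.sqrt `|\det (A *m A^T)|.

End vectors.

Section model.
Variables (R : realType) (d m : nat).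
Local Open Scope ring_scope.

Definition matrix_class (l u sigma : R) : set 'M[R]_(d, m) :=
  [set A : 'M[R]_(d, m) | [/\ forall i j, 0 <= A i j,
               forall j, l <= norm1 (column A j) <= u &
               sigma <= jacobian A]].

Definition pareto_density (alpha : R) (z : m.-tuple R) : R :=
  alpha ^+ m * \prod_(i < m) (1 + tnth z i) `^ (- (alpha + 1)).

(* [Q] has the Lebesgue density [g] on the nonnegative orthant (hence it gives
   no mass to the complement) *)
Definition has_density (Q : probability (m.-tuple R) R) (g : m.-tuple R -> R) :=
  [/\ measurable_fun (@orthant R m) g,
      forall z, orthant z -> 0 <= g z &
      forall B, measurable B ->
        Q B = (\int[@lebesgue_tuple R m]_(z in B `&` @orthant R m) (g z)%:E)%E].

Definition near_pareto (alpha s xi zeta : R) (k : nat) :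
    set (probability (m.-tuple R) R) :=
  [set Q | exists g, [/\ has_density Q g,
    forall z, orthant z ->
      `|(g z - pareto_density alpha z) / pareto_density alpha z|
        <= xi * k%:R `^ (- s) &
    exists2 c : R, 0 < c & forall z, orthant z ->
      zeta * k%:R `^ ((1 - 2 * s) / alpha) < norm1 z ->
      g z = c * \prod_(i < m) (1 + tnth z i) `^ (- (alpha + 1))]].

(* A law L(X) of the model is recorded together with the matrix A of its
   representation X = AZ, since the spectral measure is read off A. *)
Definition model_at (alpha l u sigma s xi zeta : R) (k : nat) :
    set ('M[R]_(d, m) * probability (d.-tuple R) R) :=
  [set AL : 'M[R]_(d, m) * probability (d.-tuple R) R |
    matrix_class l u sigma AL.1 /\
    exists2 Q, near_pareto alpha s xi zeta k Q &
      forall B, measurable B -> AL.2 B = pushforward Q (apply_mx AL.1) B].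

Definition model (alpha l u sigma s xi zeta : R) :
    set ('M[R]_(d, m) * probability (d.-tuple R) R) :=
  \bigcup_(k in [set k | (1 <= k)%N]) model_at alpha l u sigma s xi zeta k.

Definition spectral_weight (alpha : R) (A : 'M[R]_(d, m)) (j : 'I_m) : R :=
  norm1 (column A j) `^ alpha / \sum_(i < m) norm1 (column A i) `^ alpha.

Lemma spectral_weight_ge0 alpha A j : 0 <= spectral_weight alpha A j.
Proof.
by rewrite divr_ge0 ?powR_ge0// sumr_ge0// => i _; exact: powR_ge0.
Qed.

(* As probability measures on the l1-simplex, K_A and the empirical angular
   measure are regarded as measures on R^d carried by the simplex. *)
Definition spectral_measure (alpha : R) (A : 'M[R]_(d, m)) :
    {measure set (d.-tuple R) -> \bar R} :=
  fin_sum_measure xpredT (fun j => mscale (NngNum (spectral_weight_ge0 alpha A j))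
    (dirac (angle (column A j)))).

End model.
Arguments model {R} d m.

Section estimation.
Variables (R : realType) (d m : nat).
Local Open Scope ring_scope.

Definition n_exceed n (tau : R) (x : n.-tuple (d.-tuple R)) : nat :=
  #|[set i : 'I_n | tau < norm1 (tnth x i)]%SET|.

(* the zero measure when there is no exceedance *)
Definition empirical_angular_measure n (tau : R) (x : n.-tuple (d.-tuple R)) :
    {measure set (d.-tuple R) -> \bar R} :=
  mscale ((n_exceed tau x)%:R^-1)%:nng
    (fin_sum_measure (fun i => tau < norm1 (tnth x i))
      (fun i => dirac (angle (tnth x i)))).

Definition coupling (mu nu : {measure set (d.-tuple R) -> \bar R}) :
    set (probability (d.-tuple R * d.-tuple R)%type R) :=
  [set gamma | forall B, measurable B ->
    gamma (B `*` setT) = mu B /\ gamma (setT `*` B) = nu B].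

(* An infimum over no coupling is +oo, so that [wasserstein] is +oo, and not
   small, if [mu] is the zero measure. *)
Definition wasserstein (p : R) (mu nu : {measure set (d.-tuple R) -> \bar R}) :
    \bar R :=
  (ereal_inf [set \int[gamma]_y (dist1 y.1 y.2 `^ p)%:E
             | gamma in coupling mu nu] `^ p^-1)%E.

(* infimum over the model of the probability, for n i.i.d. observations, that
   W_p^p(P_n^tau, K_A) <= r *)
Definition inf_prob (alpha p l u sigma s xi zeta : R) (n : nat) (tau r : R) :
    \bar R :=
  ereal_inf [set power_measure AL.2 n
      [set x | (wasserstein p (empirical_angular_measure tau x)
                  (spectral_measure alpha AL.1) `^ p <= r%:E)%E]
    | AL in model d m alpha l u sigma s xi zeta].

End estimation.
Arguments inf_prob {R} d m.

Section asymptotics.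
Variable R : realType.
Local Open Scope ring_scope.

Definition Theta (a b : nat -> R) : Prop :=
  exists c1 c2 : R, 0 < c1 /\ \forall n \near \oo, c1 <= a n / b n <= c2.

Definition Theta_polylog (a b : nat -> R) : Prop :=
  exists c1 c2 r : R, [/\ 0 < c1, 0 <= r & \forall n \near \oo,
    c1 * ln n%:R `^ (- r) <= a n / b n <= c2 * ln n%:R `^ r].

End asymptotics.

(* Main.v *)
(* For X = A Z put r_j = |A_j|_1, so |X|_1 = sum_j r_j Z_j, and let tau be the
   threshold. When |X|_1 > tau some j has r_j Z_j > tau / m; labelling each
   exceedance by such a coordinate yields an explicit transport plan from the
   empirical angular measure to K_A. Its cost is at most a constant times the
   empirical mean of (sum_{i <> j} r_i Z_i) / |X|_1 plus the excess of the label
   frequencies over the weights of K_A: the simplex being bounded, |y - y'|_1^p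
   is at most a constant times |y - y'|_1.

   Under the product Pareto law the mean of that cost is
   O(tau^(- min 1 alpha) log tau): a coordinate of size 2^-k tau next to another
   one of size about tau is handled scale by scale, using only pairwise
   independence. For a law of the k-th class with k <= n, and tau above the
   radius beyond which its density is exactly proportional to the Pareto one, the
   conditional law given an exceedance is the Pareto one; for k > n the relative
   error is at most n^-s up to a constant. Fluctuations are controlled by Chernoff
   bounds, of order (log (1/eps) / (n tau^-alpha))^(1/2). With
   tau = c n^((1 - 2 theta) / alpha) they are of order n^-theta, and the
   population bias is no larger, up to logarithms, exactly when
   theta <= 1 / (2 + max 1 alpha); one takes theta = min(s, 1 / (2 + max 1 alpha)),
   and for theta = s below that bound the bias is polynomially smaller, which
   absorbs the logarithm. *)
From HB Require Import structures.
Require Import Defs.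
From mathcomp Require Import all_boot all_order all_algebra.
From mathcomp Require Import all_classical all_reals all_analysis.
From mathcomp Require Import measurable_realfun ring lra.
Set Implicit Arguments.
Unset Strict Implicit.
Unset Printing Implicit Defensive.
Import Order.TTheory GRing.Theory Num.Theory.
Import numFieldNormedType.Exports.
Local Open Scope classical_set_scope.
Local Open Scope ring_scope.

(** * Power measures *)

(** The event bounding the Wasserstein distance is not known to be measurable, and [power_measure]
    evaluates an arbitrary set as an iterated integral. Such a functional is still monotone, so it
    suffices to bound from below the probability of a measurable subset: the event that a cheap
    labelling exists among the finitely many possible ones. The sectors r_j Z_j > tau / m overlap,
    so no exact label frequency is computed. Both marginals of the plan have mass one, so surplus
    equals deficit and upper bounds on sector frequencies are enough. This leaves m + 2 one-sided
    sums: the cost, the number of exceedances, and one per sector. Each is supported on the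
    exceedance event, so its fluctuations scale with the probability of that event. The
    proportionality constant of condition (b) is arbitrary, but it cancels in conditional
    probabilities. The lower bound on the exceedance probability comes instead from condition (a)
    with [xi < 1]. The number of dyadic levels stays free until the end, where about log2 n levels
    cost a single logarithm. *)

Section power_measure_theory.
Import HBNNSimple.
Local Open Scope ereal_scope.
Context d (T : measurableType d) (R : realType).
Implicit Types mu nu : {sigma_finite_measure set T -> \bar R}.

Lemma emeasurable_prod d' (X : measurableType d') I (s : seq I)
    (h : I -> X -> \bar R) : (forall i, measurable_fun setT (h i)) ->
  measurable_fun setT (fun x => \prod_(i <- s) h i x).
Proof.
move=> mh; elim: s => [|i s ih].
  by under eq_fun do rewrite big_nil; exact: measurable_cst.
by under eq_fun do rewrite big_cons; exact: emeasurable_funM.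
Qed.

(* No measurability is required: the integral of a nonnegative function is a
   supremum over the simple functions below it. *)
Lemma ge0_le_integral_any d' (X : measurableType d') (m : {measure set X -> \bar R})
    (f g : X -> \bar R) :
  (forall x, 0 <= f x) -> (forall x, f x <= g x) ->
  \int[m]_x f x <= \int[m]_x g x.
Proof.
move=> f0 fg; have g0 x : 0 <= g x by exact: le_trans (fg x).
rewrite !ge0_integralTE//; apply: ereal_sup_le => _ [h hf <-].
exists h => //= x.
exact: le_trans (hf x) (fg x).
Qed.

Lemma power_measureS mu n (B : set (n.+1.-tuple T)) :
  power_measure mu n.+1 B =
  \int[mu]_x power_measure mu n [set t | B (tcons (x, t))].
Proof.
rewrite /= /tcons_measure /pushforward /product_measure1.
apply: eq_integral => x _ /=; congr (power_measure _ _ _).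
by apply/seteqP; split=> t; rewrite /xsection/= ?inE.
Qed.

(** Each induction step compares integrals of nonnegative functions, which needs no measurable
    fibres. This carries lower bounds from measurable subsets to the Wasserstein event. *)
Lemma power_measure_mono mu n (B C : set (n.-tuple T)) : B `<=` C ->
  power_measure mu n B <= power_measure mu n C.
Proof.
elim: n B C => [|n ih] B C BC.
  rewrite /= !diracE lee_fin ler_nat.
  case: (boolP (_ \in B)) => //; rewrite inE => /BC BC'.
  by rewrite mem_set.
rewrite !power_measureS; apply: ge0_le_integral_any => x //.
by apply: ih => t /BC.
Qed.

Lemma integral_power_measureS mu n (f : n.+1.-tuple T -> \bar R) :
  measurable_fun [set: n.+1.-tuple T] f -> (forall t, 0 <= f t) ->
  \int[power_measure mu n.+1]_t f t =
  \int[mu]_x \int[power_measure mu n]_t f (tcons (x, t)).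
Proof.
move=> mf f0 /=.
rewrite (ge0_integral_pushforward (@measurable_tcons _ T n))//.
rewrite preimage_setT fubini_tonelli1//; last by move=> x; exact: f0.
exact: measurableT_comp (@measurable_tcons _ T n).
Qed.

Lemma integral_power_measure_prod mu n (f : 'I_n -> T -> \bar R) :
  (forall i, measurable_fun setT (f i)) -> (forall i x, 0 <= f i x) ->
  \int[power_measure mu n]_t (\prod_(i < n) f i (tnth t i)) =
  \prod_(i < n) \int[mu]_x f i x.
Proof.
elim: n f => [|n ih] f mf f0.
  rewrite /= big_ord0; under eq_integral do rewrite big_ord0.
  by rewrite integral_cst//= diracT mule1.
have mprod (k : nat) (g : 'I_k -> T -> \bar R) :
    (forall i, measurable_fun setT (g i)) ->
    measurable_fun [set: k.-tuple T] (fun t => \prod_(i < k) g i (tnth t i)).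
  move=> mg; apply: emeasurable_prod => i.
  by apply: measurableT_comp => //; exact: measurable_tnth.
rewrite integral_power_measureS; last 2 first.
- exact: mprod.
- by move=> t; apply: prode_ge0.
under eq_integral => x _.
  under eq_integral => t _.
    rewrite big_ord_recl /= (_ : tnth _ ord0 = x)//.
    under eq_bigr => i _ do rewrite (_ : tnth (tcons (x, t)) (lift ord0 i) = tnth t i) ?tnthS//.
    over.
  rewrite ge0_integralZl//; last 2 first.
  - exact: mprod (fun i => f (lift ord0 i)) _.
  - by move=> t _; apply: prode_ge0.
  rewrite (ih (fun i => f (lift ord0 i)))//.
  over.
rewrite ge0_integralZr//; last by apply: prode_ge0 => i _; exact: integral_ge0.
by rewrite big_ord_recl.
Qed.

Lemma power_measure_forall mu n (B : set T) : measurable B -> mu B = 1 ->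
  power_measure mu n [set t | forall i, B (tnth t i)] = 1.
Proof.
move=> mB mu1.
have mS : measurable [set t : n.-tuple T | forall i, B (tnth t i)].
  rewrite (_ : [set t | _] = \bigcap_(i in [set: 'I_n]) ((@tnth _ _)^~ i @^-1` B)).
    apply: fin_bigcap_measurable => // i _.
    by rewrite -[X in measurable X]setTI; exact: measurable_tnth.
  by apply/seteqP; split => t /= => [h i _|h i]; exact: h.
have := @integral_power_measure_prod mu n (fun _ x => (\1_B x)%:E).
rewrite [X in _ -> _ -> _ = X]big1; last first.
  by move=> i _; rewrite integral_indic// setIT.
move=> <-//.
- rewrite -[in LHS](setIT [set t | _]) -integral_indic//; apply: eq_integral => t _.
  rewrite prodEFin; congr EFin; rewrite indicE.
  case: (boolP (t \in _)) => [|/negP]; rewrite inE /=.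
    by move=> h; rewrite big1// => i _; rewrite indicE mem_set.
  move=> /existsNP[i h]; rewrite (bigD1 i)//= indicE memNset ?mul0r//.
- by move=> _; apply/measurable_EFinP; exact: measurable_indic.
Qed.

Lemma power_measureT mu n : mu setT = 1 -> power_measure mu n setT = 1.
Proof.
move=> mu1; rewrite -(power_measure_forall n measurableT mu1).
by congr (power_measure _ _ _); apply/seteqP; split.
Qed.

End power_measure_theory.

Section power_measure_pushforward.
Local Open Scope ereal_scope.
Context d1 d2 (T1 : measurableType d1) (T2 : measurableType d2) (R : realType).

Definition tmap (f : T1 -> T2) n (t : n.-tuple T1) : n.-tuple T2 :=
  [tuple of map f t].

(** Moves the analysis from the observations X = A Z to the vectors Z, for which a density is
    available. Measurability of [S] makes the fibre masses measurable, as the change of variables in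
    each step requires. *)
Lemma power_measure_pushforward (mu : {sigma_finite_measure set T1 -> \bar R})
    (nu : {sigma_finite_measure set T2 -> \bar R}) (f : T1 -> T2) n
    (S : set (n.-tuple T2)) : measurable_fun setT f ->
  (forall B, measurable B -> nu B = mu (f @^-1` B)) -> measurable S ->
  power_measure nu n S = power_measure mu n (@tmap f n @^-1` S).
Proof.
move=> mf numu; elim: n S => [|n ih] S mS.
  rewrite /= !diracE; congr ((_ : bool)%:R)%:E.
  apply/idP/idP; rewrite !inE /=; congr S; exact/val_inj.
have mSx (y : T2) : measurable [set t | S (tcons (y, t))].
  rewrite -[X in measurable X]setTI; apply: (measurableT_comp (@measurable_tcons _ T2 n)) => //.
have mfib : measurable_fun setT
    (fun y => power_measure nu n [set t | S (tcons (y, t))]).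
  rewrite (_ : (fun y => _) = power_measure nu n \o xsection (@tcons _ T2 n @^-1` S)).
    apply: measurable_fun_xsection.
    by rewrite -[X in measurable X]setTI; apply: measurable_tcons.
  apply/funext => y /=; congr (power_measure _ _ _).
  by apply/seteqP; split=> t; rewrite /xsection/= ?inE.
rewrite !power_measureS.
rewrite (eq_measure_integral (pushforward mu f)); last first.
  by move=> B mB _; exact: numu.
rewrite ge0_integral_pushforward//.
rewrite preimage_setT; apply: eq_integral => x _ /=.
rewrite ih//; congr (power_measure _ _ _).
apply/seteqP; split => t /=; rewrite (_ : tmap f _ = tcons (f x, tmap f t))//; exact/val_inj.
Qed.

End power_measure_pushforward.

(** * Chernoff bounds *)

Section chernoff.
Context d (T : measurableType d) (R : realType).

(** Multiply by [1 - y], which is positive: the left side becomes at most 1, and the right side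
    becomes [1 + y ^+ 2 * (1 - 2 * y)]. *)
Lemma expR_le_quadratic (y : R) : y <= 2^-1 -> expR y <= 1 + y + 2 * y ^+ 2.
Proof.
move=> y2; have y1 : 0 < 1 - y by lra.
have : 1 - y <= (expR y)^-1 by rewrite -expRN; have := expR_ge1Dx (- y).
have e0 := expR_gt0 y => h.
have : expR y * (1 - y) <= 1.
  by rewrite -[leRHS](mulfV (lt0r_neq0 e0)) ler_pM2l.
move=> {}h; rewrite -(ler_pM2r y1); apply: le_trans h _.
have : 0 <= y ^+ 2 * (1 - 2 * y) by rewrite mulr_ge0 ?sqr_ge0//; lra.
nra.
Qed.

Variable mu : probability T R.
Variables (E : set T) (f : T -> R) (M P : R).
Hypotheses (mE : measurable E) (mf : measurable_fun setT f) (M0 : 0 <= M).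
Hypothesis fM : forall x, `|f x| <= M * \1_E x.
Hypothesis muE : mu E = P%:E.

Lemma bounded_integrable (g : T -> R) (c : R) : measurable_fun setT g ->
  (forall x, `|g x| <= c) -> mu.-integrable setT (EFin \o g).
Proof.
move=> mg gc; have c0 : 0 <= c by exact: le_trans (gc point).
apply: measurable_bounded_integrable => //.
  by have := ltry (1 : R); rewrite -(probability_setT mu).
exists c; split; first exact: num_real.
by move=> x cx y _ /=; exact: le_trans (gc y) (ltW cx).
Qed.

(** Since [f] vanishes off [E], its second moment is at most [M ^+ 2 * P] and not merely [M ^+ 2].
    This is why deviations are governed by the expected number [n * P] of exceedances and not by
    [n]. *)
Lemma mgf_le (b lam : R) : 0 <= lam -> lam * M <= 2^-1 ->
  (\int[mu]_x (f x)%:E <= (b * P)%:E)%E ->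
  (\int[mu]_x (expR (lam * f x))%:E <=
   (expR (lam * (b * P) + 2 * lam ^+ 2 * M ^+ 2 * P))%:E)%E.
Proof.
move=> lam0 lamM fb.
have fM' x : `|f x| <= M.
  apply: le_trans (fM x) _; rewrite -[leRHS]mulr1; exact: ler_wpM2l.
have intf : mu.-integrable setT (EFin \o f) by exact: bounded_integrable fM'.
have intE : mu.-integrable setT (EFin \o \1_E).
  apply: (@bounded_integrable _ 1); first exact: measurable_indic.
  by move=> x; rewrite indicE; case: (_ \in _); rewrite ?normr1 ?normr0.
have int1 : mu.-integrable setT (EFin \o cst 1).
  by apply: (@bounded_integrable _ 1) => // x; rewrite normr1.
have intlf : mu.-integrable setT (fun x => lam%:E * (f x)%:E)%E.
  exact: integrableZl.
have intle : mu.-integrable setT (fun x => (2 * lam ^+ 2 * M ^+ 2)%:E * (\1_E x)%:E)%E.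
  exact: integrableZl.
apply: (@le_trans _ _ (\int[mu]_x ((cst 1 x)%:E + lam%:E * (f x)%:E +
    (2 * lam ^+ 2 * M ^+ 2)%:E * (\1_E x)%:E))%E).
  apply: ge0_le_integral => //.
  - apply/measurable_EFinP; apply: measurableT_comp => //.
    by apply: measurable_funM.
  - apply: emeasurable_funD; last by case/integrableP: intle.
    by apply: emeasurable_funD; [case/integrableP: int1|case/integrableP: intlf].
  move=> x _; rewrite -!EFinM -!EFinD lee_fin.
  have lfE : lam * f x <= 2^-1.
    apply: le_trans lamM; rewrite ler_wpM2l//.
    exact: le_trans (ler_norm _) (fM' x).
  apply: le_trans (expR_le_quadratic lfE) _; rewrite lerD2l.
  have f2 : f x ^+ 2 <= M ^+ 2 * \1_E x.
    have := fM x; rewrite indicE; case: (_ \in _) => /= h.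
      by rewrite !mulr1 in h *; rewrite -(real_normK (num_real (f x))) lerXn2r ?nnegrE.
    by rewrite mulr0 normr_le0 in h; rewrite (eqP h) mulr0 expr0n.
  have := ler_wpM2l (sqr_ge0 lam) f2; rewrite exprMn; lra.
rewrite integralD//=; last exact: integrableD.
rewrite integralD//.
have -> : (\int[mu]__ 1 = 1)%E.
  transitivity (1%:E * mu setT)%E; first exact: (integral_cst mu measurableT 1).
  by rewrite mul1e; exact: probability_setT.
have IE : (\int[mu]_x (\1_E x)%:E = P%:E)%E.
  by rewrite integral_indic// setIT; exact: muE.
rewrite integralZl//= integralZl//= IE.
have [I0] : exists I0 : R, (\int[mu]_x (f x)%:E = I0%:E)%E.
  by exists (fine (\int[mu]_x (f x)%:E)%E); rewrite fineK//; exact: integrable_fin_num.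
move=> I0E; rewrite I0E.
rewrite -!EFinM -!EFinD lee_fin.
apply: le_trans (expR_ge1Dx _).
by rewrite -addrA lerD2l lerD2r ler_wpM2l// -lee_fin -I0E.
Qed.

Lemma chernoff n (b L : R) : 0 <= L -> L <= n%:R * P -> 0 < M -> 0 < P ->
  (\int[mu]_x (f x)%:E <= (b * P)%:E)%E ->
  (power_measure mu n [set t | (n%:R * P * b + 4 * M * Num.sqrt (n%:R * P * L) <
     \sum_(i < n) f (tnth t i))%R] <= (expR (- L))%:E)%E.
Proof.
move=> L0 LnP Mp Pp fb.
have nP0 : 0 <= n%:R * P by exact: le_trans LnP.
have [->|Lp] := eqVneq L 0.
  rewrite oppr0 expR0; rewrite -(power_measureT n (probability_setT mu)).
  exact: power_measure_mono.
have {}Lp : 0 < L by rewrite lt0r Lp.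
have nPp : 0 < n%:R * P by exact: lt_le_trans LnP.
set nP := n%:R * P in LnP nP0 nPp *.
(* With this choice the deviation term contributes [- 2 * L] to the exponent and the quadratic term
   [L / 2], so the total is below [- L]. The condition [L <= n * P] gives [lam * M <= 1/2], the
   range of the quadratic bound. *)
pose lam : R := Num.sqrt (L / nP) / (2 * M).
have lam0 : 0 <= lam by rewrite divr_ge0 ?sqrtr_ge0// mulr_ge0.
have lamM : lam * M <= 2^-1.
  have -> : lam * M = Num.sqrt (L / nP) / 2 by rewrite /lam; field; rewrite gt_eqF.
  rewrite -[leRHS]mul1r ler_pM2r//.
  by rewrite -sqrtr1 ler_wsqrtr// ler_pdivrMr// mul1r.
set s := nP * b + _.
pose G := fun t : n.-tuple T => (\prod_(i < n) (expR (lam * f (tnth t i)))%:E)%E.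
have mS : measurable [set t : n.-tuple T | s < \sum_(i < n) f (tnth t i)].
  have : measurable_fun [set: n.-tuple T] (fun t => \sum_(i < n) f (tnth t i)).
    apply: measurable_sum => i; apply: measurableT_comp => //.
    exact: measurable_tnth.
  move=> /(_ measurableT _ (measurable_itv `]s, +oo[)); rewrite setTI.
  by congr measurable; apply/seteqP; split => t /=; rewrite in_itv/= andbT.
have mG : measurable_fun [set: n.-tuple T] G.
  apply: emeasurable_prod => i.
  apply/measurable_EFinP; apply: measurableT_comp => //.
  apply: measurable_funM => //; apply: measurableT_comp => //.
  exact: measurable_tnth.
have G0 t : (0 <= G t)%E by apply: prode_ge0 => i _; rewrite lee_fin expR_ge0.
rewrite -[X in power_measure _ _ X]setIT -integral_indic//.
apply: (@le_trans _ _ (\int[power_measure mu n]_t ((expR (- lam * s))%:E * G t))%E).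
  apply: ge0_le_integral => //.
  - by apply/measurable_EFinP; exact: measurable_indic.
  - exact: emeasurable_funM.
  - move=> t _; rewrite /G prodEFin -EFinM lee_fin -expR_sum -mulr_sumr -expRD.
    rewrite indicE; case: (boolP (_ \in _)) => [|_]; last exact: expR_ge0.
    rewrite inE /= => st; rewrite -[leLHS]expR0 ler_expR mulNr addrC -mulrBr.
    by rewrite mulr_ge0// subr_ge0 ltW.
rewrite ge0_integralZl//.
rewrite (integral_power_measure_prod _ (f := fun _ x => (expR (lam * f x))%:E)).
- have h := mgf_le lam0 lamM fb.
  apply: (@le_trans _ _ ((expR (- lam * s))%:E *
      (\prod_(i < n) (expR (lam * (b * P) + 2 * lam ^+ 2 * M ^+ 2 * P))%:E))%E).
    apply: lee_wpmul2l; first by rewrite lee_fin expR_ge0.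
    apply: (proj2 (big_ind2 (fun a c => 0 <= a /\ a <= c)%E _ _ _)) => //.
      move=> a a' c c' [a0 aa'] [c0 cc']; split; first exact: mule_ge0.
      exact: lee_pmul.
    by move=> i _; split => //; apply: integral_ge0 => x _; rewrite lee_fin expR_ge0.
  rewrite prodEFin -EFinM lee_fin -expR_sum -expRD ler_expR sumr_const card_ord.
  rewrite -[X in _ + X <= _]mulr_natl /s /lam.
  have -> : 4 * M * Num.sqrt (nP * L) = 4 * M * (nP * Num.sqrt (L / nP)).
    congr (_ * _); rewrite (_ : nP * L = nP ^+ 2 * (L / nP)).
      by rewrite sqrtrM ?sqr_ge0// sqrtr_sqr ger0_norm.
    by field; rewrite gt_eqF.
  set q := Num.sqrt _.
  have q2 : nP * q ^+ 2 = L.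
    by rewrite sqr_sqrtr ?divr_ge0//; field; rewrite gt_eqF.
  rewrite (_ : - _ * _ + _ = - 2 * (nP * q ^+ 2) + 2^-1 * (nP * q ^+ 2)); last first.
    rewrite /nP; field; rewrite gt_eqF//.
  rewrite q2; lra.
- move=> _; apply/measurable_EFinP; apply: measurableT_comp => //.
  exact: measurable_funM.
- by move=> _ x; rewrite lee_fin expR_ge0.
Qed.

End chernoff.

(** * Transport plans *)

Section repair_plan.
Variables (R : realType) (I J : finType).

(* The columns of [pi0] carrying too much mass are scaled down to [w], and the
   mass freed is redistributed by an independent coupling of the two defects. *)
Lemma repair_plan (pi0 c : I -> J -> R) (w : J -> R) (K : R) :
  (forall i j, 0 <= pi0 i j) -> (forall j, 0 <= w j) ->
  \sum_i \sum_j pi0 i j = 1 -> \sum_j w j = 1 ->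
  (forall i j, 0 <= c i j <= K) ->
  exists pi : I -> J -> R, [/\ forall i j, 0 <= pi i j,
    forall i, \sum_j pi i j = \sum_j pi0 i j,
    forall j, \sum_i pi i j = w j &
    \sum_i \sum_j pi i j * c i j <= \sum_i \sum_j pi0 i j * c i j +
      K * \sum_j Num.max 0 (\sum_i pi0 i j - w j)].
Proof.
move=> pi00 w0 pi01 w1 cK.
pose v j := \sum_i pi0 i j.
have v0 j : 0 <= v j by exact: sumr_ge0.
pose mn j := Num.min (v j) (w j).
have mn0 j : 0 <= mn j by rewrite le_min v0 w0.
have mnv j : mn j <= v j by rewrite ge_min lexx.
have mnw j : mn j <= w j by rewrite ge_min lexx orbT.
(* If [v j = 0] the quotient is 0 by convention, which is consistent because [mn j = 0] as well. *)
pose kp j := mn j / v j.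
have kp0 j : 0 <= kp j by rewrite divr_ge0.
have kp1 j : kp j <= 1.
  have [vj|vj] := eqVneq (v j) 0; first by rewrite /kp vj invr0 mulr0.
  by rewrite ler_pdivrMr ?mul1r// lt0r vj v0.
have vkp j : v j * kp j = mn j.
  have [vj|vj] := eqVneq (v j) 0; last by rewrite /kp mulrC divfK.
  by rewrite vj mul0r; apply/eqP; rewrite eq_le mn0 -vj mnv.
pose r i := \sum_j pi0 i j * (1 - kp j).
have r0 i : 0 <= r i by apply: sumr_ge0 => j _; rewrite mulr_ge0// subr_ge0.
pose e j := w j - mn j.
have e0 j : 0 <= e j by rewrite subr_ge0.
pose del := \sum_j (v j - mn j).
have sv : \sum_j v j = 1 by rewrite exchange_big.
have sr : \sum_i r i = del.
  rewrite exchange_big; apply: eq_bigr => j _.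
  by rewrite -mulr_suml -/(v j) mulrBr mulr1 vkp.
have se : \sum_j e j = del.
  by rewrite /e /del !sumrB w1 sv.
have del0 : 0 <= del by rewrite -sr sumr_ge0.
have rz i : del = 0 -> r i = 0.
  by rewrite -sr => /eqP; rewrite psumr_eq0// => /allP/(_ i); rewrite mem_index_enum => /(_ isT) /eqP.
have ez j : del = 0 -> e j = 0.
  by rewrite -se => /eqP; rewrite psumr_eq0// => /allP/(_ j); rewrite mem_index_enum => /(_ isT) /eqP.
(* [r] is the row mass freed and [e] the column mass missing, both of total [del]; their normalized
   product couples them. If [del = 0] both vanish identically, so the division by zero adds
   nothing. *)
exists (fun i j => pi0 i j * kp j + r i * e j / del); split.
- by move=> i j; rewrite addr_ge0 ?mulr_ge0 ?invr_ge0.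
- move=> i; rewrite big_split/=.
  have -> : \sum_j r i * e j / del = r i.
    rewrite -mulr_suml -mulr_sumr se; have [d0|dN] := eqVneq del 0.
      by rewrite rz// mul0r mul0r.
    by rewrite mulfK.
  by rewrite -big_split/=; apply: eq_bigr => j _; rewrite mulrBr mulr1 addrC subrK.
- move=> j; rewrite big_split/= -mulr_suml -/(v j) vkp.
  have -> : \sum_i r i * e j / del = e j.
    rewrite -mulr_suml -mulr_suml sr; have [d0|dN] := eqVneq del 0.
      by rewrite ez// mulr0 mul0r.
    by rewrite mulrAC mulfV ?mul1r.
  by rewrite /e addrC subrK.
have -> : \sum_j Num.max 0 (\sum_i pi0 i j - w j) = del.
  apply: eq_bigr => j _; rewrite -/(v j) /mn.
  case: (leP (v j) (w j)) => vw.
    by rewrite subrr; apply/max_idPl; rewrite subr_le0.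
  by apply/max_idPr; rewrite subr_ge0 ltW.
have -> : \sum_i \sum_j (pi0 i j * kp j + r i * e j / del) * c i j =
   \sum_i \sum_j pi0 i j * kp j * c i j + \sum_i \sum_j r i * e j / del * c i j.
  rewrite -big_split; apply: eq_bigr => i _; rewrite -big_split/=.
  by apply: eq_bigr => j _; rewrite mulrDl.
apply: lerD.
  apply: ler_sum => i _; apply: ler_sum => j _; have /andP[c0 _] := cK i j.
  by rewrite ler_wpM2r// -[leRHS]mulr1 ler_wpM2l.
apply: (@le_trans _ _ (\sum_i \sum_j r i * e j / del * K)).
  apply: ler_sum => i _; apply: ler_sum => j _; have /andP[_ cK'] := cK i j.
  by rewrite ler_wpM2l ?mulr_ge0 ?invr_ge0.
have K0 : 0 <= K.
  case: (pickP (fun _ : I => true)) => [i _|I0]; last first.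
    by move: pi01; rewrite big_pred0// => /eqP; rewrite eq_sym oner_eq0.
  case: (pickP (fun _ : J => true)) => [j _|J0]; last first.
    by move: w1; rewrite big_pred0// => /eqP; rewrite eq_sym oner_eq0.
  by have /andP[] := cK i j; exact: le_trans.
under eq_bigr do rewrite -mulr_suml -mulr_suml -mulr_sumr se.
rewrite -!mulr_suml sr mulrC ler_wpM2l//.
by have [->|dN] := eqVneq del 0; rewrite ?mul0r// mulfK.
Qed.

End repair_plan.

Section finite_plan.
Local Open Scope ereal_scope.
Context d (T : measurableType d) (R : realType).

Lemma ge0_integral_fin_sum_measure (K : finType) (mu_ : K -> {measure set T -> \bar R})
    (f : T -> \bar R) : measurable_fun setT f -> (forall x, 0 <= f x) ->
  \int[fin_sum_measure xpredT mu_]_x f x = \sum_(k : K) \int[mu_ k]_x f x.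
Proof.
move=> mf f0.
(* Enumerating [K] turns the family into a sequence padded with zero measures, to which additivity
   of the integral over initial sums applies. *)
pose nu (k : nat) : {measure set T -> \bar R} :=
  if insub k is Some o then mu_ (enum_val (o : 'I_#|K|)) else mzero.
have nuE (o : 'I_#|K|) : nu o = mu_ (enum_val o) by rewrite /nu valK.
rewrite (eq_measure_integral (msum nu #|K|)); last first.
  move=> B mB _; transitivity (\sum_k mu_ k B) => //.
  rewrite (reindex (@enum_val K K)) /=; last exact/onW_bij/enum_val_bij.
  by apply: eq_bigr => o _; rewrite nuE.
rewrite ge0_integral_measure_sum//.
rewrite [RHS](reindex (@enum_val K K)) /=; last exact/onW_bij/enum_val_bij.
by apply: eq_bigr => o _; rewrite nuE.
Qed.

Variables (K : finType) (c : K -> {nonneg R}) (z : K -> T).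
Hypothesis c1 : (\sum_k (c k)%:num = 1)%R.

(** The normalization proof is an argument so that the term [plan_measure c1] can itself carry the
    structure of a probability, as couplings require. *)
Definition plan_measure of (\sum_k (c k)%:num = 1)%R : set T -> \bar R :=
  fin_sum_measure xpredT (fun k => mscale (c k) (dirac (z k))).

HB.instance Definition _ := Measure.on (plan_measure c1).

Lemma plan_measureE (B : set T) :
  plan_measure c1 B = \sum_k (c k)%:num%:E * \d_(z k) B.
Proof. by []. Qed.

Lemma plan_measureT : plan_measure c1 setT = 1.
Proof.
rewrite plan_measureE; under eq_bigr do rewrite diracT mule1.
by rewrite sumEFin c1.
Qed.

HB.instance Definition _ := Measure_isProbability.Build _ _ _ (plan_measure c1)
  plan_measureT.

Lemma integral_plan_measure (f : T -> \bar R) : measurable_fun setT f ->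
  (forall x, 0 <= f x) ->
  \int[plan_measure c1]_x f x = \sum_k (c k)%:num%:E * f (z k).
Proof.
move=> mf f0; rewrite ge0_integral_fin_sum_measure//; apply: eq_bigr => k _.
by rewrite ge0_integral_mscale// integral_dirac// diracT mul1e.
Qed.

End finite_plan.

Section wasserstein_bound.
Variables (R : realType) (d : nat).
Implicit Types v w : d.-tuple R.

Lemma norm1_ge0 v : 0 <= norm1 v.
Proof. exact: sumr_ge0. Qed.

(** An inequality, because the angle of the zero vector is the zero vector. *)
Lemma norm1_angle_le1 v : norm1 (angle v) <= 1.
Proof.
rewrite /norm1 /angle.
under eq_bigr do rewrite tnth_mktuple normrM normfV (ger0_norm (norm1_ge0 v)).
rewrite -mulr_suml -/(norm1 v); have [->|v0] := eqVneq (norm1 v) 0.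
  by rewrite mul0r.
by rewrite mulfV.
Qed.

Lemma dist1_ge0 v w : 0 <= dist1 v w.
Proof. exact: sumr_ge0. Qed.

Lemma dist1_angle_le2 v w : dist1 (angle v) (angle w) <= 2.
Proof.
apply: le_trans (_ : norm1 (angle v) + norm1 (angle w) <= 2).
  by rewrite -big_split /=; apply: ler_sum => i _; exact: ler_normB.
by rewrite (_ : 2 = 1 + 1)// lerD// norm1_angle_le1.
Qed.

Lemma dist1_powR_le (p : R) v w : 1 <= p ->
  dist1 (angle v) (angle w) `^ p <= 2 `^ p * dist1 (angle v) (angle w).
Proof.
move=> p1; set D := dist1 _ _; have D0 : 0 <= D by exact: dist1_ge0.
have -> : D `^ p = 2 `^ p * (D / 2) `^ p.
  by rewrite -powRM// ?divr_ge0// mulrC divfK.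
apply: ler_wpM2l; first exact: powR_ge0.
have h : 0 <= D / 2 <= 1 by rewrite divr_ge0//= ler_pdivrMr// mul1r dist1_angle_le2.
apply: (@le_trans _ _ (D / 2)); last by rewrite ler_pdivrMr// ler_peMr// ler1n.
have [->|DN] := eqVneq D 0; first by rewrite mul0r powR0// gt_eqF//; lra.
by apply: ge1r_powR => //; case/andP: h => _ ->; rewrite divr_gt0// lt0r DN.
Qed.

Lemma measurable_dist1 :
  measurable_fun [set: d.-tuple R * d.-tuple R] (fun y => dist1 y.1 y.2).
Proof.
apply: measurable_sum => i; apply: measurableT_comp => //.
apply: measurable_funB.
  exact: (measurableT_comp (measurable_tnth i) measurable_fst).
exact: (measurableT_comp (measurable_tnth i) measurable_snd).
Qed.

(** A labelling [sg] puts mass 1/N on each pair formed by an exceedance and its atom. The first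
    marginal is then right and the second may be wrong; [repair_plan] corrects it, each unit of
    displaced mass costing at most 2^p, the power of the diameter. *)
Lemma wasserstein_le (m n : nat) (A : 'M[R]_(d, m)) (alpha p tau : R)
    (x : n.-tuple (d.-tuple R)) (sg : 'I_n -> 'I_m) :
  1 <= p -> \sum_j spectral_weight alpha A j = 1 -> (0 < n_exceed tau x)%N ->
  (wasserstein p (empirical_angular_measure tau x) (spectral_measure alpha A) `^ p
   <= (2 `^ p * (\sum_(i | tau < norm1 (tnth x i))
          dist1 (angle (tnth x i)) (angle (column A (sg i))) / (n_exceed tau x)%:R +
        \sum_j Num.max 0 ((\sum_(i | (tau < norm1 (tnth x i)) && (sg i == j)) (n_exceed tau x)%:R^-1)
          - spectral_weight alpha A j)))%:E)%E.
Proof.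
move=> p1 w1 N0; set w := spectral_weight alpha A in w1 *.
set N : R := (n_exceed tau x)%:R.
have p0 : 0 < p by lra.
have Np : 0 < N by rewrite ltr0n.
pose I := [pred i | tau < norm1 (tnth x i)].
pose pi0 (i : 'I_n) (j : 'I_m) := if I i && (sg i == j) then N^-1 else 0.
pose c (i : 'I_n) (j : 'I_m) := dist1 (angle (tnth x i)) (angle (column A j)) `^ p.
have rowE i : \sum_j pi0 i j = if I i then N^-1 else 0.
  rewrite /pi0; case: (I i) => /=; last by rewrite big1.
  rewrite (bigD1 (sg i))//= eqxx big1 ?addr0// => j js.
  by rewrite eq_sym (negbTE js).
have tot : \sum_i \sum_j pi0 i j = 1.
  under eq_bigr do rewrite rowE.
  rewrite -big_mkcond/= sumr_const -[X in _ *+ X]/(#|I|).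
  rewrite (_ : #|I| = n_exceed tau x); last by rewrite /n_exceed cardsE.
  by rewrite -[RHS](mulVf (lt0r_neq0 Np)) mulr_natr.
have cK i j : 0 <= c i j <= 2 `^ p.
  rewrite powR_ge0/= ge0_ler_powR ?nnegrE ?dist1_ge0 ?dist1_angle_le2//; exact: ltW.
have [||pi [pi_ge0 pirow picol picost]] := @repair_plan R _ _ pi0 c w (2 `^ p) _ _ tot w1 cK.
- by move=> i j; rewrite /pi0; case: ifP => // _; rewrite invr_ge0 ltW.
- by move=> j; exact: spectral_weight_ge0.
pose C (k : 'I_n * 'I_m) := NngNum (pi_ge0 k.1 k.2).
pose z (k : 'I_n * 'I_m) := (angle (tnth x k.1), angle (column A k.2)).
have C1 : \sum_k (C k)%:num = 1.
  rewrite -(pair_bigA _ (fun i j => pi i j))/=; under eq_bigr do rewrite pirow.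
  exact: tot.
have gE S : plan_measure z C1 S = (\sum_i \sum_j (pi i j)%:E * \d_(z (i, j)) S)%E.
  by rewrite plan_measureE (pair_bigA _ (fun i j => (pi i j)%:E * \d_(z (i, j)) S)%E).
have coup : coupling (empirical_angular_measure tau x) (spectral_measure alpha A)
    (plan_measure z C1).
  move=> B mB; split.
    apply: etrans (gE _) _.
    transitivity (\sum_(i | I i) (N^-1)%:E * \d_(angle (tnth x i)) B)%E; last first.
      rewrite -ge0_sume_distrr//.
    rewrite [RHS]big_mkcond; apply: eq_bigr => i _ /=.
    transitivity (\sum_j (pi i j)%:E * \d_(angle (tnth x i)) B)%E.
      apply: eq_bigr => j _; congr (_ * _)%E; rewrite !diracE; congr ((_ : bool)%:R)%:E.
      by apply/idP/idP; rewrite !inE //= => -[].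
    rewrite -ge0_sume_distrl; last by move=> j _; rewrite lee_fin.
    by rewrite sumEFin pirow rowE /=; case: ifP => // _; rewrite mul0e.
  apply: etrans (gE _) _.
  rewrite exchange_big; apply: eq_bigr => j _ /=.
  transitivity (\sum_i (pi i j)%:E * \d_(angle (column A j)) B)%E.
    apply: eq_bigr => i _; congr (_ * _)%E; rewrite !diracE; congr ((_ : bool)%:R)%:E.
    by apply/idP/idP; rewrite !inE //= => -[].
  rewrite -ge0_sume_distrl; last by move=> i _; rewrite lee_fin.
  by rewrite sumEFin picol.
pose f (y : d.-tuple R * d.-tuple R) := (dist1 y.1 y.2 `^ p)%:E.
have mf : measurable_fun [set: d.-tuple R * d.-tuple R] f.
  by apply/measurable_EFinP; exact: (measurableT_comp (measurable_powR p) measurable_dist1).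
have If : (\int[plan_measure z C1]_y f y = (\sum_i \sum_j pi i j * c i j)%:E)%E.
  rewrite integral_plan_measure//; last by move=> y; rewrite lee_fin powR_ge0.
  by rewrite sumEFin pair_bigA.
rewrite /wasserstein; set W := ereal_inf _.
have WI : (W <= \int[plan_measure z C1]_y f y)%E.
  by apply: ereal_inf_lbound; exists (plan_measure z C1).
have W0 : (0 <= W)%E.
  apply: le_ereal_inf_tmp => _ [g _ <-]; apply: integral_ge0 => y _.
  by rewrite lee_fin powR_ge0.
have -> : (W `^ p^-1 `^ p = W)%E.
  by rewrite -poweRrM mulVf ?gt_eqF// poweRe1.
apply: le_trans WI _; rewrite If lee_fin; apply: le_trans picost _.
rewrite mulrDr lerD//.
  rewrite mulr_sumr [leRHS]big_mkcond/=; apply: ler_sum => i _.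
  rewrite /pi0 /=; case: ifP => _ /=; last by rewrite big1// => j _; rewrite mul0r.
  rewrite (bigD1 (sg i))//= eqxx big1 ?addr0; last first.
    by move=> j js; rewrite eq_sym (negbTE js) mul0r.
  rewrite mulrA mulrC ler_wpM2r ?invr_ge0 ?(ltW Np)//; exact: dist1_powR_le.
rewrite ler_wpM2l ?powR_ge0// ler_sum// => j _.
by rewrite [X in _ <= Num.max _ (X - _)]big_mkcond.
Qed.

End wasserstein_bound.

Lemma is_derive_powR_add1 (R : realType) (c x : R) : 0 < 1 + x ->
  is_derive x (1 : R) (fun y => (1 + y) `^ c) (c * (1 + x) `^ (c - 1)).
Proof.
move=> x1.
have := is_deriveD (is_derive_cst (1 : R) x (1 : R)) (is_derive_id x (1 : R)).
rewrite add0r => d1.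
by have := is_derive1_comp (is_derive1_powR c x1) d1; rewrite mulr1.
Qed.

(** * The Pareto law *)

Section pareto_tail.
Variable R : realType.
Local Open Scope ereal_scope.

(** Pushing forward along the identity exchanges the two versions of Lebesgue measure, so that the
    fundamental theorem of calculus can be applied. *)
Lemma ge0_integral_lebesgueR (D : set R) (f : R -> \bar R) : measurable D ->
  measurable_fun D f -> (forall x, D x -> 0 <= f x) ->
  \int[@lebesgueR R]_(x in D) f x = \int[@lebesgue_measure R]_(x in D) f x.
Proof.
move=> mD mf f0.
have mid : measurable_fun setT (id : measurableTypeR R -> R) by [].
transitivity (\int[pushforward (@lebesgue_measure R) (id : measurableTypeR R -> R)]_(x in D) f x).
  exact: eq_measure_integral.
rewrite (ge0_integral_pushforward mid)//.
by move=> x; rewrite inE => /f0.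
Qed.

Variable alpha : R.
Hypothesis alpha0 : (0 < alpha)%R.

Definition pareto_pdf (x : R) : R := (alpha * (1 + x) `^ (- (alpha + 1)))%R.

Lemma measurable_pareto_pdf : measurable_fun setT pareto_pdf.
Proof.
apply: measurable_funM => //.
apply: (measurableT_comp (measurable_powR _)).
exact: measurable_funD.
Qed.

Lemma pareto_pdf_ge0 x : (0 <= pareto_pdf x)%R.
Proof. by rewrite mulr_ge0 ?powR_ge0// ltW. Qed.

Lemma integral_pareto_tail (a : R) : (0 <= a)%R ->
  \int[@lebesgueR R]_(x in `]a, +oo[) (pareto_pdf x)%:E = ((1 + a) `^ (- alpha))%:E.
Proof.
move=> a0.
have mp : measurable_fun `]a, +oo[ (EFin \o pareto_pdf).
  by apply/measurable_EFinP; apply: measurable_funTS; exact: measurable_pareto_pdf.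
rewrite ge0_integral_lebesgueR//; last by move=> x _; rewrite lee_fin pareto_pdf_ge0.
rewrite integral_itv_obnd_cbnd//.
pose F (x : R) : R := (- (1 + x) `^ (- alpha))%R.
have dF (x : R) : (a <= x)%R -> is_derive x (1 : R)%R F (pareto_pdf x).
  move=> ax; have x1 : (0 < 1 + x)%R by lra.
  have := is_deriveN (is_derive_powR_add1 (- alpha)%R x1).
  by rewrite mulNr opprK /pareto_pdf opprD.
have Fc (x : R) : (a <= x)%R -> {for x, continuous F}.
  move=> ax; apply: differentiable_continuous; apply/derivable1_diffP.
  by have [] := dF x ax.
rewrite (@ge0_continuous_FTC2y _ _ F _ 0%R)//.
- by rewrite /F EFinN oppeK add0e.
- by move=> x _; exact: pareto_pdf_ge0.
- apply: continuous_in_subspaceT => x; rewrite inE/= in_itv/= andbT => ax.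
  have x1 : (0 < 1 + x)%R by lra.
  have [d1 _] := is_derive_powR_add1 (- (alpha + 1))%R x1.
  apply: cvgM; first exact: cvg_cst.
  have /differentiable_continuous := (derivable1_diffP _ _).1 d1.
  exact.
- rewrite -oppr0; apply: cvgN; apply/cvgr0Pnorm_le => e e0; near=> x.
  have x1 : (0 < 1 + x)%R by near: x; exists 0%R; split => // x /=; lra.
  rewrite ger0_norm ?powR_ge0// powRN -[leRHS]invrK lef_pV2 ?posrE ?invr_gt0 ?powR_gt0//.
  have -> : (e^-1 = (e^-1 `^ alpha^-1) `^ alpha)%R.
    by rewrite -powRrM mulVf ?gt_eqF// powRr1// invr_ge0 ltW.
  apply: ge0_ler_powR; rewrite ?nnegrE ?powR_ge0 ?ltW//.
  near: x; exists (e^-1 `^ alpha^-1)%R; split; first exact: num_real.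
  by move=> x /= h; rewrite ltr_pwDl// ltW.
- by move=> x ax; case: (dF x (ltW ax)).
- exact/cvg_at_right_filter/Fc.
- move=> x; rewrite in_itv/= andbT => ax; rewrite derive1E.
  by have [_ ->] := dF x (ltW ax).
Unshelve. all: by end_near. Qed.

Lemma integral_pareto_itv (a b : R) : (0 <= a <= b)%R ->
  \int[@lebesgueR R]_(x in `]a, b]) (pareto_pdf x)%:E =
  ((1 + a) `^ (- alpha) - (1 + b) `^ (- alpha))%:E.
Proof.
move=> /andP[a0 ab]; have b0 := le_trans a0 ab.
have := integral_pareto_tail a0.
rewrite (@itv_bndbnd_setU _ _ _ (BRight b)) ?bnd_simp//.
rewrite ge0_integral_setU//=; last 3 first.
- by apply/measurable_EFinP; apply: measurable_funTS; exact: measurable_pareto_pdf.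
- by move=> x _; rewrite lee_fin pareto_pdf_ge0.
- rewrite disj_set2E; apply/eqP/seteqP; split => // x [] /=; rewrite !in_itv/= andbT.
  by move=> /andP[_ xb] bx; have := lt_le_trans bx xb; rewrite ltxx.
rewrite integral_pareto_tail// EFinB => <-.
by rewrite addeK.
Qed.

End pareto_tail.

Section pareto_mass.
Variables (R : realType) (alpha : R) (m : nat).
Hypothesis alpha0 : 0 < alpha.
Implicit Types B C : set (m.-tuple R).

Lemma measurable_orthant : measurable (@orthant R m).
Proof.
rewrite (_ : @orthant R m = \bigcap_(i in [set: 'I_m]) ((@tnth _ _)^~ i @^-1` `[0, +oo[)).
  apply: fin_bigcap_measurable => // i _.
  rewrite -[X in measurable X]setTI; exact: measurable_tnth.
apply/seteqP; split => z /= h i; first by move=> _; rewrite /= in_itv/= andbT; exact: h.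
by have := h i I; rewrite /= in_itv/= andbT.
Qed.

Lemma pareto_densityE (z : m.-tuple R) :
  pareto_density alpha z = \prod_(i < m) pareto_pdf alpha (tnth z i).
Proof. by rewrite /pareto_density big_split/= prodr_const card_ord. Qed.

Lemma measurable_pareto_density : measurable_fun [set: m.-tuple R] (pareto_density alpha).
Proof.
rewrite (_ : pareto_density alpha = fun z : m.-tuple R =>
  \prod_(i < m) pareto_pdf alpha (tnth z i)); last exact/funext/pareto_densityE.
apply: measurable_prod => i _; apply: (measurableT_comp (measurable_pareto_pdf alpha)).
exact: measurable_tnth.
Qed.

Lemma pareto_density_ge0 (z : m.-tuple R) : 0 <= pareto_density alpha z.
Proof. by rewrite pareto_densityE prodr_ge0// => i _; exact: pareto_pdf_ge0. Qed.

Lemma pareto_density_gt0 (z : m.-tuple R) : orthant z -> 0 < pareto_density alpha z.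
Proof.
move=> z0; rewrite /pareto_density mulr_gt0 ?exprn_gt0// prodr_gt0// => i _.
by rewrite powR_gt0// (lt_le_trans ltr01)// lerDl.
Qed.

Definition pareto_mass B : \bar R :=
  (\int[@lebesgue_tuple R m]_(z in B `&` @orthant R m) (pareto_density alpha z)%:E)%E.

Lemma pareto_massE B : measurable B ->
  (pareto_mass B = \int[@lebesgue_tuple R m]_z
     (\1_B z * (\1_(@orthant R m) z * pareto_density alpha z))%:E)%E.
Proof.
move=> mB; rewrite /pareto_mass integral_mkcond; apply: eq_integral => z _.
rewrite patchE in_setI !indicE.
by case: (z \in B) => /=; case: (z \in _); rewrite ?(mul0r, mul1r).
Qed.

Definition pareto_mass1 (I : set R) : \bar R :=
  (\int[@lebesgueR R]_(x in I `&` `[0%R, +oo[) (pareto_pdf alpha x)%:E)%E.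

Lemma pareto_mass_rect (I : 'I_m -> set R) : (forall i, measurable (I i)) ->
  (pareto_mass [set z | forall i, I i (tnth z i)] = \prod_(i < m) pareto_mass1 (I i))%E.
Proof.
move=> mI; rewrite pareto_massE; last first.
  rewrite (_ : [set z : m.-tuple R | _] = \bigcap_(i in [set: 'I_m]) ((@tnth _ _)^~ i @^-1` I i)).
    apply: fin_bigcap_measurable => // i _.
    rewrite -[X in measurable X]setTI; exact: measurable_tnth.
  by apply/seteqP; split => t /= => [h i _|h i]; exact: h.
pose f i x := (\1_(I i `&` `[0, +oo[) x * pareto_pdf alpha x)%:E.
transitivity (\int[@lebesgue_tuple R m]_z \prod_(i < m) f i (tnth z i))%E.
  apply: eq_integral => z _; rewrite prodEFin; congr EFin.
  rewrite big_split/= -pareto_densityE mulrA; congr (_ * _).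
  rewrite !indicE; case: (boolP (z \in [set _ | _])) => [|/negP]; rewrite inE /=.
    move=> zI; rewrite mul1r; case: (boolP (z \in _)) => [|/negP]; rewrite inE.
      move=> z0; rewrite big1// => i _; rewrite indicE mem_set//; split => //=.
      by rewrite in_itv/= andbT.
    move=> /existsNP[i zi]; rewrite (bigD1 i)//= indicE memNset ?mul0r//.
    by move=> [_ /=]; rewrite in_itv/= andbT.
  move=> /existsNP[i zi]; rewrite mul0r (bigD1 i)//= indicE memNset ?mul0r//.
  by case.
rewrite /lebesgue_tuple integral_power_measure_prod.
- apply: eq_bigr => i _; rewrite /pareto_mass1 [RHS]integral_mkcond.
  apply: eq_integral => x _; rewrite patchE /f indicE.
  by case: (x \in _); rewrite ?(mul0r, mul1r).
- move=> i; apply/measurable_EFinP; apply: measurable_funM.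
    by apply: measurable_indic; exact: measurableI.
  exact: measurable_pareto_pdf.
- by move=> i x; rewrite lee_fin mulr_ge0 ?pareto_pdf_ge0.
Qed.

Lemma pareto_mass1_gt (a : R) : 0 <= a ->
  pareto_mass1 `]a, +oo[ = ((1 + a) `^ (- alpha))%:E.
Proof.
move=> a0; rewrite -(integral_pareto_tail alpha0 a0) /pareto_mass1.
rewrite setIidl// => x /=; rewrite !in_itv/= !andbT => /ltW; exact: le_trans.
Qed.

Lemma pareto_mass1_itv (a b : R) : 0 <= a <= b ->
  pareto_mass1 `]a, b] = ((1 + a) `^ (- alpha) - (1 + b) `^ (- alpha))%:E.
Proof.
move=> /[dup] ab /andP[a0 _]; rewrite -(integral_pareto_itv alpha0 ab) /pareto_mass1.
rewrite setIidl// => x /=; rewrite !in_itv/= andbT => /andP[/ltW + _]; exact: le_trans.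
Qed.

Lemma pareto_mass1T : pareto_mass1 setT = 1%E.
Proof.
have mp (D : set R) : measurable D -> measurable_fun D (EFin \o pareto_pdf alpha).
  by move=> mD; apply/measurable_EFinP; apply: measurable_funTS; exact: measurable_pareto_pdf.
have p0 (D : set R) x : D x -> (0 <= (pareto_pdf alpha x)%:E)%E.
  by rewrite lee_fin pareto_pdf_ge0.
rewrite /pareto_mass1 setTI ge0_integral_lebesgueR//; [|exact: mp|exact: p0].
rewrite -integral_itv_obnd_cbnd; last exact: mp.
rewrite -ge0_integral_lebesgueR//; [|exact: mp|exact: p0].
by rewrite integral_pareto_tail// addr0 powR1.
Qed.

Lemma pareto_massT : pareto_mass setT = 1%E.
Proof.
have := @pareto_mass_rect (fun _ => setT) (fun _ => measurableT).
rewrite big1; last by move=> i _; exact: pareto_mass1T.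
by move=> <-; congr pareto_mass; apply/seteqP; split.
Qed.

Lemma pareto_mass_pair (i j : 'I_m) (I J : set R) : i != j ->
  measurable I -> measurable J ->
  (pareto_mass [set z | I (tnth z i) /\ J (tnth z j)] =
   pareto_mass1 I * pareto_mass1 J)%E.
Proof.
move=> ij mI mJ.
pose K k := if k == i then I else if k == j then J else setT.
have := @pareto_mass_rect K; rewrite (bigD1 i)//= (bigD1 j) 1?eq_sym//= big1; last first.
  move=> k /andP[ki kj]; rewrite /K (negbTE ki) (negbTE kj); exact: pareto_mass1T.
have Ki : K i = I by rewrite /K eqxx.
have Kj : K j = J by rewrite /K eq_sym (negbTE ij) eqxx.
rewrite mule1 Ki Kj => <-.
  congr pareto_mass; apply/seteqP; split => z /=.
    by move=> [Ii Jj] k; rewrite /K; case: eqVneq => [->//|_]; case: eqVneq => [->|].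
  by move=> h; split; [rewrite -Ki|rewrite -Kj]; exact: h.
by move=> k; rewrite /K; case: ifP => // _; case: ifP.
Qed.

Lemma pareto_mass_single (i : 'I_m) (I : set R) : measurable I ->
  (pareto_mass [set z | I (tnth z i)] = pareto_mass1 I)%E.
Proof.
move=> mI; pose K k := if k == i then I else setT.
have := @pareto_mass_rect K; rewrite (bigD1 i)//= big1; last first.
  move=> k ki; rewrite /K (negbTE ki); exact: pareto_mass1T.
have Ki : K i = I by rewrite /K eqxx.
rewrite mule1 Ki => <-.
  congr pareto_mass; apply/seteqP; split => z /=.
    by move=> Ii k; rewrite /K; case: eqVneq => [->|].
  by rewrite -Ki; exact.
by move=> k; rewrite /K; case: ifP.
Qed.

Lemma pareto_mass_ge0 B : (0 <= pareto_mass B)%E.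
Proof. by apply: integral_ge0 => z _; rewrite lee_fin pareto_density_ge0. Qed.

(** Monotonicity, union bounds and Bonferroni inequalities for [pareto_mass] are all derived from
    this one principle: a pointwise comparison of weighted indicators on the orthant integrates. *)
Lemma pareto_mass_dom (K L : Type) (s : seq K) (t : seq L) (a : K -> R) (b : L -> R)
    (B : K -> set (m.-tuple R)) (C : L -> set (m.-tuple R)) :
  (forall k, 0 <= a k) -> (forall l, 0 <= b l) ->
  (forall k, measurable (B k)) -> (forall l, measurable (C l)) ->
  (forall z, orthant z -> \sum_(k <- s) a k * \1_(B k) z <= \sum_(l <- t) b l * \1_(C l) z) ->
  (\sum_(k <- s) (a k)%:E * pareto_mass (B k) <= \sum_(l <- t) (b l)%:E * pareto_mass (C l))%E.
Proof.
move=> a0 b0 mB mC h.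
pose g z := \1_(@orthant R m) z * pareto_density alpha z.
have g0 z : 0 <= g z by rewrite mulr_ge0 ?pareto_density_ge0.
have mg : measurable_fun [set: m.-tuple R] g.
  apply: measurable_funM; last exact: measurable_pareto_density.
  by apply: measurable_indic; exact: measurable_orthant.
have mBg (B' : set (m.-tuple R)) : measurable B' ->
    measurable_fun [set: m.-tuple R] (fun z => \1_B' z * g z).
  by move=> mB'; apply: measurable_funM => //; exact: measurable_indic.
have E (M : Type) (r : seq M) (c : M -> R) (D : M -> set (m.-tuple R)) :
    (forall k, 0 <= c k) -> (forall k, measurable (D k)) ->
    (\sum_(k <- r) (c k)%:E * pareto_mass (D k) =
     \int[@lebesgue_tuple R m]_z ((\sum_(k <- r) c k * \1_(D k) z) * g z)%:E)%E.
  move=> c0 mD.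
  under [RHS]eq_integral do rewrite mulr_suml -sumEFin.
  rewrite ge0_integral_sum//; last 2 first.
  - move=> k; apply/measurable_EFinP; under eq_fun do rewrite -mulrA.
    by apply: measurable_funM => //; exact: mBg.
  - by move=> k z _; rewrite lee_fin; apply: mulr_ge0 => //; exact: mulr_ge0.
  apply: eq_bigr => k _; rewrite pareto_massE// -ge0_integralZl//.
  - by apply: eq_integral => z _; rewrite -EFinM -/(g z) -mulrA.
  - by apply/measurable_EFinP; exact: mBg.
  - by move=> z _; rewrite lee_fin; apply: mulr_ge0 => //; exact: g0.
  - by rewrite lee_fin.
rewrite !E//; apply: ge0_le_integral => //.
- move=> z _; rewrite lee_fin; apply: mulr_ge0 => //; apply: sumr_ge0 => k _.
  exact: mulr_ge0.
- apply/measurable_EFinP; apply: measurable_funM => //.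
  apply: measurable_sum => k; apply: measurable_funM => //; exact: measurable_indic.
- apply/measurable_EFinP; apply: measurable_funM => //.
  apply: measurable_sum => k; apply: measurable_funM => //; exact: measurable_indic.
- move=> z _; rewrite lee_fin /g indicE; case: (boolP (z \in _)).
    by rewrite inE => z0; rewrite mul1r ler_wpM2r ?pareto_density_ge0//; exact: h.
  by rewrite mul0r !mulr0.
Qed.

End pareto_mass.

(** * Inequalities for powers and dyadic scales *)

Section power_inequalities.
Variable R : realType.

Lemma powRN_le (a x y : R) : 0 <= a -> 0 < x -> x <= y -> y `^ (- a) <= x `^ (- a).
Proof.
move=> a0 x0 xy; have y0 := lt_le_trans x0 xy.
rewrite !powRN lef_pV2 ?posrE ?powR_gt0//.
by apply: ge0_ler_powR => //; rewrite nnegrE ltW.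
Qed.

Lemma natr_powRN_le1 (n : nat) (a : R) : (1 <= n)%N -> 0 <= a -> n%:R `^ (- a) <= 1 :> R.
Proof.
by move=> n1 a0; have := @powRN_le a 1 n%:R a0 ltr01; rewrite powR1 ler1n; apply.
Qed.

Lemma powRN_div (a x y : R) : 0 <= x -> 0 <= y ->
  (x / y) `^ (- a) = y `^ a * x `^ (- a).
Proof.
move=> x0 y0; rewrite powRM ?invr_ge0// mulrC; congr (_ * _).
by rewrite -(powR_inv1 y0) -powRrM mulrNN mul1r.
Qed.

(** With q = y / x, factor out x^(-a) and use q^(-a) = exp(- a ln q) >= 1 - a ln q >= 1 - a (q -
    1). *)
Lemma powRN_sub_le (a x y : R) : 0 <= a -> 0 < x -> x <= y ->
  x `^ (- a) - y `^ (- a) <= a * x `^ (- a) * ((y - x) / x).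
Proof.
move=> a0 x0 xy; have y0 := lt_le_trans x0 xy.
have yx : y = x * (y / x) by rewrite mulrC divfK ?gt_eqF.
have q1 : 1 <= y / x by rewrite ler_pdivlMr// mul1r.
have q0 : 0 < y / x by rewrite divr_gt0.
have -> : y `^ (- a) = x `^ (- a) * (y / x) `^ (- a).
  by rewrite {1}yx powRM ?ltW.
rewrite -{1}(mulr1 (x `^ (- a))) -mulrBr (mulrC a) -mulrA ler_wpM2l ?powR_ge0//.
rewrite lerBlDr -lerBlDl.
apply: (@le_trans _ _ (1 - a * ln (y / x))).
  rewrite lerD2l lerN2 ler_wpM2l// mulrBl mulfV ?gt_eqF//.
  have := @le_ln1Dx R (y / x - 1); rewrite addrCA subrr addr0; apply; lra.
rewrite /powR gt_eqF// -mulNr; exact: expR_ge1Dx.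
Qed.

Lemma powR_le_self (x g : R) : 1 <= x -> g <= 1 -> x `^ g <= x.
Proof. by move=> x1 g1; exact: ler1_powR. Qed.

(** Either [x] is still below the last scale, or some k has 2^-(k+1) t <= x < 2^-k t, and then [y]
    exceeds 2^-(k+1) t because it exceeds [x]. In the application [x] is the deficit of one
    coordinate and [y] what another one supplies. *)
Lemma dyadic_cover (t x y : R) (K : nat) : x < t -> x < y ->
  (1 : R) <= \sum_(k < K) ((x < 2^-1 ^+ k * t) && (2^-1 ^+ k.+1 * t < y))%R%:R +
       (x < 2^-1 ^+ K * t)%R%:R.
Proof.
move=> xt xy; elim: K => [|K ih]; first by rewrite big_ord0 add0r expr0 mul1r xt.
rewrite big_ord_recr/=; apply: le_trans ih _; rewrite -addrA lerD2l.
case: (ltP x (2^-1 ^+ K * t)) => //= _; last by rewrite addr_ge0.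
case: (ltP x (2^-1 ^+ K.+1 * t)) => h; first by rewrite lerDr.
by rewrite (le_lt_trans h xy) addr0.
Qed.

(** Replaces the truncated ratio by indicators of tail events, whose probabilities are explicit.
    Passing from K to K + 1, either the new indicator is 1 and its weight 2^-K pays for the old
    remainder, or [x / t] is already below the new remainder. *)
Lemma dyadic_min (t x : R) (K : nat) : 0 < t -> 0 <= x ->
  Num.min (x / t) 1 <= \sum_(k < K) 2^-1 ^+ k * (2^-1 ^+ k.+1 * t < x)%R%:R + 2^-1 ^+ K.
Proof.
move=> t0 x0; elim: K => [|K ih].
  by rewrite big_ord0 add0r expr0 ge_min lexx orbT.
rewrite big_ord_recr/=; case: (ltP (2^-1 ^+ K.+1 * t) x) => h.
  apply: le_trans ih _; rewrite -addrA lerD2l mulr1.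
  by rewrite lerDl exprn_ge0// invr_ge0.
rewrite ge_min; apply/orP; left; rewrite mulr0 addr0.
apply: (@le_trans _ _ (2^-1 ^+ K.+1)); first by rewrite ler_pdivrMr.
rewrite lerDr sumr_ge0// => k _; rewrite mulr_ge0// exprn_ge0// invr_ge0//.
Qed.

End power_inequalities.

(** * Exceedances under the product Pareto law *)

Section pareto_population.
Variables (R : realType) (alpha : R) (m : nat).
Hypothesis alpha0 : 0 < alpha.
Local Notation H B := (fine (pareto_mass alpha B)).
Implicit Types B C : set (m.-tuple R).

Lemma pareto_mass_fin B : measurable B -> pareto_mass alpha B = (H B)%:E.
Proof.
move=> mB; rewrite fineK// ge0_fin_numE ?pareto_mass_ge0//.
apply: (@le_lt_trans _ _ (pareto_mass alpha setT)); last by rewrite pareto_massT// ltry.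
have := @pareto_mass_dom R alpha m alpha0 unit unit [:: tt] [:: tt] (fun _ => 1) (fun _ => 1)
  (fun _ => B) (fun _ => setT) (fun _ => ler01) (fun _ => ler01) (fun _ => mB)
  (fun _ => measurableT).
rewrite !big_seq1 !mul1e; apply => z _; rewrite !big_seq1 !mul1r.
by rewrite indicT indicE /=; case: (_ \in _).
Qed.

Lemma mass_dom (K L : Type) (s : seq K) (t : seq L) (a : K -> R) (b : L -> R)
    (B : K -> set (m.-tuple R)) (C : L -> set (m.-tuple R)) :
  (forall k, 0 <= a k) -> (forall l, 0 <= b l) ->
  (forall k, measurable (B k)) -> (forall l, measurable (C l)) ->
  (forall z, orthant z -> \sum_(k <- s) a k * \1_(B k) z <= \sum_(l <- t) b l * \1_(C l) z) ->
  \sum_(k <- s) a k * H (B k) <= \sum_(l <- t) b l * H (C l).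
Proof.
move=> a0 b0 mB mC /(pareto_mass_dom alpha0 a0 b0 mB mC).
under eq_bigr do rewrite (pareto_mass_fin (mB _)) -EFinM.
under [X in (_ <= X)%E]eq_bigr do rewrite (pareto_mass_fin (mC _)) -EFinM.
by rewrite !sumEFin lee_fin.
Qed.

Lemma mass_ge0 B : 0 <= H B.
Proof. by rewrite fine_ge0// pareto_mass_ge0. Qed.

Lemma mass_mono B C : measurable B -> measurable C -> B `&` @orthant R m `<=` C ->
  H B <= H C.
Proof.
move=> mB mC BC.
have := @mass_dom unit unit [:: tt] [:: tt] (fun _ => 1) (fun _ => 1)
  (fun _ => B) (fun _ => C) (fun _ => ler01) (fun _ => ler01) (fun _ => mB)
  (fun _ => mC).
rewrite !big_seq1 !mul1r; apply => z z0; rewrite !big_seq1 !mul1r !indicE.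
case: (boolP (z \in B)) => [|_ //]; rewrite inE => zB.
by rewrite mem_set//; exact: BC.
Qed.

Variables (l u : R) (r : 'I_m -> R).
Hypotheses (l0 : 0 < l) (l1 : l < 1) (u1 : 1 < u) (m0 : (0 < m)%N).
Hypothesis rlu : forall j, l <= r j <= u.

Let r0 j : 0 < r j.
Proof. by have /andP[h _] := rlu j; exact: lt_le_trans h. Qed.

(** When [r j] is the l1 norm of column j of A, [halfspace t] is the exceedance event of X = A Z and
    [r j * tnth z j] is the contribution of coordinate j to the norm of X. *)
Definition ray (j : 'I_m) (t : R) : set (m.-tuple R) := [set z | t < r j * tnth z j].
Definition slab (j : 'I_m) (a b : R) : set (m.-tuple R) :=
  [set z | a < r j * tnth z j <= b].
Definition halfspace (t : R) : set (m.-tuple R) := [set z | t < \sum_j r j * tnth z j].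

Let tl j t := (1 + t / r j) `^ (- alpha).

Lemma rayE j t : ray j t = [set z | `]t / r j, +oo[%classic (tnth z j)].
Proof.
apply/seteqP; split => z; rewrite /ray/= in_itv/= andbT ltr_pdivrMr// mulrC//.
Qed.

Lemma slabE j a b : slab j a b = [set z | `]a / r j, b / r j]%classic (tnth z j)].
Proof.
apply/seteqP; split => z; rewrite /slab/= in_itv/= ltr_pdivrMr// ler_pdivlMr// mulrC//.
Qed.

Lemma measurable_coord (j : 'I_m) (I : set R) : measurable I ->
  measurable [set z : m.-tuple R | I (tnth z j)].
Proof.
by move=> mI; rewrite -[X in measurable X]setTI; apply: measurable_tnth.
Qed.

Lemma measurable_ray j t : measurable (ray j t).
Proof. by rewrite rayE; exact: measurable_coord. Qed.

Lemma measurable_slab j a b : measurable (slab j a b).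
Proof. by rewrite slabE; exact: measurable_coord. Qed.

Lemma measurable_halfspace t : measurable (halfspace t).
Proof.
have : measurable_fun [set: m.-tuple R] (fun z => \sum_j r j * tnth z j).
  by apply: measurable_sum => j; apply: measurable_funM => //; exact: measurable_tnth.
move=> /(_ measurableT _ (measurable_itv `]t, +oo[)); rewrite setTI.
by congr measurable; apply/seteqP; split => z; rewrite /halfspace/= in_itv/= andbT.
Qed.

Lemma mass_ray j t : 0 <= t -> H (ray j t) = tl j t.
Proof.
move=> t0; rewrite rayE pareto_mass_single// pareto_mass1_gt//.
by rewrite divr_ge0// ltW.
Qed.

Lemma mass_slab j a b : 0 <= a <= b -> H (slab j a b) = tl j a - tl j b.
Proof.
move=> /andP[a0 ab]; rewrite slabE pareto_mass_single// pareto_mass1_itv//.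
by rewrite divr_ge0 ?(ltW (r0 j))//= ler_pM2r// invr_gt0.
Qed.

Lemma mass_rayI i j s t : i != j -> 0 <= s -> 0 <= t ->
  H (ray i s `&` ray j t) = tl i s * tl j t.
Proof.
move=> ij s0 t0; rewrite !rayE.
have := @pareto_mass_pair R alpha m alpha0 i j _ _ ij
  (measurable_itv `]s / r i, +oo[) (measurable_itv `]t / r j, +oo[).
rewrite !pareto_mass1_gt ?divr_ge0 ?(ltW (r0 _))// => h.
by rewrite /setI/= [X in fine X]h.
Qed.

Lemma mass_slabI i j a b t : j != i -> 0 <= a <= b -> 0 <= t ->
  H (slab j a b `&` ray i t) = (tl j a - tl j b) * tl i t.
Proof.
move=> ij /andP[a0 ab] t0; rewrite rayE slabE.
have := @pareto_mass_pair R alpha m alpha0 j i _ _ ij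
  (measurable_itv `]a / r j, b / r j]) (measurable_itv `]t / r i, +oo[).
rewrite pareto_mass1_gt ?divr_ge0 ?(ltW (r0 _))// pareto_mass1_itv//; last first.
  by rewrite divr_ge0 ?(ltW (r0 j))//= ler_pM2r// invr_gt0.
by move=> h; rewrite /setI/= [X in fine X]h.
Qed.

Let gam := Num.min 1 alpha.

Lemma tail_ge0 j t : 0 <= tl j t. Proof. exact: powR_ge0. Qed.

Lemma tail_le j t : 0 < t -> tl j t <= r j `^ alpha * t `^ (- alpha).
Proof.
move=> t0; have tr : 0 < t / r j by rewrite divr_gt0.
apply: (@le_trans _ _ ((t / r j) `^ (- alpha))).
  by apply: powRN_le => //; [exact: ltW|rewrite lerDr].
by rewrite powRN_div// ltW.
Qed.

Lemma tail_le_unif j t : 0 < t -> tl j t <= u `^ alpha * t `^ (- alpha).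
Proof.
move=> t0; apply: le_trans (tail_le j t0) _; rewrite ler_wpM2r ?powR_ge0//.
have /andP[_ ru] := rlu j.
by apply: ge0_ler_powR => //; rewrite ?nnegrE ltW// (lt_trans _ u1).
Qed.

Lemma tail_ge j t : 1 <= t ->
  r j `^ alpha * t `^ (- alpha) * (1 - alpha * u / t) <= tl j t.
Proof.
move=> t1; have t0 : 0 < t by exact: lt_le_trans t1.
have tr : 0 < t / r j by rewrite divr_gt0.
have /andP[_ ru] := rlu j.
have := @powRN_sub_le R alpha (t / r j) (1 + t / r j) (ltW alpha0) tr.
rewrite lerDr => /(_ ler01).
rewrite addrK div1r invf_div.
have -> : (t / r j) `^ (- alpha) = r j `^ alpha * t `^ (- alpha).
  by rewrite powRN_div// ltW.
rewrite -/(tl j t); set x := r j `^ alpha * _ => h.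
have x0 : 0 <= x by rewrite mulr_ge0 ?powR_ge0.
have h2 : alpha * x * (r j / t) <= x * (alpha * u / t).
  rewrite [leLHS](_ : _ = x * (alpha * r j / t)); last by ring.
  by rewrite ler_wpM2l// ler_pM2r ?invr_gt0// ler_pM2l.
rewrite mulrBr mulr1; lra.
Qed.

(* The exponent [min 1 alpha] makes the dyadic weights [2^-k] compensate the
   growth of the tail at the scales [2^-(k+1) t]. *)
Lemma tail_dyadic i k t : 1 <= t ->
  2^-1 ^+ k * tl i (2^-1 ^+ k.+1 * t / m%:R) <= 2 * (u * m%:R) * t `^ (- gam).
Proof.
move=> t1; have t0 : 0 < t by exact: lt_le_trans t1.
have mp : 0 < m%:R :> R by rewrite ltr0n.
have g1 : gam <= 1 by rewrite ge_min lexx.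
have g0 : 0 < gam by rewrite lt_min ltr01.
have ga : gam <= alpha by rewrite ge_min lexx orbT.
have /andP[_ ru] := rlu i.
have u0 : 0 < u by exact: lt_trans u1.
have h0 : 0 < 2^-1 ^+ k.+1 :> R by rewrite exprn_gt0// invr_gt0.
set D := 2^-1 ^+ k.+1 in h0 *.
(* [c] bounds the factor dividing t. Weakening the exponent from alpha to [gam], allowed since the
   base is at least 1, bounds the tail by c^gam t^(-gam); as [gam <= 1 <= c], this is at most c
   t^(-gam), and 2^-k c = 2 u m for every k. *)
pose c := u * m%:R / D.
have c1 : 1 <= c.
  rewrite ler_pdivlMr// mul1r; apply: (@le_trans _ _ 1).
    by rewrite exprn_ile1// ?invr_ge0// invf_le1// ler1n.
  by rewrite (le_trans (ltW u1))// ler_peMr ?(ltW u0)// ler1n.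
have c0 : 0 < c by exact: lt_le_trans c1.
have X0 : 0 < t / c by rewrite divr_gt0.
have Xle : t / c <= D * t / m%:R / r i.
  rewrite /c invf_div mulrA [t * D]mulrC invfM mulrA [leLHS]mulrAC ler_wpM2l//.
    by rewrite divr_ge0 ?mulr_ge0 ?ltW.
  by rewrite lef_pV2 ?posrE.
have : tl i (D * t / m%:R) <= c * t `^ (- gam).
  apply: (@le_trans _ _ ((1 + D * t / m%:R / r i) `^ (- gam))).
    by apply: ler_powR; [rewrite lerDl (le_trans (ltW X0))|rewrite lerN2].
  apply: (@le_trans _ _ ((t / c) `^ (- gam))).
    by apply: powRN_le => //; [exact: ltW|rewrite ler_wpDl].
  rewrite powRN_div ?(ltW t0) ?(ltW c0)// ler_wpM2r ?powR_ge0//.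
  exact: powR_le_self.
move=> h; apply: (@le_trans _ _ (2^-1 ^+ k * (c * t `^ (- gam)))).
  by rewrite ler_wpM2l// exprn_ge0// invr_ge0.
rewrite le_eqVlt; apply/orP; left; apply/eqP; rewrite /c /D exprS; field.
by rewrite expf_neq0// invr_eq0 pnatr_eq0.
Qed.

(** Lower bound for coordinate j when its deficit to t is below 2^-k t and it lies in its sector.
    The floor t / m keeps tails at this level comparable to t^(-alpha), also for k = 0. *)
Let low (k : nat) (t : R) : R := Num.max (t * (1 - 2^-1 ^+ k)) (t / m%:R).
Let Cs := alpha * m%:R `^ (alpha + 1) * u `^ alpha.

(** The slab has relative width at most m 2^-k, because its lower end is at least t / m and its
    width at most 2^-k t. [powRN_sub_le] turns this into a probability. *)
Lemma slab_tail_le j k t : 1 <= t ->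
  tl j (low k t) - tl j t <= Cs * 2^-1 ^+ k * t `^ (- alpha).
Proof.
set a := low k t; move=> t1; have t0 : 0 < t by exact: lt_le_trans t1.
have mp : 0 < m%:R :> R by rewrite ltr0n.
have m1 : 1 <= m%:R :> R by rewrite ler1n.
have /andP[_ ru] := rlu j.
have u0 : 0 < u by exact: lt_trans u1.
have at_ : a <= t.
  rewrite /a /low ge_max; apply/andP; split.
    by apply: ler_piMr; [exact: ltW|rewrite lerBlDr lerDl exprn_ge0// invr_ge0].
  by rewrite ler_pdivrMr// ler_peMr// ltW.
have ma : t / m%:R <= a by rewrite le_max lexx orbT.
have tm0 : 0 < t / m%:R by rewrite divr_gt0.
have a0 : 0 < a by exact: lt_le_trans ma.
have x0 : 0 < 1 + a / r j by rewrite addr_gt0// divr_gt0.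
have xy : 1 + a / r j <= 1 + t / r j by rewrite lerD2l ler_pM2r// invr_gt0.
apply: le_trans (powRN_sub_le (ltW alpha0) x0 xy) _.
have e0 : 0 < a / r j by rewrite divr_gt0.
have h1 : (1 + a / r j) `^ (- alpha) <= u `^ alpha * m%:R `^ alpha * t `^ (- alpha).
  apply: (@le_trans _ _ ((a / r j) `^ (- alpha))).
    by apply: powRN_le => //; [exact: ltW|rewrite lerDr].
  rewrite powRN_div ?(ltW a0) ?(ltW (r0 j))// -mulrA ler_pM ?powR_ge0//.
    by apply: ge0_ler_powR; rewrite ?nnegrE ?(ltW alpha0) ?(ltW u0) ?(ltW (r0 j)).
  by rewrite -powRN_div ?(ltW t0) ?(ltW mp)//; apply: powRN_le => //; exact: ltW.
have h2 : (1 + t / r j - (1 + a / r j)) / (1 + a / r j) <= m%:R * 2^-1 ^+ k.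
  have -> : (1 + t / r j - (1 + a / r j)) / (1 + a / r j) = (t - a) / (r j + a).
    by field; rewrite ?gt_eqF//= ?addr_gt0.
  rewrite ler_pdivrMr ?addr_gt0//; apply: (@le_trans _ _ (t * 2^-1 ^+ k)).
    have : t * (1 - 2^-1 ^+ k) <= a by rewrite le_max lexx.
    by rewrite mulrBr mulr1; lra.
  rewrite -mulrA mulrCA [leLHS]mulrC ler_wpM2l ?exprn_ge0 ?invr_ge0//.
  apply: (@le_trans _ _ (m%:R * (t / m%:R))); first by rewrite mulrC divfK// gt_eqF.
  by rewrite ler_wpM2l ?(ltW mp)// (le_trans ma)// lerDr ltW.
have mm : m%:R `^ (alpha + 1) = m%:R `^ alpha * m%:R :> R.
  by rewrite powRD ?(gt_eqF mp) ?implybT// powRr1.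
rewrite /Cs mm; set A := (1 + _) `^ _ in h1 *; set B := (_ / _) in h2 *.
have A0 : 0 <= A by exact: powR_ge0.
have := ler_wpM2l (ltW alpha0) (ler_pM A0 _ h1 h2) => h.
rewrite [leRHS](_ : _ = alpha * (u `^ alpha * m%:R `^ alpha * t `^ (- alpha) * (m%:R * 2^-1 ^+ k))); last by ring.
rewrite -mulrA; apply: h; rewrite /B divr_ge0 ?(ltW x0)//; lra.
Qed.

Lemma mass_cover (L : eqType) (s : seq L) (B : set (m.-tuple R))
    (C : L -> set (m.-tuple R)) : measurable B -> (forall i, measurable (C i)) ->
  (forall z, orthant z -> B z -> exists2 i, i \in s & C i z) ->
  H B <= \sum_(i <- s) H (C i).
Proof.
move=> mB mC BC.
have := @mass_dom unit L [:: tt] s (fun _ => 1) (fun _ => 1) (fun _ => B) C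
  (fun _ => ler01) (fun _ => ler01) (fun _ => mB) mC.
rewrite -!mulr_sumr !mul1r big_seq1.
apply => z z0; rewrite big_seq1 mul1r indicE; case: (boolP (z \in B)); last first.
  by rewrite sumr_ge0// => i _; rewrite mul1r.
rewrite inE => zB; have [i si Ciz] := BC z z0 zB.
by rewrite (big_rem i)//= mul1r indicE mem_set// lerDl sumr_ge0// => k _; rewrite mul1r.
Qed.

(** Coordinate j alone does not reach t, and m times coordinate i exceeds what is missing. *)
Let wedge j i t : set (m.-tuple R) :=
  ray j (t / m%:R) `&` [set z | t < r j * tnth z j + m%:R * (r i * tnth z i)] `&`
  [set z | r j * tnth z j <= t].

Let measurable_wedge j i t : measurable (wedge j i t).
Proof.
apply: measurableI; first apply: measurableI; first exact: measurable_ray.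
- have : measurable_fun [set: m.-tuple R] (fun z => r j * tnth z j + m%:R * (r i * tnth z i)).
    apply: measurable_funD; apply: measurable_funM => //; first exact: measurable_tnth.
    by apply: measurable_funM => //; exact: measurable_tnth.
  move=> /(_ measurableT _ (measurable_itv `]t, +oo[)); rewrite setTI.
  by congr measurable; apply/seteqP; split => z; rewrite /= in_itv/= andbT.
- have : measurable_fun [set: m.-tuple R] (fun z => r j * tnth z j).
    by apply: measurable_funM => //; exact: measurable_tnth.
  move=> /(_ measurableT _ (measurable_itv `]-oo, t])); rewrite setTI.
  by congr measurable; apply/seteqP; split => z; rewrite /= in_itv/=.
Qed.

(** Pigeonhole: if each of the m - 1 other coordinates were at most 1/m of the deficit t - r_j z_j,
    they could not fill it and the sum would stay below t. Only pairs of coordinates remain, so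
    pairwise independence suffices. *)
Lemma mass_sector_wedge j t : 0 <= t ->
  H (halfspace t `&` ray j (t / m%:R)) <= H (ray j t) + \sum_(i | i != j) H (wedge j i t).
Proof.
move=> t0; have mp : 0 < m%:R :> R by rewrite ltr0n.
pose C o := if o is Some i then wedge j i t else ray j t.
have := @mass_cover _ (None :: [seq Some i | i <- index_enum 'I_m & i != j])
  (halfspace t `&` ray j (t / m%:R)) C.
rewrite big_cons big_map big_filter; apply.
- by apply: measurableI; [exact: measurable_halfspace|exact: measurable_ray].
- by case=> [i|]; [exact: measurable_wedge|exact: measurable_ray].
move=> z z0 [hz rz]; case: (ltP t (r j * tnth z j)) => Vt.
  by exists None => //; rewrite mem_head.
case: (pselect (exists2 i, i != j & t < r j * tnth z j + m%:R * (r i * tnth z i))).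
  move=> [i ij h]; exists (Some i) => //.
  by rewrite inE /= mem_map ?mem_filter ?ij ?mem_index_enum// => ? ? [].
move=> no; exfalso; move: hz; rewrite /halfspace/= => hz.
suff : \sum_i r i * tnth z i <= t by rewrite leNgt hz.
rewrite (bigD1 j)//=; set W := \sum_(i | _) _.
have : m%:R * W <= (m%:R - 1) * (t - r j * tnth z j).
  have -> : m%:R - 1 = (\sum_(i < m | i != j) 1 : R).
    have : \sum_(i < m) (1 : R) = m%:R by rewrite sumr_const card_ord.
    by rewrite (bigD1 j)//= => <-; rewrite addrAC subrr add0r.
  rewrite mulr_sumr mulr_suml; apply: ler_sum => i ij; rewrite mul1r lerBrDl leNgt.
  by apply/negP => h; apply: no; exists i.
have : 0 <= t - r j * tnth z j by rewrite subr_ge0.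
set x := t - _ => x0 h; have : m%:R * W <= m%:R * x by apply: le_trans h _; nra.
by rewrite ler_pM2l// /x; lra.
Qed.

Lemma mass_wedge_le j i t K : i != j -> 1 <= t ->
  H (wedge j i t) <= \sum_(k < K) (tl j (low k t) - tl j t) * tl i (2^-1 ^+ k.+1 * t / m%:R) +
    (tl j (low K t) - tl j t).
Proof.
move=> ij t1; have t0 : 0 < t by exact: lt_le_trans t1.
have mp : 0 < m%:R :> R by rewrite ltr0n.
have m1 : 1 <= m%:R :> R by rewrite ler1n.
have lo k : 0 <= low k t <= t.
  rewrite /low le_max divr_ge0 ?(ltW t0) ?(ltW mp)// orbT/= ge_max; apply/andP; split.
    by apply: ler_piMr; [exact: ltW|rewrite lerBlDr lerDl exprn_ge0// invr_ge0].
  by rewrite ler_pdivrMr// ler_peMr// ltW.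
have h2 k : 0 <= 2^-1 ^+ k.+1 * t / m%:R.
  by rewrite !mulr_ge0// ?exprn_ge0 ?invr_ge0 ?(ltW t0) ?(ltW mp).
pose C o := if o is Some k then slab j (low (k : 'I_K) t) t `&` ray i (2^-1 ^+ k.+1 * t / m%:R)
  else slab j (low K t) t.
have := @mass_cover _ (None :: [seq Some k | k <- index_enum 'I_K]) (wedge j i t) C.
rewrite big_cons big_map /= mass_slab// addrC.
under eq_bigr do rewrite mass_slabI 1?eq_sym//.
apply.
- exact: measurable_wedge.
- by case=> [k|]; rewrite /C; [apply: measurableI; [exact: measurable_slab|exact: measurable_ray]|exact: measurable_slab].
move=> z z0 [[rz wz] Vt]; rewrite /ray/= in rz wz Vt.
set x := t - r j * tnth z j; set y := m%:R * (r i * tnth z i).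
have xt : x < t.
  rewrite /x ltrBlDr ltrDl; apply: le_lt_trans rz; exact: divr_ge0 (ltW t0) (ltW mp).
have xy : x < y by rewrite /x /y ltrBlDl.
have lowP k : x < 2^-1 ^+ k * t -> low k t < r j * tnth z j <= t.
  move=> xk; rewrite Vt andbT /low gt_max rz andbT mulrBr mulr1.
  by move: xk; rewrite /x; lra.
have := dyadic_cover K xt xy.
case: (ltP x (2^-1 ^+ K * t)) => [xK _|_ h].
  by exists None; [rewrite mem_head|exact: lowP].
have : exists k : 'I_K, (x < 2^-1 ^+ k * t) && (2^-1 ^+ k.+1 * t < y).
  apply: contrapT => /forallNP no; move: h; rewrite addr0 big1 ?ler10//.
  by move=> k _; have /negP/negbTE -> := no k.
move=> [k /andP[xk ky]]; exists (Some k).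
  by rewrite inE/= mem_map ?mem_index_enum// => ? ? [].
split; first exact: lowP.
by rewrite /ray/= ltr_pdivrMr// [ltRHS]mulrC.
Qed.

(** Bonferroni with ordered pairs: if some coordinate j0 exceeds t, the halfspace accounts for j0
    and the pairs (j0, j) account for every further exceedance. *)
Lemma mass_halfspace_ge t : 0 <= t ->
  \sum_j tl j t <= H (halfspace t) + \sum_i \sum_j (i != j)%:R * (tl i t * tl j t).
Proof.
move=> t0.
pose C o := if o is Some p then ray (p : 'I_m * 'I_m).1 t `&` ray p.2 t else halfspace t.
pose b o : R := if o is Some p then ((p : 'I_m * 'I_m).1 != p.2)%:R else 1.
have := @mass_dom 'I_m (option ('I_m * 'I_m)) (index_enum 'I_m)
  (None :: [seq Some p | p <- index_enum ('I_m * 'I_m)%type]) (fun _ => 1) b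
  (fun j => ray j t) C.
rewrite big_cons big_map /= mul1r; under eq_bigr do rewrite mul1r mass_ray//.
rewrite -(pair_bigA _ (fun i j => (i != j)%:R * H (ray i t `&` ray j t)))/=.
have -> : \sum_i \sum_j (i != j)%:R * H (ray i t `&` ray j t) =
    \sum_i \sum_j (i != j)%:R * (tl i t * tl j t).
  apply: eq_bigr => i _; apply: eq_bigr => j _.
  by have [->|ij] := eqVneq i j; [rewrite !mul0r|rewrite mass_rayI].
apply => //.
- by case=> [p|]; rewrite /b.
- by move=> j; exact: measurable_ray.
- by case=> [p|]; rewrite /C; [apply: measurableI; exact: measurable_ray|exact: measurable_halfspace].
move=> z z0; rewrite big_cons big_map/= mul1r.
rewrite -(pair_bigA _ (fun i j => (i != j)%:R * \1_(ray i t `&` ray j t) z))/=.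
case: (pselect (exists j, ray j t z)) => [[j0 rj0]|no]; last first.
  rewrite [leLHS]big1 => [|j _]; last first.
    by rewrite indicE memNset ?mulr0// => rj; apply: no; exists j.
  by rewrite addr_ge0// sumr_ge0// => i _; rewrite sumr_ge0// => j _; rewrite mulr_ge0.
rewrite (bigD1 j0)//= mul1r indicE mem_set// lerD//.
  rewrite indicE mem_set//; rewrite /halfspace/=; apply: (lt_le_trans rj0).
  rewrite (bigD1 j0)//= lerDl sumr_ge0// => i _; rewrite mulr_ge0 ?(ltW (r0 i))//; exact: z0.
rewrite [leRHS](bigD1 j0)//= ler_wpDr//.
  by rewrite sumr_ge0// => i _; rewrite sumr_ge0// => j _; rewrite mulr_ge0.
rewrite [leRHS](bigD1 j0)//= eqxx mul0r add0r; apply: ler_sum => j jj0.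
rewrite mul1r eq_sym jj0 mul1r !indicE in_setI [z \in ray j0 t]mem_set//.
Qed.

(** [beta] is the relative bias up to a constant: one t^(-gam) per dyadic level and the remainder
    2^-K. [A1] collects the wedges, [A2] the loss in the lower bound for the halfspace, [A3] the
    spread. [c0] converts errors relative to t^(-alpha) into errors relative to the halfspace
    mass. *)
Let beta (K : nat) t : R := K.+1%:R * t `^ (- gam) + 2^-1 ^+ K.
Let W := u * m%:R.
Let A1 := m%:R * (Cs * (2 * W + 1)).
Let A2 := alpha * u * (m%:R * u `^ alpha) + m%:R ^+ 2 * (u `^ alpha) ^+ 2.
Let A3 := m%:R ^+ 2 * (u `^ alpha * m%:R `^ alpha * (2 * W + 1)).
Let c0 := (l / 2) `^ alpha.
Let weight j := r j `^ alpha / \sum_i r i `^ alpha.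

Let u0 : 0 < u. Proof. exact: lt_trans u1. Qed.
Let mp : 0 < m%:R :> R. Proof. by rewrite ltr0n. Qed.
Let W0 : 0 < W. Proof. by rewrite mulr_gt0. Qed.
Let W21 : 0 <= 2 * W + 1. Proof. by have := W0; lra. Qed.
Let Cs0 : 0 <= Cs. Proof. by rewrite !mulr_ge0 ?powR_ge0// ltW. Qed.

Let dyadic_total t K : 1 <= t ->
  K%:R * (2 * W * t `^ (- gam)) + 2^-1 ^+ K <= (2 * W + 1) * beta K t.
Proof.
move=> t1; rewrite /beta; have h1 : 0 <= t `^ (- gam) by exact: powR_ge0.
have h2 : 0 <= 2^-1 ^+ K :> R by rewrite exprn_ge0// invr_ge0.
rewrite -natr1; set x := t `^ _ in h1 *; set y := 2^-1 ^+ K in h2 *.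
have k0 : 0 <= K%:R :> R by [].
have := mulr_ge0 (ltW W0) h1; have := mulr_ge0 (ltW W0) h2; have := mulr_ge0 k0 h1.
lra.
Qed.

Lemma mass_halfspace_lb t : (0 < m)%N -> 1 <= t -> c0 * t `^ (- alpha) <= H (halfspace t).
Proof.
move=> mpos t1; have t0 : 0 < t by exact: lt_le_trans t1.
pose j := Ordinal mpos; have /andP[lr _] := rlu j.
apply: (@le_trans _ _ (H (ray j t))); last first.
  apply: mass_mono; [exact: measurable_ray|exact: measurable_halfspace|].
  move=> z [rz z0]; rewrite /halfspace/=; apply: (lt_le_trans rz).
  rewrite (bigD1 j)//= lerDl sumr_ge0// => i _; rewrite mulr_ge0 ?(ltW (r0 i))//; exact: z0.
rewrite mass_ray ?(ltW t0)// /c0 -powRN_div ?divr_ge0 ?(ltW t0) ?(ltW l0)//.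
have x0 : 0 < t / r j by rewrite divr_gt0.
apply: powRN_le; [exact: ltW|by rewrite addr_gt0|].
rewrite invf_div mulrA; apply: (@le_trans _ _ (1 + t / l)).
  by rewrite lerD2l ler_pM2l// lef_pV2 ?posrE.
have : 1 <= t / l by rewrite ler_pdivlMr// mul1r (le_trans (ltW l1)).
by rewrite mulrAC; lra.
Qed.

(** Two relative errors occur: 1/t from the shift in 1 + z, and t^(-alpha) from points counted
    twice. Both are at most t^(- min 1 alpha). *)
Lemma mass_halfspace_total t : 1 <= t ->
  t `^ (- alpha) * (\sum_j r j `^ alpha - A2 * t `^ (- gam)) <= H (halfspace t).
Proof.
move=> t1; have t0 : 0 < t by exact: lt_le_trans t1.
have g1 : gam <= 1 by rewrite ge_min lexx.
have ga : gam <= alpha by rewrite ge_min lexx orbT.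
set X := t `^ (- alpha); set G := t `^ (- gam).
have X0 : 0 <= X by exact: powR_ge0.
have XG : X <= G by apply: ler_powR => //; rewrite lerN2.
have tG : t^-1 <= G.
  by rewrite -(powR_inv1 (ltW t0)); apply: ler_powR => //; rewrite lerN2.
set U := u `^ alpha.
have U0 : 0 <= U by exact: powR_ge0.
have rU j : r j `^ alpha <= U.
  have /andP[_ ru] := rlu j.
  by apply: ge0_ler_powR; rewrite ?nnegrE ?(ltW alpha0) ?(ltW u0) ?(ltW (r0 j)).
have h1 : X * (\sum_j r j `^ alpha) - alpha * u * G * X * (m%:R * U) <= \sum_j tl j t.
  have -> : m%:R * U = \sum_(j < m) U by rewrite sumr_const card_ord mulr_natl.
  rewrite !mulr_sumr -sumrB; apply: ler_sum => j _; apply: le_trans (tail_ge j t1).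
  rewrite mulrBr mulr1 -/X [r j `^ alpha * X]mulrC lerD2l lerN2.
  rewrite [leLHS](_ : _ = X * r j `^ alpha * (alpha * u * t^-1)); last by rewrite /=; ring.
  rewrite [leRHS](_ : _ = X * U * (alpha * u * G)); last by ring.
  have au : 0 <= alpha * u by rewrite mulr_ge0 ?ltW.
  apply: ler_pM; rewrite ?mulr_ge0 ?invr_ge0 ?powR_ge0 ?(ltW alpha0) ?(ltW u0) ?(ltW t0)//.
    by rewrite ler_wpM2l.
  by rewrite ler_wpM2l.
have h2 : \sum_i \sum_j (i != j)%:R * (tl i t * tl j t) <= m%:R ^+ 2 * U ^+ 2 * G * X.
  apply: (@le_trans _ _ (\sum_(i < m) \sum_(j < m) U ^+ 2 * (G * X))).
    apply: ler_sum => i _; apply: ler_sum => j _.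
    apply: (@le_trans _ _ (tl i t * tl j t)).
      by case: (i != j); rewrite ?mul1r// mul0r mulr_ge0 ?tail_ge0.
    rewrite [leRHS](_ : _ = (U * G) * (U * X)); last by ring.
    apply: ler_pM; rewrite ?tail_ge0//; last exact: tail_le_unif.
    by apply: le_trans (tail_le_unif i t0) _; rewrite ler_wpM2l.
  rewrite !sumr_const !card_ord -mulrnA -[leLHS]mulr_natr natrM.
  by rewrite le_eqVlt; apply/orP; left; apply/eqP; ring.
have := mass_halfspace_ge (ltW t0).
rewrite /A2 -/U; move: h1 h2.
move: (\sum_j r j `^ alpha) (\sum_j tl j t) (\sum_i \sum_j _) (H _) => a b c e.
lra.
Qed.

Let sum_neq_le (j : 'I_m) (c : R) (f : 'I_m -> R) : 0 <= c ->
  (forall i, i != j -> f i <= c) -> \sum_(i | i != j) f i <= m%:R * c.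
Proof.
move=> c_ge0 fc; apply: (@le_trans _ _ (\sum_(i < m) c)).
  rewrite [leRHS](bigD1 j)//= ler_wpDl//; exact: ler_sum.
by rewrite sumr_const card_ord mulr_natl.
Qed.

(** [ray j t] gives the leading term. In a wedge, level k pairs a slab of mass O(2^-k t^(-alpha))
    with the tail of an independent coordinate; [tail_dyadic] bounds 2^-k times that tail by
    O(t^(-gam)), uniformly in k. *)
Lemma mass_sector_le j t K : 1 <= t ->
  H (halfspace t `&` ray j (t / m%:R)) <=
  t `^ (- alpha) * (r j `^ alpha + A1 * beta K t).
Proof.
move=> t1; have t0 : 0 < t by exact: lt_le_trans t1.
apply: le_trans (mass_sector_wedge j (ltW t0)) _.
rewrite mass_ray ?(ltW t0)// mulrDr lerD//.
  by rewrite mulrC tail_le.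
set X := t `^ (- alpha); have X0 : 0 <= X by exact: powR_ge0.
have b0 : 0 <= beta K t.
  by rewrite addr_ge0 ?mulr_ge0 ?powR_ge0 ?exprn_ge0 ?invr_ge0.
rewrite /A1 mulrCA -[leRHS]mulrA; apply: sum_neq_le.
  by repeat apply: mulr_ge0 => //.
move=> i ij; apply: le_trans (mass_wedge_le K ij t1) _.
apply: (@le_trans _ _ (Cs * X * (K%:R * (2 * W * t `^ (- gam)) + 2^-1 ^+ K))); last first.
  rewrite [leRHS](_ : _ = Cs * X * ((2 * W + 1) * beta K t)); last by ring.
  by apply: ler_wpM2l; [exact: mulr_ge0|exact: dyadic_total].
rewrite [leRHS]mulrDr; apply: lerD; last first.
  by apply: le_trans (slab_tail_le j K t1) _; rewrite mulrAC.
rewrite (_ : Cs * X * (K%:R * _) = \sum_(k < K) Cs * X * (2 * W * t `^ (- gam))); last first.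
  by rewrite sumr_const card_ord -[RHS]mulr_natr; ring.
apply: ler_sum => k _.
apply: (@le_trans _ _ (Cs * 2^-1 ^+ k * X * tl i (2^-1 ^+ k.+1 * t / m%:R))).
  by rewrite ler_wpM2r ?tail_ge0// slab_tail_le.
rewrite [leLHS](_ : _ = Cs * X * (2^-1 ^+ k * tl i (2^-1 ^+ k.+1 * t / m%:R))); last by ring.
by apply: ler_wpM2l; [exact: mulr_ge0|exact: tail_dyadic].
Qed.

Lemma pareto_population t K : 1 <= t ->
  [/\ 0 <= (A1 + A2 + A3) / c0,
    c0 * t `^ (- alpha) <= H (halfspace t),
    forall j, H (halfspace t `&` ray j (t / m%:R)) <=
      (weight j + (A1 + A2 + A3) / c0 * beta K t) * H (halfspace t) &
    \sum_j \sum_(i | i != j)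
      (\sum_(k < K) 2^-1 ^+ k * H (halfspace t `&` ray j (t / m%:R) `&`
                                 ray i (2^-1 ^+ k.+1 * t / m%:R)) +
       2^-1 ^+ K * H (halfspace t `&` ray j (t / m%:R))) <=
      (A1 + A2 + A3) / c0 * beta K t * H (halfspace t)].
Proof.
move=> t1; have t0 : 0 < t by exact: lt_le_trans t1.
have c00 : 0 < c0 by rewrite powR_gt0// divr_gt0.
set X := t `^ (- alpha); have X0 : 0 <= X by exact: powR_ge0.
have HE := mass_halfspace_lb m0 t1; rewrite -/X in HE.
have b0 : 0 <= beta K t.
  by rewrite addr_ge0 ?mulr_ge0 ?powR_ge0 ?exprn_ge0 ?invr_ge0.
have U0 : 0 <= u `^ alpha by exact: powR_ge0.
have M0 : 0 <= m%:R `^ alpha :> R by exact: powR_ge0.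
have A10 : 0 <= A1 by repeat apply: mulr_ge0 => //.
have A20 : 0 <= A2.
  have := ltW alpha0; have := ltW u0 => ? ?.
  by apply: addr_ge0; rewrite ?expr2; repeat apply: mulr_ge0 => //.
have A30 : 0 <= A3 by rewrite /A3 expr2; repeat apply: mulr_ge0 => //.
have scale y : 0 <= y -> y * X * beta K t <= y / c0 * beta K t * H (halfspace t).
  move=> y0; rewrite [leLHS](_ : _ = y / c0 * beta K t * (c0 * X)); last first.
    by field; rewrite gt_eqF.
  by rewrite ler_wpM2l ?mulr_ge0 ?invr_ge0 ?(ltW c00).
split => //.
- by rewrite divr_ge0 ?(ltW c00)// addr_ge0// addr_ge0.
- move=> j; rewrite mulrDl.
  apply: le_trans (mass_sector_le j K t1) _; rewrite -/X.
  (* The lower bound for the whole halfspace, multiplied by the weight, has leading term t^(-alpha)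
     r_j^alpha, the same as in the upper bound for the sector. Only error terms survive the
     comparison. *)
  have wH : X * (r j `^ alpha - A2 * beta K t) <= weight j * H (halfspace t).
    have S0 : 0 < \sum_i r i `^ alpha.
      by rewrite (bigD1 j)//= ltr_pwDl ?powR_gt0// sumr_ge0// => i _; exact: powR_ge0.
    have w0 : 0 <= weight j by rewrite divr_ge0 ?powR_ge0 ?ltW.
    have w1 : weight j <= 1.
      rewrite ler_pdivrMr// mul1r (bigD1 j)//= lerDl sumr_ge0// => i _; exact: powR_ge0.
    have := ler_wpM2l w0 (mass_halfspace_total t1); apply: le_trans.
    rewrite mulrCA -/X ler_wpM2l// mulrBr /weight divfK ?gt_eqF// lerD2l lerN2.
    rewrite -/(weight j) (le_trans (ler_piMl _ w1)) ?mulr_ge0 ?powR_ge0//.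
    rewrite ler_wpM2l// /beta (le_trans (_ : _ <= K.+1%:R * t `^ (- gam)))//.
      by rewrite ler_peMl ?powR_ge0// ler1n.
    by rewrite lerDl exprn_ge0// invr_ge0.
  have S0 : 0 <= A1 + A2 + A3 by rewrite addr_ge0// addr_ge0.
  have h := scale _ S0; have := mulr_ge0 (mulr_ge0 A30 X0) b0.
  move: wH h; move: (_ / c0 * _ * _) (weight j * _) => q p.
  lra.
have Ht j : tl j (t / m%:R) <= u `^ alpha * m%:R `^ alpha * X.
  have tm0 : 0 < t / m%:R by rewrite divr_gt0.
  apply: le_trans (tail_le_unif j tm0) _.
  by rewrite powRN_div ?(ltW t0) ?(ltW mp)// mulrA.
apply: (@le_trans _ _ (A3 * X * beta K t)); last first.
  apply: le_trans (scale A3 A30) _.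
  rewrite ler_wpM2r ?mass_ge0// ler_wpM2r// ler_pM2r ?invr_gt0//.
  by rewrite lerDr; apply: addr_ge0.
set V := u `^ alpha * m%:R `^ alpha in Ht.
have V0 : 0 <= V by rewrite mulr_ge0.
have -> : A3 * X * beta K t = \sum_(j < m) m%:R * (V * X * ((2 * W + 1) * beta K t)).
  by rewrite sumr_const card_ord -[RHS]mulr_natl /A3 /V; ring.
apply: ler_sum => j _; apply: sum_neq_le.
  by repeat apply: mulr_ge0 => //.
move=> i ij.
apply: (@le_trans _ _ (V * X * (K%:R * (2 * W * t `^ (- gam)) + 2^-1 ^+ K))); last first.
  by apply: ler_wpM2l; [exact: mulr_ge0|exact: dyadic_total].
have tm0 : 0 <= t / m%:R by rewrite divr_ge0// ltW.
have hk k : 0 <= 2^-1 ^+ k :> R by rewrite exprn_ge0// invr_ge0.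
rewrite mulrDr lerD//; last first.
  rewrite mulrC ler_wpM2r//; apply: le_trans (Ht j); rewrite -mass_ray//.
  apply: mass_mono; [apply: measurableI; [exact: measurable_halfspace|exact: measurable_ray]|exact: measurable_ray|].
  by move=> z [[_ ?] _].
rewrite (_ : V * X * (K%:R * _) = \sum_(k < K) V * X * (2 * W * t `^ (- gam))); last first.
  by rewrite sumr_const card_ord -[RHS]mulr_natr; ring.
apply: ler_sum => k _.
apply: (@le_trans _ _ (2^-1 ^+ k * (tl j (t / m%:R) * tl i (2^-1 ^+ k.+1 * t / m%:R)))).
  rewrite ler_wpM2l// -mass_rayI 1?eq_sym//; last by rewrite !mulr_ge0 ?invr_ge0 ?(ltW t0).
  apply: mass_mono.
  - apply: measurableI; last exact: measurable_ray.
    by apply: measurableI; [exact: measurable_halfspace|exact: measurable_ray].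
  - by apply: measurableI; exact: measurable_ray.
  - by move=> z [[[_ ?] ?] _]; split.
rewrite mulrCA; apply: ler_pM; rewrite ?tail_ge0 ?mulr_ge0 ?tail_ge0//.
exact: tail_dyadic.
Qed.

End pareto_population.

Lemma pareto_population_unif (R : realType) (alpha l u : R) (m : nat) :
  0 < alpha -> 0 < l -> l < 1 -> 1 < u -> (0 < m)%N ->
  exists C c : R, [/\ 0 <= C, 0 < c &
  forall (r : 'I_m -> R) (t : R) (K : nat), (forall j, l <= r j <= u) -> 1 <= t ->
  let H B := fine (pareto_mass alpha B) in
  let b := C * (K.+1%:R * t `^ (- Num.min 1 alpha) + 2^-1 ^+ K) in
  [/\ c * t `^ (- alpha) <= H (halfspace r t),
    forall j, H (halfspace r t `&` ray r j (t / m%:R)) <=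
      (r j `^ alpha / \sum_i r i `^ alpha + b) * H (halfspace r t) &
    \sum_j \sum_(i | i != j)
      (\sum_(k < K) 2^-1 ^+ k * H (halfspace r t `&` ray r j (t / m%:R) `&`
                                 ray r i (2^-1 ^+ k.+1 * t / m%:R)) +
       2^-1 ^+ K * H (halfspace r t `&` ray r j (t / m%:R))) <=
      b * H (halfspace r t)]].
Proof.
move=> alpha0 l0 l1 u1 m0.
have pop := @pareto_population R alpha m alpha0 l u _ l0 l1 u1 m0.
do 2 eexists; split; last first.
- move=> r t K rlu t1 /=; have [_ h1 h2 h3] := pop r rlu t K t1.
  by split; [exact: h1|exact: h2|exact: h3].
- by rewrite powR_gt0// divr_gt0.
(* The constant does not involve [r], so its sign can be read off at [r = 1], which is admissible
   since l < 1 < u. *)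
- have r1 (j : 'I_m) : l <= (fun _ : 'I_m => 1 : R) j <= u by rewrite !ltW.
  by have [h _ _ _] := pop _ r1 1 0%N (lexx 1).
Qed.

(** * Simultaneous Chernoff bounds *)

Section chernoff_union.
Context d (T : measurableType d) (R : realType).

Lemma measure_bigsetU_le (nu : {measure set T -> \bar R}) (I : Type) (s : seq I)
    (B : I -> set T) : (forall i, measurable (B i)) ->
  (nu (\big[setU/set0]_(i <- s) B i) <= \sum_(i <- s) nu (B i))%E.
Proof.
move=> mB; elim: s => [|i s ih]; first by rewrite !big_nil measure0.
rewrite !big_cons; apply: le_trans (measureU2 _ (mB i) _) _.
  exact: bigsetU_measurable.
by rewrite leeD2l.
Qed.

End chernoff_union.

Section chernoff_family.
Context d (T : measurableType d) (R : realType).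
Variables (mu : probability T R) (I : finType) (E O : set T).
Variables (f : I -> T -> R) (b : I -> R) (M P L : R) (n : nat).

(** [O] is a set of full measure, later the orthant; including it lets the deterministic part of the
    argument use nonnegative coordinates for every sample in the event. *)
Definition deviation_event : set (n.-tuple T) :=
  [set t | (forall i, O (tnth t i)) /\ forall i,
    \sum_(k < n) f i (tnth t k) <= n%:R * P * b i + 4 * M * Num.sqrt (n%:R * P * L)].

Let bad i : set (n.-tuple T) :=
  [set t | n%:R * P * b i + 4 * M * Num.sqrt (n%:R * P * L) < \sum_(k < n) f i (tnth t k)].

Hypotheses (mE : measurable E) (mO : measurable O).
Hypothesis mf : forall i, measurable_fun setT (f i).

Let measurable_bad i : measurable (bad i).
Proof.
have : measurable_fun [set: n.-tuple T] (fun t => \sum_(k < n) f i (tnth t k)).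
  apply: measurable_sum => k; apply: measurableT_comp => //.
  exact: measurable_tnth.
move=> /(_ measurableT _ (measurable_itv `]n%:R * P * b i + 4 * M * Num.sqrt (n%:R * P * L), +oo[)).
by rewrite setTI; congr measurable; apply/seteqP; split => t; rewrite /= in_itv/= andbT.
Qed.

Let measurable_all : measurable [set t : n.-tuple T | forall i, O (tnth t i)].
Proof.
rewrite (_ : [set t | _] = \bigcap_(i in [set: 'I_n]) ((@tnth _ _)^~ i @^-1` O)).
  apply: fin_bigcap_measurable => // i _.
  by rewrite -[X in measurable X]setTI; exact: measurable_tnth.
by apply/seteqP; split => t /= => [h i _|h i]; exact: h.
Qed.

Let deviation_eventE : deviation_event =
  [set t | forall i, O (tnth t i)] `\` \big[setU/set0]_(i <- index_enum I) bad i.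
Proof.
apply/seteqP; split => t /=.
  move=> [tO tf]; split => //; rewrite -bigcup_seq => -[i _] /=.
  by rewrite /bad/= ltNge tf.
move=> [tO nb]; split => // i; rewrite leNgt; apply/negP => bi; apply: nb.
by rewrite -bigcup_seq; exists i => //=; exact: mem_index_enum.
Qed.

Lemma measurable_deviation_event : measurable deviation_event.
Proof.
rewrite deviation_eventE; apply: measurableD => //; exact: bigsetU_measurable.
Qed.

Lemma chernoff_family : mu E = P%:E -> mu O = 1%E -> 0 < M -> 0 < P ->
  0 <= L -> L <= n%:R * P ->
  (forall i x, `|f i x| <= M * \1_E x) ->
  (forall i, (\int[mu]_x (f i x)%:E <= (b i * P)%:E)%E) ->
  ((1 - #|I|%:R * expR (- L))%:E <= power_measure mu n deviation_event)%E.
Proof.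
move=> muE muO M0 P0 L0 LnP fM fb.
have bad_le i : (power_measure mu n (bad i) <= (expR (- L))%:E)%E.
  exact: (chernoff mE (mf i) (ltW M0) (fM i) muE).
have sum_le : (power_measure mu n (\big[setU/set0]_(i <- index_enum I) bad i) <=
    (#|I|%:R * expR (- L))%:E)%E.
  apply: le_trans (measure_bigsetU_le _ _ measurable_bad) _.
  apply: (@le_trans _ _ (\sum_(i : I) (expR (- L))%:E)%E); first by apply: lee_sum => i _; exact: bad_le.
  by rewrite sumEFin lee_fin sumr_const mulr_natl.
have := power_measure_forall n mO muO; set S := [set t | _] => S1.
have mU : measurable (\big[setU/set0]_(i <- index_enum I) bad i).
  exact: bigsetU_measurable.
have : (power_measure mu n S <= power_measure mu n deviation_event +
    power_measure mu n (\big[setU/set0]_(i <- index_enum I) bad i))%E.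
  apply: le_trans (measureU2 _ _ _) => //; last exact: measurable_deviation_event.
  rewrite deviation_eventE; apply: power_measure_mono => t St.
  by case: (pselect ((\big[setU/set0]_(i <- index_enum I) bad i) t)) => h; [right|left].
rewrite S1 EFinB => h; rewrite leeBlDr//; apply: le_trans h _; exact: leeD2l.
Qed.

End chernoff_family.

(** * Perturbations of the Pareto law *)

Section near_pareto_theory.
Variables (R : realType) (m : nat) (alpha s xi zeta : R) (k : nat).
Variable Q : probability (m.-tuple R) R.
Hypotheses (alpha0 : 0 < alpha) (s0 : 0 < s) (xi0 : 0 < xi) (xi1 : xi < 1).
Hypotheses (k1 : (1 <= k)%N) (zeta0 : 0 < zeta) (s2 : s < 2^-1).
Hypothesis Qk : near_pareto alpha s xi zeta k Q.
Local Notation H B := (fine (pareto_mass alpha B)).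
Local Notation q B := (fine (Q B)).

Lemma probability_fin (B : set (m.-tuple R)) : measurable B -> Q B = (q B)%:E.
Proof. by move=> mB; rewrite fineK// fin_num_measure. Qed.

Lemma near_pareto_orthant : Q (@orthant R m) = 1%E.
Proof.
have [g [[_ _ Qg] _ _]] := Qk; rewrite -(probability_setT Q) !Qg//.
  by rewrite setIid setTI.
exact: measurable_orthant.
Qed.

Section comparison.
Variables (c1 c2 : R) (E : set (m.-tuple R)) (g : m.-tuple R -> R).
Hypotheses (c10 : 0 <= c1) (c20 : 0 <= c2) (Qg : has_density Q g).

Lemma density_le (B : set (m.-tuple R)) : measurable B ->
  (forall z, orthant z -> B z -> g z <= c2 * pareto_density alpha z) ->
  q B <= c2 * H B.
Proof.
move=> mB h; have [mg g0 Qgd] := Qg.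
rewrite -lee_fin -probability_fin// EFinM -pareto_mass_fin// Qgd// /pareto_mass.
have mBO : measurable (B `&` @orthant R m) by apply: measurableI => //; exact: measurable_orthant.
have mp : measurable_fun (B `&` @orthant R m) (fun z => (pareto_density alpha z)%:E).
  by apply/measurable_EFinP; apply: measurable_funTS; exact: measurable_pareto_density.
rewrite -ge0_integralZl//; last by move=> z _; rewrite lee_fin pareto_density_ge0.
apply: ge0_le_integral => //.
- by move=> z [_ z0]; rewrite lee_fin g0.
- apply/measurable_EFinP; apply: measurable_funS mg => //; exact: measurable_orthant.
- by apply: emeasurable_funM.
- by move=> z [Bz z0]; rewrite -EFinM lee_fin h.
Qed.

Lemma density_ge (B : set (m.-tuple R)) : measurable B ->
  (forall z, orthant z -> B z -> c1 * pareto_density alpha z <= g z) ->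
  c1 * H B <= q B.
Proof.
move=> mB h; have [mg g0 Qgd] := Qg.
rewrite -lee_fin -probability_fin// EFinM -pareto_mass_fin// Qgd// /pareto_mass.
have mBO : measurable (B `&` @orthant R m) by apply: measurableI => //; exact: measurable_orthant.
have mp : measurable_fun (B `&` @orthant R m) (fun z => (pareto_density alpha z)%:E).
  by apply/measurable_EFinP; apply: measurable_funTS; exact: measurable_pareto_density.
rewrite -ge0_integralZl//; last by move=> z _; rewrite lee_fin pareto_density_ge0.
apply: ge0_le_integral => //.
- by move=> z [_ z0]; rewrite -EFinM lee_fin mulr_ge0// pareto_density_ge0.
- by apply: emeasurable_funM.
- apply/measurable_EFinP; apply: measurable_funS mg => //; exact: measurable_orthant.
- by move=> z [Bz z0]; rewrite -EFinM lee_fin h.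
Qed.

End comparison.

Variables (l u : R) (r : 'I_m -> R) (n : nat) (t : R).
Hypotheses (u1 : 1 < u) (n1 : (1 <= n)%N).
Hypothesis rlu : forall j, l <= r j <= u.
Hypothesis tn : u * zeta * n%:R `^ ((1 - 2 * s) / alpha) <= t.

Let eta := xi * n%:R `^ (- s).

Let powkn (e : R) : (k <= n)%N -> 0 <= e -> k%:R `^ e <= n%:R `^ e.
Proof. by move=> kn e0; apply: ge0_ler_powR; rewrite ?nnegrE ?ler_nat. Qed.

(* For [k <= n] the density is exactly proportional to the Pareto density on
   the halfspace; for [k > n] it is within a relative error [xi * n^-s]. *)
Lemma near_pareto_compare : exists g c, [/\ has_density Q g, 0 < c,
  forall z, orthant z -> (1 - xi) * pareto_density alpha z <= g z &
  forall z, orthant z -> halfspace r t z ->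
    c * (1 - eta) * pareto_density alpha z <= g z <= c * (1 + eta) * pareto_density alpha z].
Proof.
have [g [dg ga [c c0 gc]]] := Qk; have eta0 : 0 <= eta by rewrite mulr_ge0 ?powR_ge0// ltW.
have kp : 0 < k%:R :> R by rewrite ltr0n.
have gk z : orthant z ->
    (1 - xi * k%:R `^ (- s)) * pareto_density alpha z <= g z
    <= (1 + xi * k%:R `^ (- s)) * pareto_density alpha z.
  move=> z0; have h0 := pareto_density_gt0 alpha0 z0.
  have := ga z z0; rewrite ler_norml ler_pdivrMr// ler_pdivlMr//.
  by move=> /andP[h1 h2]; apply/andP; split; lra.
have kx : k%:R `^ (- s) <= 1 by exact: natr_powRN_le1 (ltW s0).
have g1 z : orthant z -> (1 - xi) * pareto_density alpha z <= g z.
  move=> z0; have /andP[h _] := gk z z0; apply: le_trans h.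
  rewrite ler_wpM2r ?pareto_density_ge0// lerD2l lerN2.
  by rewrite -[leRHS]mulr1 ler_wpM2l// ltW.
have [kn|nk] := leqP k n.
  (* The product in condition (b) lacks the factor alpha^m of the Pareto density. *)
  exists g, (c / alpha ^+ m); split => //; first by rewrite divr_gt0// exprn_gt0.
  move=> z z0 zt; have -> : g z = c / alpha ^+ m * pareto_density alpha z.
    rewrite gc//.
      by rewrite /pareto_density mulrA divfK// expf_neq0// gt_eqF.
    have rz : \sum_j r j * tnth z j <= u * norm1 z.
      rewrite mulr_sumr; apply: ler_sum => j _; have /andP[_ rj] := rlu j.
      by rewrite (ger0_norm (z0 j)) ler_wpM2r//; exact: z0.
    have u0 : 0 < u by exact: lt_trans u1.
    rewrite -(ltr_pM2l u0); apply: lt_le_trans rz; apply: le_lt_trans zt.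
    apply: le_trans tn; rewrite -mulrA ler_pM2l// ler_pM2l//.
    have s12 : 0 <= 1 - 2 * s by have := s2; lra.
    by apply: powkn => //; apply: divr_ge0 => //; exact: ltW.
  have p0 := pareto_density_ge0 alpha0 z.
  have c00 : 0 <= c / alpha ^+ m by rewrite divr_ge0 ?exprn_ge0// ltW.
  have h := mulr_ge0 (mulr_ge0 c00 eta0) p0.
  by apply/andP; split; lra.
exists g, 1; split => // z z0 _; rewrite !mul1r.
have etak : xi * k%:R `^ (- s) <= eta.
  rewrite ler_pM2l//; apply: powRN_le; rewrite ?(ltW s0) ?ltr0n// ler_nat ltnW//.
have /andP[h1 h2] := gk z z0; have p0 := pareto_density_ge0 alpha0 z.
by apply/andP; split; [apply: le_trans h1|apply: le_trans h2 _]; rewrite ler_wpM2r//; lra.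
Qed.

(** The same [c] multiplies the lower bound for the halfspace and the upper bound for its subsets,
    so it disappears from conditional probabilities. No lower bound on [c] is recorded; the
    comparison with [1 - xi] is what keeps the exceedance probability away from 0 at scale
    t^(-alpha). *)
Lemma near_pareto_ratio : exists c, [/\ 0 < c,
  (1 - xi) * H (halfspace r t) <= q (halfspace r t),
  c * (1 - eta) * H (halfspace r t) <= q (halfspace r t) &
  forall B, measurable B -> B `<=` halfspace r t -> q B <= c * (1 + eta) * H B].
Proof.
have [g [c [dg c0 h1 h2]]] := near_pareto_compare; exists c.
have mE := @measurable_halfspace R m r t.
have eta0 : 0 <= eta by rewrite mulr_ge0 ?powR_ge0// ltW.
have eta1 : eta <= 1.
  rewrite /eta -[leRHS]mulr1 ler_pM ?powR_ge0 ?(ltW xi0) ?(ltW xi1)//.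
  exact: natr_powRN_le1 (ltW s0).
split => //.
- have x1 : 0 <= 1 - xi by rewrite subr_ge0 ltW.
  by apply: (density_ge x1 dg mE) => z z0 _; exact: h1.
- apply: (density_ge _ dg mE) => [|z z0 Ez]; first by rewrite mulr_ge0 ?(ltW c0)//; lra.
  by have /andP[] := h2 z z0 Ez.
- move=> B mB BE; apply: (density_le _ dg mB) => [|z z0 Bz].
    by rewrite mulr_ge0 ?(ltW c0)//; lra.
  by have /andP[] := h2 z z0 (BE z Bz).
Qed.

End near_pareto_theory.

Lemma near_pareto_population (R : realType) (alpha l u s xi zeta : R) (m : nat) :
  0 < alpha -> 0 < l -> l < 1 -> 1 < u -> (0 < m)%N -> 0 < s -> s < 2^-1 ->
  0 < xi -> xi < 1 -> 0 < zeta ->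
  exists C c : R, [/\ 0 <= C, 0 < c &
  forall (k n K : nat) (Q : probability (m.-tuple R) R) (r : 'I_m -> R) (t : R),
  (1 <= k)%N -> (1 <= n)%N -> near_pareto alpha s xi zeta k Q ->
  (forall j, l <= r j <= u) -> 1 <= t -> u * zeta * n%:R `^ ((1 - 2 * s) / alpha) <= t ->
  let q B := fine (Q B) in
  let b := C * (n%:R `^ (- s) + K.+1%:R * t `^ (- Num.min 1 alpha) + 2^-1 ^+ K) in
  [/\ c * t `^ (- alpha) <= q (halfspace r t),
    forall j, q (halfspace r t `&` ray r j (t / m%:R)) <=
      (r j `^ alpha / \sum_i r i `^ alpha + b) * q (halfspace r t) &
    \sum_j \sum_(i | i != j)
      (\sum_(k < K) 2^-1 ^+ k * q (halfspace r t `&` ray r j (t / m%:R) `&`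
                                 ray r i (2^-1 ^+ k.+1 * t / m%:R)) +
       2^-1 ^+ K * q (halfspace r t `&` ray r j (t / m%:R))) <=
      b * q (halfspace r t)]].
Proof.
move=> alpha0 l0 l1 u1 m0 s0 s2 xi0 xi1 zeta0.
have [C [c [C0 c0 pop]]] := pareto_population_unif alpha0 l0 l1 u1 m0.
have x1 : 0 < 1 - xi by rewrite subr_gt0.
exists (2 / (1 - xi) * (1 + C)), ((1 - xi) * c); split.
- by rewrite mulr_ge0 ?divr_ge0 ?(ltW x1) ?addr_ge0.
- by rewrite mulr_gt0.
move=> k n K Q r t k1 n1 Qk rlu t1 tn /=.
have [h1 h2 h3] := pop r t K rlu t1.
have [a [a0 rE1 rE2 rB]] := near_pareto_ratio alpha0 s0 xi0 xi1 k1 zeta0 s2 Qk u1 n1 rlu tn.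
set eta := xi * _ in rE2 rB.
set E := halfspace r t in h1 h2 h3 rE1 rE2 rB *.
set hE := fine (pareto_mass alpha E) in h1 h2 h3 rE1 rE2.
set qE := fine (Q E) in rE1 rE2 *.
set N := n%:R `^ (- s).
have N0 : 0 <= N by exact: powR_ge0.
have N1 : N <= 1 by exact: natr_powRN_le1 (ltW s0).
have eta0 : 0 <= eta by rewrite mulr_ge0// ltW.
have etax : eta <= xi by rewrite -[leRHS]mulr1 ler_wpM2l// ltW.
have etaN : eta <= N by rewrite /eta ler_piMl// ltW.
pose be := K.+1%:R * t `^ (- Num.min 1 alpha) + 2^-1 ^+ K.
have be0 : 0 <= be by rewrite addr_ge0 ?mulr_ge0 ?powR_ge0 ?exprn_ge0 ?invr_ge0.
rewrite -/be in h1 h2 h3.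
have hE0 : 0 <= hE by exact: mass_ge0.
have qE0 : 0 <= qE by apply: le_trans rE1; exact: mulr_ge0 (ltW x1) hE0.
(* The conditional distortion is (1 + eta) / (1 - eta) = 1 + 2 eta / (1 - eta), and [eta <= xi]
   makes it linear in eta with slope 2 / (1 - xi). *)
have ratio y : 0 <= y -> a * (1 + eta) * (y * hE) <= y * (1 + 2 / (1 - xi) * eta) * qE.
  move=> y0; have e1 : 0 < 1 - eta by lra.
  apply: (@le_trans _ _ (y * ((1 + eta) / (1 - eta)) * qE)).
    rewrite [leLHS](_ : _ = y * ((1 + eta) / (1 - eta)) * (a * (1 - eta) * hE)).
      by apply: ler_wpM2l rE2; rewrite mulr_ge0// divr_ge0 ?(ltW e1)//; lra.
    by field; rewrite gt_eqF.
  apply: ler_wpM2r => //; apply: ler_wpM2l => //.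
  rewrite ler_pdivrMr//.
  have -> : (1 + 2 / (1 - xi) * eta) * (1 - eta) = 1 - eta + 2 * eta * ((1 - eta) / (1 - xi)).
    by field; rewrite gt_eqF.
  have : 1 <= (1 - eta) / (1 - xi) by rewrite ler_pdivlMr//; lra.
  by move=> h0; have := ler_wpM2l eta0 h0; rewrite mulr1; lra.
set b := _ * (_ + _ + _).
have bE : b = 2 / (1 - xi) * (1 + C) * (N + be) by rewrite /b /be addrA.
have x2 : 2 <= 2 / (1 - xi) by rewrite ler_pdivlMr//; lra.
have X2 : 1 + 2 / (1 - xi) * eta <= 2 / (1 - xi).
  rewrite -lerBrDr -[X in X - _]mulr1 -mulrBr mulrAC ler_pdivlMr//; lra.
have Cb0 : 0 <= C * be by exact: mulr_ge0.
have b1 : C * be * (1 + 2 / (1 - xi) * eta) + 2 / (1 - xi) * eta <= b.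
  apply: (@le_trans _ _ (2 / (1 - xi) * (C * be + N))).
    have y0 : 0 <= 2 / (1 - xi) by lra.
    have := ler_wpM2l Cb0 X2; have := ler_wpM2l y0 etaN; lra.
  rewrite bE -[leRHS]mulrA; apply: ler_wpM2l; first by lra.
  by have := mulr_ge0 C0 N0; lra.
have mE : measurable E by exact: measurable_halfspace.
have mEF j : measurable (E `&` ray r j (t / m%:R)).
  by apply: measurableI => //; exact: (measurable_ray l0 rlu).
have S0 : 0 < \sum_i r i `^ alpha.
  have rp i : 0 < r i `^ alpha.
    by have /andP[hr _] := rlu i; rewrite powR_gt0// (lt_le_trans l0).
  rewrite (bigD1 (Ordinal m0))//= ltr_pwDl// sumr_ge0// => i _; exact: ltW.
split.
- rewrite -mulrA; apply: le_trans rE1; apply: ler_wpM2l h1; exact: ltW.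
- move=> j; set w := r j `^ alpha / _.
  have w0 : 0 <= w by rewrite divr_ge0 ?powR_ge0 ?(ltW S0).
  have w1 : w <= 1.
    rewrite ler_pdivrMr// mul1r (bigD1 j)//= lerDl sumr_ge0// => i _; exact: powR_ge0.
  apply: le_trans (rB _ (mEF j) (@subIsetl _ _ _)) _.
  have ae0 : 0 <= a * (1 + eta) by rewrite mulr_ge0 ?(ltW a0)//; lra.
  apply: le_trans (ler_wpM2l ae0 (h2 j)) _; rewrite -/w.
  apply: le_trans (ratio _ _) _; first exact: addr_ge0.
  apply: ler_wpM2r => //.
  have x0 : 0 <= 2 / (1 - xi) by lra.
  have := ler_wpM2r (mulr_ge0 x0 eta0) w1; lra.
apply: (@le_trans _ _ (C * be * (1 + 2 / (1 - xi) * eta) * qE)); last first.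
  apply: ler_wpM2r => //; apply: le_trans b1; rewrite lerDl mulr_ge0//; lra.
apply: le_trans (ratio _ Cb0).
have ae0 : 0 <= a * (1 + eta) by rewrite mulr_ge0 ?(ltW a0)//; lra.
apply: le_trans (ler_wpM2l ae0 h3).
rewrite mulr_sumr; apply: ler_sum => j _; rewrite mulr_sumr; apply: ler_sum => i ij.
rewrite mulrDr lerD//.
  rewrite mulr_sumr; apply: ler_sum => k' _; rewrite mulrCA.
  apply: ler_wpM2l; first by rewrite exprn_ge0// invr_ge0.
  apply: rB; first by apply: measurableI => //; exact: (measurable_ray l0 rlu).
  by move=> z [[]].
rewrite mulrCA; apply: ler_wpM2l; first by rewrite exprn_ge0// invr_ge0.
by apply: rB => // z [].
Qed.

(** * Angles and sectors *)

Section angles.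
Variables (R : realType) (d m : nat) (A : 'M[R]_(d, m)).
Hypothesis A0 : forall i j, 0 <= A i j.
Local Notation r j := (norm1 (column A j)).

Lemma norm1_column j : r j = \sum_i A i j.
Proof. by apply: eq_bigr => i _; rewrite tnth_mktuple ger0_norm. Qed.

Lemma norm1_apply_mx (z : m.-tuple R) : orthant z ->
  norm1 (apply_mx A z) = \sum_j r j * tnth z j.
Proof.
move=> z0; rewrite /norm1.
under eq_bigr => i _.
  rewrite tnth_mktuple ger0_norm; last first.
    by apply: sumr_ge0 => j _; rewrite mulr_ge0//; exact: z0.
  over.
rewrite exchange_big; apply: eq_bigr => j _.
by rewrite -mulr_suml -norm1_column.
Qed.

Lemma measurable_apply_mx : measurable_fun [set: m.-tuple R] (apply_mx A).
Proof.
apply/measurable_fun_tnthP => i.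
rewrite (_ : _ \o _ = fun z : m.-tuple R => \sum_(j < m) A i j * tnth z j).
  by apply: measurable_sum => j; apply: measurable_funM => //; exact: measurable_tnth.
by apply/funext => z /=; rewrite tnth_mktuple.
Qed.

(** The angle of A z is the mixture of column angles with weights r_i z_i / S. The mass U / S off
    column j is replaced by mass at column j, and each of these two parts contributes U / S to the
    distance. *)
Lemma dist1_angle_apply (z : m.-tuple R) j : orthant z -> 0 < r j ->
  0 < \sum_i r i * tnth z i ->
  dist1 (angle (apply_mx A z)) (angle (column A j)) <=
  2 * ((\sum_(i | i != j) r i * tnth z i) / \sum_i r i * tnth z i).
Proof.
move=> z0 rj S0; set S := \sum_i r i * tnth z i in S0 *.
set U := \sum_(i | i != j) r i * tnth z i.
have SU : S = r j * tnth z j + U by rewrite /S (bigD1 j).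
have U0 : 0 <= U.
  apply: sumr_ge0 => i _; apply: mulr_ge0; last exact: z0.
  exact: norm1_ge0.
have E (k : 'I_d) : `|tnth (angle (apply_mx A z)) k - tnth (angle (column A j)) k| <=
    (\sum_(i | i != j) A k i * tnth z i) / S + A k j * (U / S / r j).
  rewrite !tnth_mktuple norm1_apply_mx// -/S (bigD1 j)//=.
  set V := \sum_(i | i != j) _.
  have V0 : 0 <= V by apply: sumr_ge0 => i _; rewrite mulr_ge0//; exact: z0.
  have -> : (A k j * tnth z j + V) / S - A k j / r j = V / S - A k j * (U / S / r j).
    have : tnth z j = (S - U) / r j by rewrite SU addrK [r j * _]mulrC mulfK// gt_eqF.
    move=> ->; field; rewrite !gt_eqF//.
  apply: le_trans (ler_normB _ _) _; rewrite !ger0_norm// ?divr_ge0// ?(ltW S0)//.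
  by rewrite mulr_ge0// !divr_ge0// ltW.
apply: (@le_trans _ _ (\sum_k ((\sum_(i | i != j) A k i * tnth z i) / S + A k j * (U / S / r j)))).
  by apply: ler_sum => k _; exact: E.
rewrite big_split/= -!mulr_suml exchange_big/= -norm1_column.
have -> : \sum_(i | i != j) \sum_k A k i * tnth z i = U.
  by apply: eq_bigr => i _; rewrite -mulr_suml -norm1_column.
rewrite le_eqVlt; apply/orP; left; apply/eqP; field.
by rewrite !gt_eqF.
Qed.

End angles.

Section sector_cover.
Variables (R : realType) (m : nat) (r : 'I_m -> R) (t : R) (K : nat).
Hypotheses (r0 : forall j, 0 < r j) (t0 : 0 < t) (m0 : (0 < m)%N).
Local Notation E := (halfspace r t).
Local Notation F j := (ray r j (t / m%:R)).

(** An explicit majorant, valid for any admissible label because all [j] are summed, of the share of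
    the norm not carried by the labelled coordinate. Its mean is the double sum bounded in
    [near_pareto_population]. *)
Definition spread (z : m.-tuple R) : R :=
  \sum_j \sum_(i | i != j)
    (\sum_(k < K) 2^-1 ^+ k * \1_(E `&` F j `&` ray r i (2^-1 ^+ k.+1 * t / m%:R)) z +
     2^-1 ^+ K * \1_(E `&` F j) z).

Let h0 k : 0 <= 2^-1 ^+ k :> R. Proof. by rewrite exprn_ge0// invr_ge0. Qed.

Let term_ge0 j i (z : m.-tuple R) :
  0 <= \sum_(k < K) 2^-1 ^+ k * \1_(E `&` F j `&` ray r i (2^-1 ^+ k.+1 * t / m%:R)) z +
     2^-1 ^+ K * \1_(E `&` F j) z :> R.
Proof.
by rewrite addr_ge0 ?mulr_ge0// sumr_ge0// => k _; rewrite mulr_ge0.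
Qed.

Lemma spread_ge0 z : 0 <= spread z.
Proof. by apply: sumr_ge0 => j _; apply: sumr_ge0 => i _; exact: term_ge0. Qed.

Let geom n : \sum_(k < n) 2^-1 ^+ k = 2 - 2 * 2^-1 ^+ n :> R.
Proof.
elim: n => [|n ih]; first by rewrite big_ord0 expr0; lra.
by rewrite big_ord_recr/= ih exprS; lra.
Qed.

Lemma spread_le z : spread z <= 3 * m%:R ^+ 2 * \1_E z.
Proof.
have [zE|zE] := boolP (z \in E); last first.
  rewrite /spread big1 => [|j _].
    by rewrite !mulr_ge0 ?exprn_ge0.
  have nE (B : set (m.-tuple R)) : \1_(E `&` B) z = 0 :> R.
    by rewrite indicE in_setI (negbTE zE).
  rewrite big1// => i _; rewrite nE mulr0 addr0 big1// => k _.
  by rewrite -setIA nE mulr0.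
rewrite indicE zE mulr1 /spread.
apply: (@le_trans _ _ (\sum_(j < m) \sum_(i < m) 3)).
  apply: ler_sum => j _; rewrite [leRHS](bigD1 j)//= ler_wpDl//.
  apply: ler_sum => i _; apply: (@le_trans _ _ (\sum_(k < K) 2^-1 ^+ k + 2^-1 ^+ K)).
    rewrite lerD//; last by rewrite -[leRHS]mulr1 ler_wpM2l.
    by apply: ler_sum => k _; rewrite -[leRHS]mulr1 ler_wpM2l.
  have := h0 K; rewrite geom; lra.
rewrite !sumr_const !card_ord -mulrnA -[leLHS]mulr_natr natrM.
by rewrite le_eqVlt; apply/orP; left; apply/eqP; ring.
Qed.

Lemma sector_cover z : orthant z -> E z -> exists j, F j z.
Proof.
move=> z0 Ez; apply: contrapT => /forallNP nF.
have mp : 0 < m%:R :> R by rewrite ltr0n.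
move: Ez; rewrite /halfspace/= ltNge => /negP; apply.
apply: (@le_trans _ _ (\sum_(j < m) t / m%:R)).
  apply: ler_sum => j _; have /negP := nF j; rewrite /ray/= -leNgt//.
by rewrite sumr_const card_ord -[leLHS]mulr_natr divfK// gt_eqF.
Qed.

(** Each share r_i z_i / S is at most min(r_i z_i / t, 1), since S exceeds t and contains r_i z_i;
    [dyadic_min] then applies. The extra 1/m in the ray thresholds only enlarges the events. *)
Lemma spread_ge z j : orthant z -> E z -> F j z ->
  (\sum_(i | i != j) r i * tnth z i) / (\sum_i r i * tnth z i) <= spread z.
Proof.
move=> z0 Ez Fz; have mp : 0 < m%:R :> R by rewrite ltr0n.
have m1 : 1 <= m%:R :> R by rewrite ler1n.
set S := \sum_i r i * tnth z i; have St : t < S by exact: Ez.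
have S0 : 0 < S by exact: lt_trans St.
rewrite /spread [leRHS](bigD1 j)//= ler_wpDr//.
  by apply: sumr_ge0 => j' _; apply: sumr_ge0 => i _; exact: term_ge0.
rewrite mulr_suml; apply: ler_sum => i ij.
have V0 i' : 0 <= r i' * tnth z i' by rewrite mulr_ge0 ?(ltW (r0 i'))//; exact: z0.
rewrite [in leRHS]indicE mem_set// mulr1.
apply: (@le_trans _ _ (Num.min (r i * tnth z i / t) 1)).
  rewrite le_min; apply/andP; split.
    by rewrite ler_wpM2l// lef_pV2 ?posrE// ltW.
  by rewrite ler_pdivrMr// mul1r /S (bigD1 i)//= lerDl sumr_ge0.
apply: le_trans (dyadic_min K t0 (V0 i)) _; rewrite lerD2r.
apply: ler_sum => k _; rewrite ler_wpM2l// indicE ler_nat.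
case: (ltP (2^-1 ^+ k.+1 * t) (r i * tnth z i)) => // h.
rewrite mem_set//; split => //; apply: le_lt_trans h.
by rewrite ler_pdivrMr// ler_peMr// mulr_ge0// ltW.
Qed.

End sector_cover.

(** * Finite samples *)

Section assignment_event.
Variables (R : realType) (d m n : nat) (A : 'M[R]_(d, m)) (alpha p t : R).

Definition excess (x : n.-tuple (d.-tuple R)) (i : 'I_n) : R :=
  (t < norm1 (tnth x i))%R%:R.

(* A finite union over assignments [sg] of observations to atoms of the spectral
   measure, hence measurable, whereas the event that the Wasserstein distance is
   small is not known to be. The second sum is the excess of the label
   frequencies over the spectral weights, which [repair_plan] has to move. *)
Definition cheap_assignment (rho : R) : set (n.-tuple (d.-tuple R)) :=
  [set x | 0 < \sum_i excess x i /\ exists sg : {ffun 'I_n -> 'I_m},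
    \sum_i excess x i * dist1 (angle (tnth x i)) (angle (column A (sg i))) +
    \sum_j Num.max 0 (\sum_i excess x i * (sg i == j)%:R -
                      spectral_weight alpha A j * \sum_i excess x i)
    <= rho * \sum_i excess x i].

Lemma measurable_norm1 k : measurable_fun [set: k.-tuple R] (@norm1 R k).
Proof.
apply: measurable_sum => i; apply: measurableT_comp => //; exact: measurable_tnth.
Qed.

Lemma measurable_angle k : measurable_fun [set: k.-tuple R] (@angle R k).
Proof.
apply/measurable_fun_tnthP => i.
(* The reciprocal is rewritten as a real power, whose measurability is available; the two agree on
   nonnegative numbers. *)
rewrite (_ : _ \o _ = fun v : k.-tuple R => tnth v i * norm1 v `^ (-1)).
  apply: measurable_funM; first exact: measurable_tnth.
  exact: (measurableT_comp (measurable_powR _) (@measurable_norm1 k)).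
by apply/funext => v /=; rewrite tnth_mktuple powR_inv1// norm1_ge0.
Qed.

Lemma measurable_excess i : measurable_fun [set: n.-tuple (d.-tuple R)] (excess ^~ i).
Proof.
have mS : measurable [set v : d.-tuple R | t < norm1 v].
  have := @measurable_norm1 d measurableT _ (measurable_itv `]t, +oo[).
  by rewrite setTI; congr measurable; apply/seteqP; split => v; rewrite /= in_itv/= andbT.
rewrite (_ : excess ^~ i = \1_[set v : d.-tuple R | t < norm1 v] \o (@tnth _ _ ^~ i)).
  by apply: measurableT_comp; [exact: measurable_indic|exact: measurable_tnth].
apply/funext => x /=; rewrite /excess indicE; congr ((_ : bool)%:R).
by apply/idP/idP; rewrite inE.
Qed.

Lemma measurable_cheap_assignment rho : measurable (cheap_assignment rho).
Proof.
pose N (x : n.-tuple (d.-tuple R)) := \sum_i excess x i.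
have mN : measurable_fun [set: n.-tuple (d.-tuple R)] N.
  by apply: measurable_sum => i; exact: measurable_excess.
pose G (sg : {ffun 'I_n -> 'I_m}) (x : n.-tuple (d.-tuple R)) :=
  \sum_i excess x i * dist1 (angle (tnth x i)) (angle (column A (sg i))) +
  \sum_j Num.max 0 (\sum_i excess x i * (sg i == j)%:R -
                    spectral_weight alpha A j * N x) - rho * N x.
have mG sg : measurable_fun [set: n.-tuple (d.-tuple R)] (G sg).
  apply: measurable_funB; last exact: measurable_funM.
  apply: measurable_funD.
    apply: measurable_sum => i; apply: measurable_funM; first exact: measurable_excess.
    apply: measurable_sum => k; apply: measurableT_comp => //.
    apply: measurable_funB => //.
    apply: (measurableT_comp (measurable_tnth k)).
    by apply: (measurableT_comp (@measurable_angle d)); exact: measurable_tnth.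
  apply: measurable_sum => j; apply: measurable_maxr => //.
  apply: measurable_funB; last exact: measurable_funM.
  apply: measurable_sum => i; apply: measurable_funM => //; exact: measurable_excess.
rewrite (_ : cheap_assignment rho = \bigcup_(sg in [set: {ffun 'I_n -> 'I_m}])
    (N @^-1` `]0, +oo[ `&` G sg @^-1` `]-oo, 0])); last first.
  apply/seteqP; split => x /=.
    move=> [N0 [sg h]]; exists sg => //; split; rewrite /= in_itv/= ?andbT//.
    by rewrite subr_le0.
  move=> [sg _ []]; rewrite /= !in_itv/= andbT => N0; rewrite subr_le0 => h.
  by split => //; exists sg.
apply: fin_bigcup_measurable => // sg _; apply: measurableI.
  by rewrite -[X in measurable X]setTI; exact: mN.
by rewrite -[X in measurable X]setTI; exact: mG.
Qed.

Lemma cheap_assignment_wasserstein rho x : 1 <= p ->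
  \sum_j spectral_weight alpha A j = 1 -> cheap_assignment rho x ->
  (wasserstein p (empirical_angular_measure t x) (spectral_measure alpha A) `^ p
   <= (2 `^ p * rho)%:E)%E.
Proof.
move=> p1 w1 [N0 [sg h]].
have NE : (n_exceed t x)%:R = \sum_i excess x i :> R.
  rewrite /n_exceed -sum1_card natr_sum big_mkcond/=; apply: eq_bigr => i _.
  by rewrite /excess inE; case: (t < _).
have Np : (0 < n_exceed t x)%N by rewrite -(ltr0n R) NE.
apply: le_trans (wasserstein_le (A := A) sg p1 w1 Np) _.
rewrite lee_fin ler_wpM2l ?powR_ge0// NE; set N := \sum_i excess x i in N0 h *.
rewrite -(ler_pM2r N0); apply: le_trans h; rewrite mulrDl lerD//.
  rewrite mulr_suml big_mkcond/=; apply: ler_sum => i _; rewrite /excess.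
  by case: ifP => _; rewrite ?mul0r// mul1r divfK// gt_eqF.
rewrite mulr_suml; apply: ler_sum => j _.
rewrite maxr_pMl ?(ltW N0)// mul0r.
rewrite mulrBl mulr_suml [X in Num.max _ (X - _)](_ : _ = \sum_i excess x i * (sg i == j)%:R)//.
rewrite big_mkcond/=; apply: eq_bigr => i _; rewrite /excess.
by case: (t < _) => /=; case: (sg i == j); rewrite ?mulr1 ?mulr0 ?mul0r// mulVf// gt_eqF.
Qed.

End assignment_event.

Section finite_sample.
Variables (R : realType) (d m n : nat) (A : 'M[R]_(d, m)) (alpha p t l u b L : R) (K : nat).
Variables (Q : probability (m.-tuple R) R) (X : probability (d.-tuple R) R).
Local Notation r := (fun j => norm1 (column A j)).
Local Notation E := (halfspace r t).
Local Notation F j := (ray r j (t / m%:R)).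
Local Notation w := (spectral_weight alpha A).
Local Notation M := (3 * m%:R ^+ 2 : R).
Local Notation P := (fine (Q E)).
Hypotheses (p1 : 1 <= p) (m0 : (0 < m)%N) (A0 : forall i j, 0 <= A i j).
Hypotheses (l0 : 0 < l) (rlu : forall j, l <= norm1 (column A j) <= u) (t0 : 0 < t).
Hypothesis law : forall B, measurable B -> X B = pushforward Q (apply_mx A) B.
Hypotheses (Q1 : Q (@orthant R m) = 1%E) (P0 : 0 < P) (b0 : 0 <= b) (L0 : 0 < L).
Hypothesis Qsector : forall j, fine (Q (E `&` F j)) <= (w j + b) * P.
Hypothesis Qspread : \sum_j \sum_(i | i != j)
  (\sum_(k < K) 2^-1 ^+ k * fine (Q (E `&` F j `&` ray r i (2^-1 ^+ k.+1 * t / m%:R))) +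
   2^-1 ^+ K * fine (Q (E `&` F j))) <= b * P.
Hypothesis Lsmall : 64 * M ^+ 2 * L <= n%:R * P.

Let r0 j : 0 < norm1 (column A j).
Proof. by have /andP[h _] := rlu j; exact: lt_le_trans h. Qed.

Let S0 : 0 < \sum_j norm1 (column A j) `^ alpha.
Proof.
rewrite (bigD1 (Ordinal m0))//= ltr_pwDl ?powR_gt0// sumr_ge0// => i _; exact: powR_ge0.
Qed.

Lemma sum_spectral_weight : \sum_j w j = 1.
Proof. by rewrite -mulr_suml mulfV// gt_eqF. Qed.

Let w1 j : w j <= 1.
Proof.
rewrite -sum_spectral_weight (bigD1 j)//= lerDl sumr_ge0// => i _.
exact: spectral_weight_ge0.
Qed.

Let mE : measurable E. Proof. exact: measurable_halfspace. Qed.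
Let mF j : measurable (F j). Proof. exact: (measurable_ray l0 rlu). Qed.
Let mEF j : measurable (E `&` F j). Proof. exact: measurableI. Qed.
Let mEFT j i k : measurable (E `&` F j `&` ray r i (2^-1 ^+ k.+1 * t / m%:R)).
Proof. apply: measurableI => //; exact: (measurable_ray l0 rlu). Qed.

Let Qfin B : measurable B -> Q B = (fine (Q B))%:E.
Proof. by move=> mB; rewrite fineK// fin_num_measure. Qed.

Let h0 k : 0 <= 2^-1 ^+ k :> R. Proof. by rewrite exprn_ge0// invr_ge0. Qed.

Let M1 : 1 <= M.
Proof.
have : 1 <= m%:R ^+ 2 :> R by rewrite exprn_ege1// ler1n.
by lra.
Qed.

(** The m + 2 sums to control: the transport cost, the negated exceedance count, so that an upper
    deviation bounds the count from below, and the surplus of each sector. A point labelled j lies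
    in sector j, so sector frequencies dominate label frequencies although sectors overlap. *)
Definition statistic (o : option (option 'I_m)) : m.-tuple R -> R :=
  match o with
  | None => spread r t K
  | Some None => fun z => - \1_E z
  | Some (Some j) => fun z => \1_(E `&` F j) z - w j * \1_E z
  end.

Definition statistic_mean (o : option (option 'I_m)) : R :=
  if o is Some None then -1 else b.

Let spread_term j i (z : m.-tuple R) : R :=
  \sum_(k < K) 2^-1 ^+ k * \1_(E `&` F j `&` ray r i (2^-1 ^+ k.+1 * t / m%:R)) z +
     2^-1 ^+ K * \1_(E `&` F j) z.

Let spreadE : spread r t K = fun z => \sum_(j <- index_enum 'I_m)
  \sum_(i <- [seq i <- index_enum 'I_m | i != j]) spread_term j i z.
Proof.
by apply/funext => z; apply: eq_bigr => j _; rewrite big_filter.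
Qed.

Let measurable_spread_term j i : measurable_fun setT (spread_term j i).
Proof.
apply: measurable_funD.
  apply: measurable_sum => k; apply: measurable_funM => //; exact: measurable_indic.
apply: measurable_funM => //; exact: measurable_indic.
Qed.

Let measurable_statistic o : measurable_fun setT (statistic o).
Proof.
case: o => [[j|]|] /=.
- apply: measurable_funB; first exact: measurable_indic.
  apply: measurable_funM => //; exact: measurable_indic.
- apply: measurableT_comp => //; exact: measurable_indic.
- rewrite spreadE; apply: measurable_sum => j; apply: measurable_sum => i.
  exact: measurable_spread_term.
Qed.

Let statistic_bound o x : `|statistic o x| <= M * \1_E x.
Proof.
have E0 : 0 <= \1_E x :> R by [].
have h : \1_E x <= M * \1_E x by rewrite ler_peMl.
case: o => [[j|]|] /=.
- apply: le_trans h; have := w1 j; have := spectral_weight_ge0 alpha A j.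
  rewrite !indicE in_setI; case: (x \in E) => /=; last by rewrite mulr0 subr0 normr0.
  by move=> *; rewrite mulr1 ler_norml; case: (x \in F j) => /=;
    rewrite ?mulr1n ?mulr0n; apply/andP; split; lra.
- by rewrite normrN ger0_norm.
- by rewrite ger0_norm ?spread_ge0// spread_le.
Qed.

Let integral_indicQ B : measurable B -> (\int[Q]_z (\1_B z)%:E = (fine (Q B))%:E)%E.
Proof. by move=> mB; rewrite integral_indic// setIT; exact: Qfin. Qed.

Let integrable_indicQ B : measurable B -> Q.-integrable setT (EFin \o \1_B).
Proof.
move=> mB; apply: (@bounded_integrable _ _ _ Q _ 1); first exact: measurable_indic.
by move=> x; rewrite indicE; case: (_ \in _); rewrite ?normr1 ?normr0.
Qed.

Let statistic_le o : (\int[Q]_z (statistic o z)%:E <= (statistic_mean o * P)%:E)%E.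
Proof.
case: o => [[j|]|] /=.
- under eq_integral do rewrite EFinB EFinM.
  rewrite integralB//; last by apply: integrableZl => //; exact: integrable_indicQ.
    rewrite integralZl//; last exact: integrable_indicQ.
    rewrite !integral_indicQ// -EFinM -EFinB lee_fin.
    by have := Qsector j; lra.
  exact: integrable_indicQ.
- under eq_integral do rewrite -mulN1r EFinM.
  by rewrite integralZl ?integral_indicQ//; exact: integrable_indicQ.
- rewrite spreadE; under eq_integral do rewrite -sumEFin.
  have st0 j i z : (0 <= (spread_term j i z)%:E)%E.
    by rewrite lee_fin addr_ge0 ?mulr_ge0// sumr_ge0// => k _; rewrite mulr_ge0.
  rewrite ge0_integral_sum//; last 2 first.
  - move=> j; apply/measurable_EFinP; apply: measurable_sum => i.
    exact: measurable_spread_term.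
  - by move=> j z _; rewrite -sumEFin sume_ge0.
  apply: le_trans (_ : (\sum_(j < m) \sum_(i < m | i != j)
      (\sum_(k < K) 2^-1 ^+ k * fine (Q (E `&` F j `&` ray r i (2^-1 ^+ k.+1 * t / m%:R))) +
       2^-1 ^+ K * fine (Q (E `&` F j)))%:E <= _)%E); last first.
    by under eq_bigr do rewrite sumEFin; rewrite sumEFin lee_fin.
  apply: lee_sum => j _; under eq_integral do rewrite -sumEFin.
  rewrite ge0_integral_sum//; last first.
    by move=> i; apply/measurable_EFinP; exact: measurable_spread_term.
  rewrite big_filter; apply: lee_sum => i _.
  have ind0 B (z : m.-tuple R) k : (0 <= (2^-1 ^+ k * \1_B z : R)%:E)%E.
    by rewrite lee_fin mulr_ge0.
  have mind B k : measurable B -> measurable_fun [set: m.-tuple R]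
      (fun z => (2^-1 ^+ k * \1_B z : R)%:E).
    by move=> mB; apply/measurable_EFinP; apply: measurable_funM.
  have intind B k : measurable B ->
      (\int[Q]_z (2^-1 ^+ k * \1_B z : R)%:E = (2^-1 ^+ k * fine (Q B))%:E)%E.
    move=> mB; under eq_integral do rewrite EFinM.
    rewrite ge0_integralZl ?lee_fin//.
      by rewrite integral_indicQ.
    by apply/measurable_EFinP; exact: measurable_indic.
  under eq_integral do rewrite EFinD -sumEFin.
  rewrite ge0_integralD//; last 3 first.
  - by move=> z _; apply: sume_ge0.
  - by apply: emeasurable_sum => k; exact: mind.
  - exact: mind.
  rewrite ge0_integral_sum//; last by move=> k; exact: mind.
  under eq_bigr do rewrite intind//.
  by rewrite intind// sumEFin EFinD.
Qed.

(** The cost contributes a factor 2 and the m surpluses a factor m; the outer 2 comes from dividing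
    by at least half the expected number of exceedances. *)
Let rho := 2 * (m%:R + 2) * (b + 4 * M * Num.sqrt (L / (n%:R * P))).

Lemma deviation_event_sub :
  deviation_event (n := n) (@orthant R m) statistic statistic_mean M P L `<=`
  @tmap _ _ _ _ (apply_mx A) n @^-1` cheap_assignment A alpha t rho.
Proof.
move=> z [zO dev]; rewrite /preimage/=.
have nP0 : 0 <= n%:R * P by rewrite mulr_ge0// ltW.
set T := 4 * M * Num.sqrt (n%:R * P * L) in dev.
have T0 : 0 <= T by rewrite !mulr_ge0// sqrtr_ge0.
(* Squaring reduces this to [Lsmall], which is where 64 M^2 comes from. Consequently the number of
   exceedances is at least [n * P / 2]. *)
have TnP : T <= n%:R * P / 2.
  have -> : n%:R * P / 2 = Num.sqrt ((n%:R * P / 2) ^+ 2).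
    by rewrite sqrtr_sqr ger0_norm// divr_ge0.
  have -> : T = Num.sqrt ((4 * M) ^+ 2 * (n%:R * P * L)).
    by rewrite sqrtrM ?sqr_ge0// sqrtr_sqr ger0_norm// mulr_ge0// mulr_ge0// exprn_ge0.
  apply: ler_wsqrtr; have := ler_wpM2l nP0 Lsmall.
  rewrite !expr2; set x := n%:R * P; lra.
have nPp : 0 < n%:R * P.
  have Mp : 0 < M by apply: lt_le_trans M1.
  apply: lt_le_trans Lsmall; apply: mulr_gt0 => //; apply: mulr_gt0 => //.
  exact: exprn_gt0.
pose x := tmap (apply_mx A) z.
have exE i : excess t x i = \1_E (tnth z i).
  rewrite /excess indicE tnth_map norm1_apply_mx//; congr ((_ : bool)%:R).
  by apply/idP/idP; rewrite inE.
set N := \sum_i \1_E (tnth z i) : R.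
have NE : \sum_i excess t x i = N by apply: eq_bigr => i _; exact: exE.
have NP : n%:R * P / 2 <= N.
  by have := dev (Some None); rewrite /= sumrN -/N; lra.
have N0 : 0 < N by apply: lt_le_trans NP; rewrite divr_gt0.
have V0 : 0 <= n%:R * P * b + T by rewrite addr_ge0// mulr_ge0.
split; rewrite /= -/x ?NE//.
(* The default label is reached only by observations that do not exceed the threshold;
   [sector_cover] gives the others a sector. *)
pose sg := [ffun i => odflt (Ordinal m0) [pick j | tnth z i \in F j]].
have sgF i : tnth z i \in E -> F (sg i) (tnth z i).
  rewrite inE => zE; rewrite ffunE; case: pickP => [j|nF] /=; first by rewrite inE.
  have [j Fj] := sector_cover m0 (zO i) zE.
  by have := nF j; rewrite mem_set.
exists sg.
have h1 : \sum_i excess t x i * dist1 (angle (tnth x i)) (angle (column A (sg i))) <=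
    2 * (n%:R * P * b + T).
  have := dev None; rewrite -(ler_pM2l (_ : 0 < 2 :> R))//; apply: le_trans.
  rewrite mulr_sumr; apply: ler_sum => i _; rewrite exE indicE.
  have [zE|zE] := boolP (tnth z i \in E); last by rewrite mul0r mulr_ge0// spread_ge0.
  rewrite mul1r tnth_map; have zE' := zE; rewrite inE in zE'.
  have S1 : 0 < \sum_k norm1 (column A k) * tnth (tnth z i) k by exact: lt_trans zE'.
  apply: le_trans (dist1_angle_apply A0 (zO i) (r0 (sg i)) S1) _.
  rewrite ler_pM2l//; apply: spread_ge => //; exact: sgF.
have h2 : \sum_j Num.max 0 (\sum_i excess t x i * (sg i == j)%:R - w j * N) <=
    m%:R * (n%:R * P * b + T).
  apply: (@le_trans _ _ (\sum_(j < m) (n%:R * P * b + T))); last first.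
    by rewrite sumr_const card_ord -[leLHS]mulr_natl.
  apply: ler_sum => j _; rewrite ge_max V0 /=.
  apply: le_trans (dev (Some (Some j))); rewrite mulr_sumr -sumrB.
  apply: ler_sum => i _; rewrite lerD2r exE !indicE in_setI.
  have [zE|zE] := boolP (tnth z i \in E); last by rewrite mul0r.
  rewrite mul1r /=; case: eqVneq => [<-|_ //].
  by rewrite mem_set//; exact: sgF.
apply: le_trans (lerD h1 h2) _; rewrite -mulrDl.
apply: (@le_trans _ _ (rho * (n%:R * P / 2))); last first.
  by apply: ler_wpM2l NP; rewrite !mulr_ge0 ?addr_ge0 ?mulr_ge0 ?sqrtr_ge0.
have -> : T = 4 * M * (n%:R * P * Num.sqrt (L / (n%:R * P))).
  rewrite /T; congr (_ * _).
  rewrite (_ : n%:R * P * L = (n%:R * P) ^+ 2 * (L / (n%:R * P))).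
    by rewrite sqrtrM ?sqr_ge0// sqrtr_sqr ger0_norm.
  by move: nPp; set y := n%:R * P => y0; field; rewrite gt_eqF.
by rewrite /rho le_eqVlt; apply/orP; left; apply/eqP; field.
Qed.

Lemma finite_sample_bound :
  ((1 - (m.+2)%:R * expR (- L))%:E <= power_measure X n
     [set x | (wasserstein p (empirical_angular_measure t x)
                (spectral_measure alpha A) `^ p <= (2 `^ p * rho)%:E)%E])%E.
Proof.
have nPp : 0 <= n%:R * P by rewrite mulr_ge0// ltW.
have M0 : 0 < M by apply: lt_le_trans M1.
have LnP : L <= n%:R * P.
  apply: le_trans Lsmall; rewrite ler_peMl ?(ltW L0)//.
  have : 1 <= M ^+ 2 by rewrite exprn_ege1.
  by lra.
have := chernoff_family (n := n) mE (@measurable_orthant R m) measurable_statistic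
  (Qfin mE) Q1 M0 P0 (ltW L0) LnP statistic_bound statistic_le.
rewrite !card_option card_ord => /le_trans; apply.
apply: le_trans (power_measure_mono _ (@deviation_event_sub)) _.
rewrite -(power_measure_pushforward (nu := X) (@measurable_apply_mx R d m A))//.
- apply: power_measure_mono => x; apply: cheap_assignment_wasserstein => //.
  exact: sum_spectral_weight.
- exact: measurable_cheap_assignment.
Qed.

End finite_sample.

(** * Rates *)

Section rates.
Variables (R : realType) (d m : nat) (alpha p l u sigma s xi zeta theta : R).
Hypotheses (m0 : (0 < m)%N) (alpha0 : 0 < alpha) (p1 : 1 <= p).
Hypotheses (l0 : 0 < l) (l1 : l < 1) (u1 : 1 < u) (s0 : 0 < s) (s2 : s < 2^-1).
Hypotheses (xi0 : 0 < xi) (xi1 : xi < 1) (zeta0 : 0 < zeta).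
Hypotheses (theta0 : 0 < theta) (thetas : theta <= s).

(** For n >= 1 the summand 1 makes the threshold at least 1, and [u * zeta] puts it beyond the
    radius of exact proportionality, because |X|_1 <= u |Z|_1 and [theta <= s]. The maximum keeps it
    positive at n = 0. *)
Definition threshold (n : nat) : R :=
  (1 + u * zeta) * (maxn n 1)%:R `^ ((1 - 2 * theta) / alpha).

Let c0 : R := 1 + u * zeta.
Let c01 : 1 <= c0.
Proof. by rewrite lerDl mulr_ge0// ltW// (lt_trans _ u1). Qed.
Let c00 : 0 < c0. Proof. exact: lt_le_trans c01. Qed.

Let e1 : 0 < 1 - 2 * theta. Proof. by have := s2; have := thetas; lra. Qed.

Lemma threshold_gt0 n : 0 < threshold n.
Proof. by rewrite mulr_gt0// powR_gt0// ltr0n leq_max ltnSn orbT. Qed.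

Let thresholdE n : (1 <= n)%N -> threshold n = c0 * n%:R `^ ((1 - 2 * theta) / alpha).
Proof. by move=> n1; rewrite /threshold (maxn_idPl n1). Qed.

Let nexp_ge1 n (a : R) : (1 <= n)%N -> 0 <= a -> 1 <= n%:R `^ a :> R.
Proof.
by move=> n1 a0; rewrite -[leLHS](powRr0 (n%:R : R)); apply: ler_powR; rewrite ?ler1n.
Qed.

Let nexp_le n (a b : R) : (1 <= n)%N -> a <= b -> n%:R `^ a <= n%:R `^ b :> R.
Proof. by move=> n1 ab; apply: ler_powR; rewrite ?ler1n. Qed.

(** Serves both regimes: [theta] is the target exponent, and the number [K] of levels is left to the
    caller. Only [n0] and the factor with [ln eps] depend on [eps]. *)
Lemma sample_rate : exists C : R, 0 < C /\ forall eps : R, 0 < eps -> eps < 2^-1 ->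
  exists n0 : nat, forall (n K : nat) AL, (n0 <= n)%N -> (1 <= n)%N ->
    model d m alpha l u sigma s xi zeta AL ->
    ((1 - eps)%:E <= power_measure AL.2 n
      [set x | (wasserstein p (empirical_angular_measure (threshold n) x)
                (spectral_measure alpha AL.1) `^ p <=
        (C * (Num.sqrt (- ln eps) * n%:R `^ (- theta) +
           K.+1%:R * n%:R `^ (- ((1 - 2 * theta) / alpha * Num.min 1 alpha)) +
           2^-1 ^+ K))%:E)%E])%E.
Proof.
have [C1 [c1 [C10 c10 pop]]] :=
  near_pareto_population alpha0 l0 l1 u1 m0 s0 s2 xi0 xi1 zeta0.
pose c2 := c1 * c0 `^ (- alpha).
have c20 : 0 < c2 by rewrite mulr_gt0// powR_gt0.
have ln2 : 0 < ln 2 :> R by rewrite ln_gt0// ltr1n.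
pose M : R := 3 * m%:R ^+ 2.
have M0 : 0 < M by rewrite mulr_gt0// exprn_gt0// ltr0n.
(* Since [eps < 1/2], the logarithm of the number m + 2 of statistics is a bounded multiple of - ln
   eps; [lm] is the resulting factor in [L <= lm * le]. *)
pose lm : R := 1 + ln (m.+2)%:R / ln 2.
have lnm : 0 <= ln (m.+2)%:R :> R by rewrite ln_ge0// ler1n.
have lm0 : 0 < lm by rewrite ltr_pwDl// divr_ge0// ltW.
pose G : R := 2 `^ p * (2 * (m%:R + 2)).
have G0 : 0 < G by rewrite mulr_gt0 ?powR_gt0// mulr_gt0// ltr_wpDl.
pose q2 : R := (Num.sqrt (ln 2))^-1.
have q20 : 0 <= q2 by rewrite invr_ge0 sqrtr_ge0.
pose C3 := C1 * (q2 + 1) + 4 * M * Num.sqrt (lm / c2) + 1.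
have C30 : 0 < C3.
  by rewrite ltr_wpDl// addr_ge0// mulr_ge0 ?sqrtr_ge0 ?addr_ge0// mulr_ge0// ltW.
exists (G * C3); split; first exact: mulr_gt0.
move=> eps eps0 eps2.
have le2 : ln 2 <= - ln eps.
  by rewrite -lnV ?posrE// ler_ln ?posrE ?invr_gt0// -[leLHS]invrK lef_pV2 ?posrE ?ltW// invr_gt0.
set le := - ln eps in le2 *.
have le0 : 0 < le by exact: lt_le_trans le2.
(* Makes the union bound over the m + 2 deviations equal to [eps]. *)
pose L := ln (m.+2)%:R + le.
have L0 : 0 < L by rewrite ltr_wpDl.
have LE : (m.+2)%:R * expR (- L) = eps.
  rewrite /L opprD expRD expRN lnK ?posrE// mulrA mulfV ?pnatr_eq0// mul1r.
  by rewrite /le opprK lnK.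
have Lle : L <= lm * le.
  rewrite /L /lm [leRHS]mulrDl mul1r addrC lerD2l.
  by rewrite mulrAC ler_pdivlMr//; exact: ler_wpM2l.
pose B := 64 * M ^+ 2 * L / c2.
have B0 : 0 <= B by rewrite divr_ge0 ?(ltW c20)// !mulr_ge0 ?sqr_ge0 ?(ltW L0).
(* From this index on, the expected number of exceedances, at least c2 n^(2 theta), exceeds 64 M^2
   L. The dependence on [eps] goes into this index and not into the constant. *)
exists (Num.truncn (B `^ (2 * theta)^-1)).+1.
move=> n K [A X] n0 n1 [k k1 [[/= A0 Alu _] [Q Qk law]]].
have np : 0 < n%:R :> R by rewrite ltr0n.
have rlu j : l <= norm1 (column A j) <= u by exact: Alu.
set t := threshold n.
have tE : t = c0 * n%:R `^ ((1 - 2 * theta) / alpha) by exact: thresholdE.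
have ea : 0 <= (1 - 2 * theta) / alpha by rewrite divr_ge0 ?ltW.
have t1 : 1 <= t by rewrite tE mulr_ege1// nexp_ge1.
have t0 : 0 < t by exact: lt_le_trans t1.
have tn : u * zeta * n%:R `^ ((1 - 2 * s) / alpha) <= t.
  rewrite tE; apply: ler_pM; rewrite ?powR_ge0//.
  - by rewrite mulr_ge0// ltW// (lt_trans _ u1).
  - by rewrite /c0 lerDr.
  - by apply: nexp_le => //; rewrite ler_pM2r ?invr_gt0//; have := thetas; lra.
have [h1 h2 h3] := pop k n K Q _ t k1 n1 Qk rlu t1 tn.
set b := C1 * _ in h2 h3.
set r := fun j => norm1 (column A j) in h1 h2 h3.
set P := fine (Q (halfspace r t)) in h1 h2 h3.
have b0 : 0 <= b.
  by rewrite mulr_ge0// addr_ge0 ?exprn_ge0 ?invr_ge0// addr_ge0 ?mulr_ge0 ?powR_ge0.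
have P0 : 0 < P by apply: lt_le_trans h1; rewrite mulr_gt0// powR_gt0.
have nP : c2 * n%:R `^ (2 * theta) <= n%:R * P.
  apply: (@le_trans _ _ (n%:R * (c1 * t `^ (- alpha)))); last by rewrite ler_pM2l.
  rewrite tE powRM ?powR_ge0 ?(ltW c00)// -powRrM.
  have -> : (1 - 2 * theta) / alpha * - alpha = 2 * theta - 1.
    by field; rewrite gt_eqF.
  have -> : n%:R `^ (2 * theta) = n%:R * n%:R `^ (2 * theta - 1) :> R.
    by rewrite mulr_powRB1 ?(ltW np)// mulr_gt0.
  by rewrite le_eqVlt; apply/orP; left; apply/eqP; rewrite /c2; ring.
have Lsmall : 64 * M ^+ 2 * L <= n%:R * P.
  apply: le_trans nP; rewrite [leRHS]mulrC -ler_pdivrMr// -/B.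
  have -> : B = (B `^ (2 * theta)^-1) `^ (2 * theta).
    by rewrite -powRrM mulVf ?powRr1// gt_eqF// mulr_gt0.
  apply: ge0_ler_powR; rewrite ?nnegrE ?powR_ge0 ?mulr_ge0 ?(ltW theta0)//.
  by apply: le_trans (ltW (truncnS_gt _)) _; rewrite ler_nat.
have := @finite_sample_bound R d m n A alpha p t l u b L K Q X p1 m0 A0 l0 rlu t0 law
  (near_pareto_orthant Qk) P0 b0 L0 h2 h3 Lsmall.
rewrite LE => /le_trans; apply; apply: power_measure_mono => x /= /le_trans; apply.
rewrite lee_fin -/r -/P -/M [leLHS]mulrA -/G -[leRHS]mulrA ler_pM2l//.
set Y := Num.sqrt le * _; set Z := K.+1%:R * _; set V := 2^-1 ^+ K.
have Y0 : 0 <= Y by rewrite mulr_ge0 ?sqrtr_ge0 ?powR_ge0.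
have Z0 : 0 <= Z by rewrite mulr_ge0 ?powR_ge0.
have V0 : 0 <= V by rewrite exprn_ge0// invr_ge0.
have ns : n%:R `^ (- s) <= q2 * Y.
  apply: (@le_trans _ _ (n%:R `^ (- theta))); first by apply: nexp_le => //; rewrite lerN2.
  rewrite /Y mulrA ler_peMl ?powR_ge0// mulrC -/q2 ler_pdivlMr ?sqrtr_gt0// mul1r.
  exact: ler_wsqrtr.
have tg : K.+1%:R * t `^ (- Num.min 1 alpha) <= Z.
  rewrite ler_wpM2l// tE powRM ?powR_ge0 ?(ltW c00)// -powRrM mulrN.
  rewrite ler_piMl ?powR_ge0//; have := @powRN_le R (Num.min 1 alpha) 1 c0 _ ltr01 c01.
  by rewrite powR1; apply; rewrite le_min ler01 ltW.
have bb : b <= C1 * (q2 * Y + Z + V).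
  by rewrite ler_wpM2l// lerD2r lerD.
have sq : Num.sqrt (L / (n%:R * P)) <= Num.sqrt (lm / c2) * Y.
  have -> : Num.sqrt (lm / c2) * Y = Num.sqrt (lm * le / (c2 * n%:R `^ (2 * theta))).
    rewrite [_ * le / _](_ : _ = lm / c2 * (le * (n%:R `^ (- theta)) ^+ 2)); last first.
      have -> : n%:R `^ (2 * theta) = (n%:R `^ (- theta)) ^- 2 :> R.
        by rewrite -powR_mulrn ?powR_ge0// -powRrM -powRN; congr (_ `^ _); ring.
      have g0 : 0 < n%:R `^ (- theta) :> R by rewrite powR_gt0.
      by field; rewrite !gt_eqF.
    rewrite [RHS]sqrtrM ?divr_ge0 ?(ltW lm0) ?(ltW c20)//; congr (_ * _).
    by rewrite [RHS]sqrtrM ?(ltW le0)// sqrtr_sqr ger0_norm ?powR_ge0.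
  apply: ler_wsqrtr; apply: ler_pM; rewrite ?(ltW L0) ?invr_ge0 ?mulr_ge0 ?(ltW P0)//.
  by rewrite lef_pV2 ?posrE// ?mulr_gt0 ?powR_gt0.
have h5 : 4 * M * Num.sqrt (L / (n%:R * P)) <= 4 * M * (Num.sqrt (lm / c2) * Y).
  by rewrite ler_wpM2l// mulr_ge0// ltW.
apply: le_trans (lerD bb h5) _.
rewrite /C3; set w := Num.sqrt (lm / c2).
have w0 : 0 <= w by exact: sqrtr_ge0.
have Mw0 : 0 <= M * w by rewrite mulr_ge0// ltW.
have := mulr_ge0 (mulr_ge0 C10 q20) Z0; have := mulr_ge0 (mulr_ge0 C10 q20) V0.
have := mulr_ge0 C10 Y0; have := mulr_ge0 Mw0 Z0; have := mulr_ge0 Mw0 V0.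
lra.
Qed.

End rates.

(** * Limits, number of levels and exponents *)

Section asymptotic_choices.
Variable R : realType.

Lemma limn_einf_ge (v : nat -> \bar R) (a : \bar R) (n0 : nat) :
  (forall n, (n0 <= n)%N -> (a <= v n)%E) -> (a <= limn_einf v)%E.
Proof.
move=> av; rewrite limn_einf_lim.
apply: (@le_trans _ _ (einfs v n0)).
  by apply: le_ereal_inf_tmp => _ [n /= n0n <-]; exact: av.
have /ereal_nondecreasing_cvgn h := nondecreasing_einfs v.
rewrite (cvg_lim _ h)//; apply: ereal_sup_ubound; by exists n0.
Qed.

Lemma inf_prob_ge (d m n : nat) (alpha p l u sigma s xi zeta tau rho : R) (a : \bar R) :
  (forall AL, model d m alpha l u sigma s xi zeta AL -> (a <= power_measure AL.2 n
      [set x | (wasserstein p (empirical_angular_measure tau x)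
                (spectral_measure alpha AL.1) `^ p <= rho%:E)%E])%E) ->
  (a <= inf_prob d m alpha p l u sigma s xi zeta n tau rho)%E.
Proof. by move=> h; apply: le_ereal_inf_tmp => _ [AL mAL <-]; exact: h. Qed.

(** With K = [up_log 2 n] one has K - 1 <= ln n / ln 2, hence K + 1 <= ln n / ln 2 + 2, and the 2 is
    absorbed once ln n >= 1. *)
Definition level_const : R := 2 + (ln 2)^-1.

Let ln2 : 0 < ln 2 :> R. Proof. by rewrite ln_gt0// ltr1n. Qed.

Lemma level_const_gt0 : 0 < level_const.
Proof. by rewrite addr_gt0// invr_gt0. Qed.

(* [up_log 2 n] dyadic levels reach the scale [1/n]. *)
Lemma up_log_levels (n : nat) : (2 <= n)%N -> 1 <= ln n%:R :> R ->
  2^-1 ^+ up_log 2 n <= n%:R^-1 :> R /\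
  (up_log 2 n).+1%:R <= level_const * ln n%:R.
Proof.
move=> n2 ln1; have /andP[h1 h2] := up_log_bounds (isT : (1 < 2)%N) n2.
have np : 0 < n%:R :> R by rewrite ltr0n (leq_trans _ n2).
split.
  by rewrite exprVn lef_pV2 ?posrE ?exprn_gt0// -natrX ler_nat.
have k0 : (0 < up_log 2 n)%N by rewrite lt0n; apply: contraTneq h2 => ->; rewrite -ltnNge.
have : (up_log 2 n).-1%:R * ln 2 <= ln n%:R :> R.
  rewrite mulr_natl -lnXn// ler_ln ?posrE ?exprn_gt0//.
  by rewrite -natrX ler_nat ltnW.
rewrite -ler_pdivlMr// => h.
rewrite -(prednK k0) -!natr1 /level_const mulrDl [_^-1 * _]mulrC.
by apply: (@le_trans _ _ (ln n%:R / ln 2 + 1 + 1)); lra.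
Qed.

Lemma ln_ge1_eventually : exists n0 : nat, forall n, (n0 <= n)%N ->
  (2 <= n)%N /\ 1 <= ln n%:R :> R.
Proof.
exists (Num.truncn (expR 1 : R)).+2 => n n0; split.
  by apply: leq_trans n0; rewrite ltnS.
have np : 0 < n%:R :> R by rewrite ltr0n (leq_trans _ n0).
rewrite -[leLHS](expRK 1) ler_ln ?posrE ?expR_gt0//.
apply: le_trans (ltW (truncnS_gt _)) _; rewrite ler_nat; exact: ltnW.
Qed.

Lemma sqrt_ln_half (eps : R) : 0 < eps -> eps < 2^-1 ->
  0 <= - ln eps /\ 1 <= (Num.sqrt (ln 2))^-1 * Num.sqrt (- ln eps).
Proof.
move=> eps0 eps2.
have le2 : ln 2 <= - ln eps.
  by rewrite -lnV ?posrE// ler_ln ?posrE ?invr_gt0// -[leLHS]invrK lef_pV2 ?posrE ?ltW// invr_gt0.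
split; first exact: le_trans (ltW ln2) le2.
by rewrite mulrC ler_pdivlMr ?sqrtr_gt0// mul1r ler_wsqrtr.
Qed.

Lemma critical_exponent (alpha : R) : 0 < alpha ->
  (1 - 2 * (2 + Num.max 1 alpha)^-1) / alpha = (Num.min (2 + alpha) (3 * alpha))^-1.
Proof.
move=> a0; case: (leP 1 alpha) => a1.
  have -> : Num.min (2 + alpha) (3 * alpha) = 2 + alpha by apply/min_idPl; lra.
  by field; rewrite !gt_eqF//; lra.
have -> : Num.min (2 + alpha) (3 * alpha) = 3 * alpha by apply/min_idPr; lra.
by field; rewrite gt_eqF.
Qed.

(** Because min(1, alpha) * max(1, alpha) = alpha. *)
Lemma bias_exponent (alpha th : R) : 0 < alpha ->
  (1 - 2 * th) / alpha * Num.min 1 alpha = (1 - 2 * th) / Num.max 1 alpha.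
Proof.
move=> a0; case: (leP 1 alpha) => a1; first by rewrite mulr1.
by rewrite divr1 divfK// gt_eqF.
Qed.

(** Equivalent to th (2 + max 1 alpha) <= 1: this is the balance between fluctuations n^(-th) and
    bias that defines the critical exponent. *)
Lemma bias_exponent_ge (alpha th : R) : 0 < alpha -> th <= (2 + Num.max 1 alpha)^-1 ->
  th <= (1 - 2 * th) / alpha * Num.min 1 alpha.
Proof.
move=> a0; rewrite bias_exponent//; set x := Num.max 1 alpha.
have x1 : 1 <= x by rewrite le_max lexx.
have x0 : 0 < 2 + x by lra.
by rewrite -[X in _ <= X -> _]div1r !ler_pdivlMr//; lra.
Qed.

Lemma bias_exponent_gt (alpha th : R) : 0 < alpha -> th < (2 + Num.max 1 alpha)^-1 ->
  th < (1 - 2 * th) / alpha * Num.min 1 alpha.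
Proof.
move=> a0; rewrite bias_exponent//; set x := Num.max 1 alpha.
have x1 : 1 <= x by rewrite le_max lexx.
have x0 : 0 < 2 + x by lra.
by rewrite -[X in _ < X -> _]div1r !ltr_pdivlMr//; lra.
Qed.

Lemma ln_le_powR (x e : R) : 0 < x -> 0 < e -> ln x <= e^-1 * x `^ e.
Proof.
move=> x0 e0; rewrite mulrC ler_pdivlMr// mulrC -ln_powR.
by apply/ltW/ln_sublinear; rewrite powR_gt0.
Qed.

End asymptotic_choices.

Theorem theorem3p1 (R : realType) (d m : nat)
    (alpha p l u sigma s xi zeta : R)
    (hd : (2 <= d)%N) (hdm : (d <= m)%N) (halpha : 0 < alpha) (hp : 1 <= p)
    (hl0 : 0 < l) (hl1 : l < 1) (hu : 1 < u) (hsigma : 0 < sigma)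
    (hs0 : 0 < s) (hs2 : s < 2^-1) (hxi0 : 0 < xi) (hxi1 : xi < 1)
    (hzeta : 0 < zeta) :
  ((2 + Num.max 1 alpha)^-1 <= s ->
    exists tau : nat -> R,
      [/\ forall n, 0 < tau n,
          Theta_polylog tau
            (fun n => n%:R `^ (Num.min (2 + alpha) (3 * alpha))^-1) &
          exists C q : R, [/\ 0 < C, 0 <= q &
            forall eps : R, 0 < eps -> eps < 2^-1 ->
              ((1 - eps)%R%:E <= limn_einf (fun n : nat =>
                inf_prob d m alpha p l u sigma s xi zeta n (tau n)
                  (C * ln n%:R `^ q * (- ln eps) `^ 2^-1
                     * n%:R `^ (- (2 + Num.max 1 alpha)^-1))%R))%E]])
  /\
  (s < (2 + Num.max 1 alpha)^-1 ->
    exists tau : nat -> R,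
      [/\ forall n, 0 < tau n,
          Theta tau (fun n => n%:R `^ ((1 - 2 * s) / alpha)) &
          exists C : R, 0 < C /\
            forall eps : R, 0 < eps -> eps < 2^-1 ->
              ((1 - eps)%R%:E <= limn_einf (fun n : nat =>
                inf_prob d m alpha p l u sigma s xi zeta n (tau n)
                  (C * (- ln eps) `^ 2^-1 * n%:R `^ (- s))%R))%E]).
Proof.
have m0 : (0 < m)%N by apply: leq_trans hdm; exact: leq_trans hd.
have u0 : 0 < u by lra.
have c0 : 0 < 1 + u * zeta by rewrite addr_gt0// mulr_gt0.
set beta := (2 + Num.max 1 alpha)^-1.
have mx : 1 <= Num.max 1 alpha by rewrite le_max lexx.
have beta0 : 0 < beta by rewrite invr_gt0; lra.
have beta1 : beta <= 1 by rewrite invf_le1; lra.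
pose q2 : R := (Num.sqrt (ln 2))^-1.
have q20 : 0 <= q2 by rewrite invr_ge0 sqrtr_ge0.
have a0 := level_const_gt0 R; set a := level_const R in a0.
have [n1 n1P] := ln_ge1_eventually R.
have natP n : (n1 <= n)%N -> [/\ (1 <= n)%N, 0 < n%:R :> R,
    2^-1 ^+ up_log 2 n <= n%:R `^ (- 1) :> R,
    1 <= ln n%:R :> R & (up_log 2 n).+1%:R <= a * ln n%:R].
  move=> /n1P[n2 lnn]; have [h1 h2] := up_log_levels n2 lnn.
  have np : 0 < n%:R :> R by rewrite ltr0n (leq_trans _ n2).
  by split => //; [exact: leq_trans n2|rewrite powR_inv1// ltW].
have ratioE th n : (1 <= n)%N ->
    threshold alpha u zeta th n / n%:R `^ ((1 - 2 * th) / alpha) = 1 + u * zeta.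
  move=> n1'; rewrite /threshold (maxn_idPl n1') mulfK// gt_eqF// powR_gt0// ltr0n//.
split => hs.
  exists (threshold alpha u zeta beta); split.
  - by move=> n; apply: threshold_gt0.
  (* The threshold is an exact multiple of the power of n, so the logarithmic factor has exponent
     0. *)
  - exists (1 + u * zeta), (1 + u * zeta), 0; split => //.
    exists 1%N => // n /= n1'; rewrite -critical_exponent// -/beta ratioE//.
    by rewrite oppr0 powRr0 mulr1 lexx.
  have [C [C0 rate]] := @sample_rate R d m alpha p l u sigma s xi zeta beta
    m0 halpha hp hl0 hl1 hu hs0 hs2 hxi0 hxi1 hzeta beta0 hs.
  have nu := bias_exponent_ge halpha (lexx beta).
  set v := (1 - 2 * beta) / alpha * Num.min 1 alpha in rate nu.
  (* At the critical exponent bias and fluctuations have the same power of n, so the factor K + 1 <=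
     a ln n survives and q = 1. The summands 1, a and 1 pay for the fluctuations, the levels and the
     remainder 2^-K; [q2] supplies the factor sqrt(- ln eps) missing from the last two. *)
  exists (C * (1 + (a + 1) * q2)), 1; split => //.
    by rewrite mulr_gt0// ltr_pwDl// mulr_ge0// addr_ge0 ?(ltW a0).
  move=> eps eps0 eps2; have [n0 n0P] := rate eps eps0 eps2.
  have [le0 le1] := sqrt_ln_half eps0 eps2; rewrite -/q2 in le1.
  apply: (@limn_einf_ge _ _ _ (maxn n0 n1)) => n; rewrite geq_max => /andP[nn0 nn1].
  have [n1' np lev1 lnn lev2] := natP n nn1.
  have ln0 : 0 <= ln n%:R :> R by exact: le_trans lnn.
  apply: inf_prob_ge => AL mAL.
  apply: le_trans (n0P n (up_log 2 n) AL nn0 n1' mAL) _.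
  apply: power_measure_mono => x /= /le_trans; apply.
  rewrite lee_fin powRr1// powR12_sqrt// -!mulrA ler_pM2l//.
  set N := n%:R `^ (- beta); have N0 : 0 <= N by exact: powR_ge0.
  set S := Num.sqrt (- ln eps) in le1 *; have S0 : 0 <= S by exact: sqrtr_ge0.
  have nb : n%:R `^ (- v) <= N by apply: ler_powR; [rewrite ler1n|rewrite lerN2].
  have h1 : (up_log 2 n).+1%:R * n%:R `^ (- v) <= a * ln n%:R * N.
    by apply: ler_pM; rewrite ?powR_ge0.
  have h2 : 2^-1 ^+ up_log 2 n <= N.
    by apply: le_trans lev1 _; apply: ler_powR; rewrite ?ler1n// lerN2.
  have h3 := ler_wpM2r (mulr_ge0 S0 N0) lnn.
  have h4 := ler_wpM2r (mulr_ge0 (mulr_ge0 (ltW a0) ln0) N0) le1.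
  have h5 := ler_wpM2r N0 le1.
  have h6 := ler_wpM2r (mulr_ge0 (mulr_ge0 q20 S0) N0) lnn.
  lra.
exists (threshold alpha u zeta s); split.
- by move=> n; apply: threshold_gt0.
- exists (1 + u * zeta), (1 + u * zeta); split => //.
  by exists 1%N => // n /= n1'; rewrite ratioE// lexx.
have [C [C0 rate]] := @sample_rate R d m alpha p l u sigma s xi zeta s
  m0 halpha hp hl0 hl1 hu hs0 hs2 hxi0 hxi1 hzeta hs0 (lexx s).
have nu := bias_exponent_gt halpha hs.
set v := (1 - 2 * s) / alpha * Num.min 1 alpha in rate nu.
have de0 : 0 < v - s by rewrite subr_gt0.
(* Below the critical exponent the bias decays like n^(-v) with v > s, and ln n <= n^(v - s) / (v -
   s) absorbs the logarithm into the gap. *)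
pose a' := a / (v - s); have a'0 : 0 <= a' by rewrite divr_ge0 ?(ltW a0) ?(ltW de0).
exists (C * (1 + (a' + 1) * q2)); split.
  by rewrite mulr_gt0// ltr_pwDl// mulr_ge0// addr_ge0.
move=> eps eps0 eps2; have [n0 n0P] := rate eps eps0 eps2.
have [le0 le1] := sqrt_ln_half eps0 eps2; rewrite -/q2 in le1.
apply: (@limn_einf_ge _ _ _ (maxn n0 n1)) => n; rewrite geq_max => /andP[nn0 nn1].
have [n1' np lev1 lnn lev2] := natP n nn1.
apply: inf_prob_ge => AL mAL.
apply: le_trans (n0P n (up_log 2 n) AL nn0 n1' mAL) _.
apply: power_measure_mono => x /= /le_trans; apply.
rewrite lee_fin powR12_sqrt// -!mulrA ler_pM2l//.
set N := n%:R `^ (- s); have N0 : 0 <= N by exact: powR_ge0.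
set S := Num.sqrt (- ln eps) in le1 *; have S0 : 0 <= S by exact: sqrtr_ge0.
have h1 : (up_log 2 n).+1%:R * n%:R `^ (- v) <= a' * N.
  apply: (@le_trans _ _ (a * ((v - s)^-1 * n%:R `^ (v - s)) * n%:R `^ (- v))).
    apply: ler_wpM2r; first exact: powR_ge0.
    by apply: le_trans lev2 _; rewrite ler_pM2l//; exact: ln_le_powR.
  have -> : N = n%:R `^ (v - s) * n%:R `^ (- v).
    by rewrite -powRD ?(gt_eqF np) ?implybT//; congr (_ `^ _); ring.
  by rewrite le_eqVlt; apply/orP; left; apply/eqP; rewrite /a'; ring.
have h2 : 2^-1 ^+ up_log 2 n <= N.
  by apply: le_trans lev1 _; apply: ler_powR; rewrite ?ler1n// lerN2; lra.
have h4 := ler_wpM2r (mulr_ge0 a'0 N0) le1.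
have h5 := ler_wpM2r N0 le1.
lra.
Qed.
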